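(* Let $n\geqslant 1$, let $A,B\in\mathbb{C}$, let $L=\sum_{0<|\alpha|\leqslant m}c_\alpha\partial^\alpha$ be a differential operator on $\mathbb{T}^n$ with constant coefficients $c_\alpha\in\mathbb{C}$, and let $P$ be the operator $Pu=Lu-Au-B\bar u$. Then $P$ is solvable if and only if $P$ is globally hypoelliptic.
   Context: $\mathbb{T}^n\simeq\mathbb{R}^n/2\pi\mathbb{Z}^n$ is the $n$-dimensional torus, $\mathcal{C}^\infty(\mathbb{T}^n)$ is the space of smooth complex-valued functions on it, and $\mathscr{D}'(\mathbb{T}^n)$ is the space of distributions on it. The sum defining $L$ runs over multi-indices $\alpha\in\mathbb{N}_0^n$ with $0<|\alpha|\leqslant m$. The operator $P$ maps $\mathcal{C}^\infty(\mathbb{T}^n)$ to itself and extends to $\mathscr{D}'(\mathbb{T}^n)$ in the usual way, where $\bar u$ denotes the complex conjugate distribution, $\langle\bar u,\varphi\rangle=\overline{\langle u,\bar\varphi\rangle}$. Solvability: the operator $P:\mathcal{C}^\infty(\mathbb{T}^n)\to\mathcal{C}^\infty(\mathbb{T}^n)$ is called solvable if there exists a subspace $\mathcal{F}\subset\mathcal{C}^\infty(\mathbb{T}^n)$ of finite codimension such that for all $f\in\mathcal{F}$ there exists $u\in\mathcal{C}^\infty(\mathbb{T}^n)$ with $Pu=f$. Global hypoellipticity: $P$ is called globally hypoelliptic if $u\in\mathscr{D}'(\mathbb{T}^n)$ and $Pu\in\mathcal{C}^\infty(\mathbb{T}^n)$ imply $u\in\mathcal{C}^\infty(\mathbb{T}^n)$.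 *)

(* Defs.v *)
From HB Require Import structures.
From mathcomp Require Import all_boot all_order all_algebra.
From mathcomp Require Import complex.
From mathcomp Require Import all_classical all_reals all_analysis.

Set Implicit Arguments.
Unset Strict Implicit.
Unset Printing Implicit Defensive.

Import Order.TTheory GRing.Theory Num.Theory.
Import numFieldNormedType.Exports.

Local Open Scope classical_set_scope.
Local Open Scope ring_scope.
Local Open Scope complex_scope.

(* A function on the torus R^n / 2 pi Z^n is a function on 'rV[R]_n that is
   2 pi periodic in each coordinate.  R[i] has no normed R-module structure,
   so limits, derivatives and integrals are taken on real and imaginary parts. *)

Definition partial (R : realType) (n : nat) (j : 'I_n)
    (f : 'rV[R]_n -> R[i]) : 'rV[R]_n -> R[i] :=
  fun x => 'D_('e_j) (@complex.Re R \o f) x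
        +i* 'D_('e_j) (@complex.Im R \o f) x.

Definition iter_partial (R : realType) (n : nat) (s : seq 'I_n)
    (f : 'rV[R]_n -> R[i]) : 'rV[R]_n -> R[i] :=
  foldr (@partial R n) f s.

Definition continuous_pderivable (R : realType) (n : nat)
    (g : 'rV[R]_n -> R) : Prop :=
  continuous g /\ forall (j : 'I_n) x, derivable g x ('e_j).

(* C^oo: all iterated partial derivatives, in any order, exist and are
   continuous. *)
Definition smooth (R : realType) (n : nat) (f : 'rV[R]_n -> R[i]) : Prop :=
  forall s : seq 'I_n,
    continuous_pderivable (@complex.Re R \o iter_partial s f) /\
    continuous_pderivable (@complex.Im R \o iter_partial s f).

Definition torus_periodic (R : realType) (n : nat)
    (f : 'rV[R]_n -> R[i]) : Prop :=
  forall j : 'I_n, periodic f ((2 * pi) *: 'e_j).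

Definition torus_Cinf (R : realType) (n : nat) : {pred ('rV[R]_n -> R[i])} :=
  fun f => `[< smooth f /\ torus_periodic f >].
Arguments torus_Cinf : clear implicits.

Lemma continuous_pderivable0 (R : realType) (n : nat) :
  continuous_pderivable (fun _ : 'rV[R]_n => 0 : R).
Proof.
split=> [x|j x]; first exact: (@cst_continuous _ _ (0 : R)).
exact: (@derivable_cst R _ _ (0 : R)).
Qed.

Lemma continuous_pderivableZD (R : realType) (n : nat) (a b : R)
    (f g h : 'rV[R]_n -> R) :
  continuous_pderivable f -> continuous_pderivable g ->
  continuous_pderivable h ->
  continuous_pderivable (a \*: f + b \*: g + h).
Proof.
move=> [cf df] [cg dg] [ch dh]; split.
- move=> x; apply: continuousD; last exact: ch.
  by apply: continuousD; apply: continuousZl_tmp; [exact: cf|exact: cg].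
- move=> j x; apply: derivableD; last exact: dh.
  by apply: derivableD; apply: derivableZ; [exact: df|exact: dg].
Qed.

Lemma ReZD (R : realType) (n : nat) (a : R[i]) (f g : 'rV[R]_n -> R[i]) :
  @complex.Re R \o (fun x => a * f x + g x) =
  complex.Re a \*: (@complex.Re R \o f) +
  (- complex.Im a) \*: (@complex.Im R \o f) + (@complex.Re R \o g).
Proof.
apply/funext => x; rewrite !fctE /=.
case: a => a1 a2; case: (f x) => f1 f2; case: (g x) => g1 g2 /=.
by rewrite /GRing.scale/= mulNr.
Qed.

Lemma ImZD (R : realType) (n : nat) (a : R[i]) (f g : 'rV[R]_n -> R[i]) :
  @complex.Im R \o (fun x => a * f x + g x) =
  complex.Im a \*: (@complex.Re R \o f) +
  complex.Re a \*: (@complex.Im R \o f) + (@complex.Im R \o g).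
Proof.
apply/funext => x; rewrite !fctE /=.
case: a => a1 a2; case: (f x) => f1 f2; case: (g x) => g1 g2 /=.
by rewrite /GRing.scale/= [a2 * f1 + _]addrC.
Qed.

Lemma deriveZDD (R : realType) (n : nat) (a b : R) (f g h : 'rV[R]_n -> R)
    (x v : 'rV[R]_n) :
  derivable f x v -> derivable g x v -> derivable h x v ->
  'D_v (a \*: f + b \*: g + h) x = a * 'D_v f x + b * 'D_v g x + 'D_v h x.
Proof.
move=> df dg dh; have daf := derivableZ (k := a) df.
have dbg := derivableZ (k := b) dg.
by rewrite deriveD ?deriveD ?deriveZ//; exact: derivableD.
Qed.

Lemma iter_partialZD (R : realType) (n : nat) (a : R[i])
    (f g : 'rV[R]_n -> R[i]) (s : seq 'I_n) : smooth f -> smooth g ->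
  iter_partial s (fun x => a * f x + g x) =
  (fun x => a * iter_partial s f x + iter_partial s g x).
Proof.
move=> sf sg; elim: s => [//|j s IHs] /=.
rewrite -/(iter_partial s _) IHs; apply/funext => x.
have [[_ dRf] [_ dIf]] := sf s; have [[_ dRg] [_ dIg]] := sg s.
rewrite /partial ReZD ImZD !deriveZDD//.
by case: a {IHs} => a1 a2; rewrite mulNr; congr (_ +i* _); rewrite [a2 * _ + _]addrC.
Qed.

Lemma smoothZD (R : realType) (n : nat) (a : R[i]) (f g : 'rV[R]_n -> R[i]) :
  smooth f -> smooth g -> smooth (fun x => a * f x + g x).
Proof.
move=> sf sg s; rewrite (iter_partialZD a s sf sg) ReZD ImZD.
have [Rf If] := sf s; have [Rg Ig] := sg s.
by split; apply: continuous_pderivableZD.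
Qed.

Lemma iter_partial0 (R : realType) (n : nat) (s : seq 'I_n) :
  iter_partial s (fun _ : 'rV[R]_n => 0) = (fun=> 0).
Proof.
elim: s => [//|j s IHs] /=; rewrite -/(iter_partial s _) IHs.
apply/funext => x; rewrite /partial.
by congr (_ +i* _); exact: (@derive_cst R _ _ (0 : R)).
Qed.

Lemma smooth0 (R : realType) (n : nat) : smooth (fun _ : 'rV[R]_n => 0).
Proof.
by move=> s; rewrite iter_partial0; split; exact: continuous_pderivable0.
Qed.

Lemma torus_Cinf_submod_closed (R : realType) (n : nat) :
  submod_closed (torus_Cinf R n).
Proof.
split.
  by apply/asboolP; split=> [|j x]; [exact: smooth0|].
move=> a f g /asboolP[sf pf] /asboolP[sg pg]; apply/asboolP; split.
  exact: smoothZD.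
by move=> j x; rewrite !fctE pf pg.
Qed.

HB.instance Definition _ (R : realType) (n : nat) :=
  GRing.isSubmodClosed.Build R[i] ('rV[R]_n -> R[i]) (torus_Cinf R n)
    (@torus_Cinf_submod_closed R n).

Record Cinf (R : realType) (n : nat) := MkCinf {
  Cinf_fun :> 'rV[R]_n -> R[i] ;
  _ : Cinf_fun \in torus_Cinf R n }.

HB.instance Definition _ (R : realType) (n : nat) :=
  [isSub for @Cinf_fun R n].
HB.instance Definition _ (R : realType) (n : nat) :=
  [Choice of Cinf R n by <:].
HB.instance Definition _ (R : realType) (n : nat) :=
  [SubChoice_isSubLmodule of Cinf R n by <:].

Definition Cinf_of (R : realType) (n : nat) (f : 'rV[R]_n -> R[i])
    (fC : smooth f /\ torus_periodic f) : Cinf R n :=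
  MkCinf (introT (asboolP _) fC).

Lemma CinfP (R : realType) (n : nat) (f : Cinf R n) :
  smooth f /\ torus_periodic f.
Proof. by case: f => f fC; exact/asboolP. Qed.

Lemma derive_periodic (R : realType) (n : nat) (g : 'rV[R]_n -> R)
    (T v x : 'rV[R]_n) : periodic g T -> 'D_v g (x + T) = 'D_v g x.
Proof.
move=> pg; rewrite /derive.
suff -> : (fun h : R => h^-1 *: ((g \o shift (x + T)) (h *: v) - g (x + T))) =
          (fun h => h^-1 *: ((g \o shift x) (h *: v) - g x)) by [].
by apply/funext => h /=; rewrite addrA !pg.
Qed.

Lemma partial_Cinf (R : realType) (n : nat) (j : 'I_n) (f : Cinf R n) :
  smooth (partial j f) /\ torus_periodic (partial j f).
Proof.
have [sf pf] := CinfP f; split=> [s|k x].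
  rewrite (_ : iter_partial s _ = iter_partial (rcons s j) f)//.
  by rewrite /iter_partial foldr_rcons.
by rewrite /partial; congr (_ +i* _);
  apply: derive_periodic => y; rewrite /= pf.
Qed.

Lemma conj_Cinf (R : realType) (n : nat) (f : Cinf R n) :
  smooth (fun x => (f x)^*) /\ torus_periodic (fun x => (f x)^*).
Proof.
have [sf pf] := CinfP f; split=> [s|j x]; last by rewrite pf.
have ReC (g : 'rV[R]_n -> R[i]) :
    @complex.Re R \o (fun x => (g x)^*) = @complex.Re R \o g.
  by apply/funext => x /=; case: (g x).
have ImC (g : 'rV[R]_n -> R[i]) :
    @complex.Im R \o (fun x => (g x)^*) = - (@complex.Im R \o g).
  by apply/funext => x; rewrite !fctE /=; case: (g x).
have -> : iter_partial s (fun x => (f x)^*) = (fun x => (iter_partial s f x)^*).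
  elim: s => [//|j s IHs] /=; rewrite -/(iter_partial s _) IHs.
  apply/funext => x; rewrite /partial ReC ImC deriveN//.
  by have [_ [_ +]] := sf s; apply.
rewrite ReC ImC; have [Rf [cIf dIf]] := sf s; split=> //; split=> [x|j x].
  by apply: continuousN; exact: cIf.
by apply: derivableN; exact: dIf.
Qed.

Definition pderiv (R : realType) (n : nat) (j : 'I_n) (f : Cinf R n) :
  Cinf R n := Cinf_of (partial_Cinf j f).

Definition conjf (R : realType) (n : nat) (f : Cinf R n) : Cinf R n :=
  Cinf_of (conj_Cinf f).

(* A multi-index of order at most m has all its entries at most m, hence sums
   over such multi-indices are indexed by {ffun 'I_n -> 'I_m.+1}. *)
Definition mabs (n m : nat) (a : {ffun 'I_n -> 'I_m.+1}) : nat :=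
  (\sum_(j < n) a j)%N.

Definition mderiv (R : realType) (n m : nat) (a : {ffun 'I_n -> 'I_m.+1})
    (f : Cinf R n) : Cinf R n :=
  foldr (fun j => iter (a j) (pderiv j)) f (enum 'I_n).

Definition diffop (R : realType) (n m : nat)
    (c : {ffun 'I_n -> 'I_m.+1} -> R[i]) (f : Cinf R n) : Cinf R n :=
  \sum_(a : {ffun 'I_n -> 'I_m.+1} | (0 < mabs a <= m)%N) c a *: mderiv a f.

Definition operP (R : realType) (n m : nat)
    (c : {ffun 'I_n -> 'I_m.+1} -> R[i]) (A B : R[i]) (u : Cinf R n) :
    Cinf R n :=
  diffop c u - A *: u - B *: conjf u.

Definition finite_codim (K : fieldType) (V : lmodType K) (F : {pred V}) : Prop :=
  exists s : seq V, forall f : V, exists2 h : V, h \in F &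
    exists b : 'I_(size s) -> K, f = h + \sum_(i < size s) b i *: s`_i.

Definition solvable (R : realType) (n : nat) (P : Cinf R n -> Cinf R n) : Prop :=
  exists F : {pred Cinf R n},
    [/\ submod_closed F, finite_codim F &
        forall f, f \in F -> exists u, P u = f].

Definition supnorm (R : realType) (n : nat) (f : Cinf R n) : R :=
  sup [set Normc.normc (f x) | x in [set: 'rV[R]_n]].

Definition Cnorm (R : realType) (n N : nat) (f : Cinf R n) : R :=
  \sum_(a : {ffun 'I_n -> 'I_N.+1} | (mabs a <= N)%N) supnorm (mderiv a f).

(* Distributions are the linear functionals that are continuous for the
   Frechet topology given by the norms Cnorm N. *)
Definition is_distribution (R : realType) (n : nat) (u : Cinf R n -> R[i]) :
    Prop :=
  linear_for *%R u /\
  exists (K : R) (N : nat), forall f : Cinf R n,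
    Normc.normc (u f) <= K * Cnorm N f.

Definition conjd (R : realType) (n : nat) (u : Cinf R n -> R[i]) :
    Cinf R n -> R[i] :=
  fun f => (u (conjf f))^*.

Definition mderivd (R : realType) (n m : nat) (a : {ffun 'I_n -> 'I_m.+1})
    (u : Cinf R n -> R[i]) : Cinf R n -> R[i] :=
  fun f => (-1) ^+ mabs a * u (mderiv a f).

Definition diffopd (R : realType) (n m : nat)
    (c : {ffun 'I_n -> 'I_m.+1} -> R[i]) (u : Cinf R n -> R[i]) :
    Cinf R n -> R[i] :=
  \sum_(a : {ffun 'I_n -> 'I_m.+1} | (0 < mabs a <= m)%N) c a *: mderivd a u.

Definition operPd (R : realType) (n m : nat)
    (c : {ffun 'I_n -> 'I_m.+1} -> R[i]) (A B : R[i])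
    (u : Cinf R n -> R[i]) : Cinf R n -> R[i] :=
  diffopd c u - A *: u - B *: conjd u.

(* Iterated integral over [0, 2 pi]^n. *)
Fixpoint cube_int (R : realType) (n : nat) : ('rV[R]_n -> R) -> R :=
  match n with
  | 0 => fun g => g 0
  | n'.+1 => fun g => \int[@lebesgue_measure R]_(t in `[0, 2 * pi])
      cube_int (fun x : 'rV[R]_n' => g (row_mx (const_mx t : 'rV[R]_1) x))
  end.

Definition torus_int (R : realType) (n : nat) (f : 'rV[R]_n -> R[i]) : R[i] :=
  cube_int (@complex.Re R \o f) +i* cube_int (@complex.Im R \o f).

Definition dist_of (R : realType) (n : nat) (f : Cinf R n) : Cinf R n -> R[i] :=
  fun g => torus_int (fun x => f x * g x).

(* Pd is the extension of an operator P from functions to distributions; a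
   distribution is in C^oo when it is induced by a function in C^oo. *)
Definition globally_hypoelliptic (R : realType) (n : nat)
    (Pd : (Cinf R n -> R[i]) -> (Cinf R n -> R[i])) : Prop :=
  forall u : Cinf R n -> R[i], is_distribution u ->
    (exists f : Cinf R n, Pd u = dist_of f) ->
    exists g : Cinf R n, u = dist_of g.

(* Main.v *)
Require Import Defs.
From mathcomp Require Import all_boot all_order all_algebra.
From mathcomp Require Import complex.
From mathcomp Require Import all_classical all_reals all_analysis.
From mathcomp Require Import ring lra zify.

(** P acts on Fourier coefficients by 2 x 2 blocks: writing s(k) for the symbol
    of L - A, the pair formed by the coefficient of u at k and the conjugate of
    its coefficient at - k is multiplied by the matrix with rows (s(k), - B) and
    (- B^*, s(- k)^* ).  Both properties of P are equivalent to the Diophantine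
    condition that the determinant of this block is bounded from below by a
    negative power of |k| for all large k.  Under this condition the blocks can
    be inverted with polynomial loss, which preserves rapid decrease.  If the
    condition fails, it fails along a sparse sequence of frequencies, on which
    one finds vectors of size bounded from below that are almost annihilated by
    the blocks, hence a non-smooth distribution with smooth image, and tiny
    right-hand sides whose solutions are bounded from below.  Distributing the
    latter over 2 N + 1 disjoint infinite sets of frequencies gives 2 N + 1
    smooth functions no nontrivial real combination of which is in the range of
    P; since P is only real linear, this is the number of functions needed to
    exclude a complex subspace of codimension N. *)

Set Implicit Arguments.
Unset Strict Implicit.
Unset Printing Implicit Defensive.

Import Order.TTheory GRing.Theory Num.Theory.
Import numFieldNormedType.Exports.

Local Open Scope classical_set_scope.
Local Open Scope ring_scope.
Local Open Scope complex_scope.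

(** * Complex-valued continuous functions and slices of the cube *)

(** Conjugation moves the frequency k to - k, so P is not diagonal on coefficients. The equation at
    k and the conjugate of the equation at - k form a closed complex linear system, which is why the
    second unknown is a conjugate. The determinants at k and - k are conjugate to each other, so a
    lower bound holds on both or on neither. When the condition fails, the exponents along the
    chosen sequence tend to infinity: errors of the size of the determinant then beat every fixed
    power of the weight, while a lower bound r along the same sequence rules out rapid decrease.
    Most of the work goes into the dictionary between functions, distributions and coefficients.
    Uniqueness of Fourier coefficients rests on peaking trigonometric polynomials; sums over boxes
    of frequencies come with explicit errors D / (M + 1), which reduces limits to an archimedean
    argument; distributions are compared on characters only. *)

Lemma normc_ge0 (R : realType) (z : R[i]) : 0 <= Normc.normc z.
Proof. by case: z => a b; rewrite sqrtr_ge0. Qed.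

Lemma normcD_le (R : realType) (x y : R[i]) :
  Normc.normc (x + y) <= Normc.normc x + Normc.normc y.
Proof. exact: (le_normcD x y). Qed.

Lemma normc_opp (R : realType) (x : R[i]) : Normc.normc (- x) = Normc.normc x.
Proof. exact: (normcN x). Qed.

Lemma normc_conj (R : realType) (x : R[i]) : Normc.normc (conjc x) = Normc.normc x.
Proof. by case: x => a b; rewrite /= sqrrN. Qed.

Lemma conjcM (R : realType) (x y : R[i]) :
  conjc (x * y) = conjc x * conjc y.
Proof. exact: rmorphM. Qed.

Lemma conjcD (R : realType) (x y : R[i]) :
  conjc (x + y) = conjc x + conjc y.
Proof. exact: rmorphD. Qed.

Lemma normc_sub (R : realType) (x y : R[i]) :
  Normc.normc (x - y) = Normc.normc (y - x).
Proof. by rewrite -normc_opp opprB. Qed.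

Lemma normc_realC (R : realType) (x : R) : Normc.normc x%:C = `|x|.
Proof. by rewrite /= expr0n/= addr0 sqrtr_sqr. Qed.

Lemma normcX (R : realType) (x : R[i]) k :
  Normc.normc (x ^+ k) = Normc.normc x ^+ k.
Proof.
elim: k => [|k IH]; first by rewrite !expr0 Normc.normc1.
by rewrite !exprS Normc.normcM IH.
Qed.

Lemma normc_eq0 (R : realType) (x : R[i]) : (Normc.normc x == 0) = (x == 0).
Proof.
apply/eqP/eqP => [/Normc.eq0_normc//|->]; exact: Normc.normc0.
Qed.

Lemma normc_gt0 (R : realType) (x : R[i]) : (0 < Normc.normc x) = (x != 0).
Proof. by rewrite lt_neqAle normc_ge0 andbT eq_sym normc_eq0. Qed.

Lemma Re_le_normc (R : realType) (z : R[i]) : `|complex.Re z| <= Normc.normc z.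
Proof.
by case: z => a b /=; rewrite -sqrtr_sqr ler_sqrt ?lerDl ?addr_ge0 ?sqr_ge0.
Qed.

Lemma Im_le_normc (R : realType) (z : R[i]) : `|complex.Im z| <= Normc.normc z.
Proof.
by case: z => a b /=; rewrite -sqrtr_sqr ler_sqrt ?lerDr ?addr_ge0 ?sqr_ge0.
Qed.

Lemma normc_le_ReIm (R : realType) (z : R[i]) :
  Normc.normc z <= `|complex.Re z| + `|complex.Im z|.
Proof.
case: z => a b /=; rewrite -[leRHS]ger0_norm ?addr_ge0// -sqrtr_sqr.
rewrite ler_sqrt ?sqr_ge0// sqrrD !real_normK ?num_real// addrAC lerDl.
by rewrite mulrn_wge0// mulr_ge0.
Qed.

Lemma normc_sum (R : realType) (I : Type) (r : seq I) (F : I -> R[i]) :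
  Normc.normc (\sum_(i <- r) F i) <= \sum_(i <- r) Normc.normc (F i).
Proof.
elim/big_ind2: _ => [|x a y b xa yb|//]; first by rewrite Normc.normc0.
exact: le_trans (normcD_le _ _) (lerD xa yb).
Qed.

Lemma sumC (R : realType) (I : Type) (r : seq I) (P : pred I) (F : I -> R[i]) :
  \sum_(i <- r | P i) F i =
  (\sum_(i <- r | P i) complex.Re (F i)) +i*
  (\sum_(i <- r | P i) complex.Im (F i)).
Proof.
elim: r => [|i r IH]; first by rewrite !big_nil.
by rewrite !big_cons; case: (P i) => //; rewrite IH; case: (F i) => a b; simpc.
Qed.

Definition ccont (R : realType) (T : topologicalType) (f : T -> R[i]) : Prop :=
  continuous (@complex.Re R \o f) /\ continuous (@complex.Im R \o f).

Lemma ccont_cst (R : realType) (T : topologicalType) (z : R[i]) :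
  ccont (fun _ : T => z).
Proof.
split=> x; [exact: (@cst_continuous _ _ (complex.Re z))|
  exact: (@cst_continuous _ _ (complex.Im z))].
Qed.

Lemma ccontM (R : realType) (T : topologicalType) (f g : T -> R[i]) :
  ccont f -> ccont g -> ccont (fun x => f x * g x).
Proof.
move=> [rf jf] [rg jg]; split.
- have -> : @complex.Re R \o (fun x => f x * g x) =
    (@complex.Re R \o f) * (@complex.Re R \o g) -
    (@complex.Im R \o f) * (@complex.Im R \o g).
    by apply/funext => x; rewrite !fctE /=; case: (f x); case: (g x).
  move=> x; apply: continuousB; apply: continuousM;
    [exact: rf|exact: rg|exact: jf|exact: jg].
- have -> : @complex.Im R \o (fun x => f x * g x) =
    (@complex.Re R \o f) * (@complex.Im R \o g) +
    (@complex.Im R \o f) * (@complex.Re R \o g).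
    by apply/funext => x; rewrite !fctE /=; case: (f x); case: (g x).
  move=> x; apply: continuousD; apply: continuousM;
    [exact: rf|exact: jg|exact: jf|exact: rg].
Qed.

Lemma ccontD (R : realType) (T : topologicalType) (f g : T -> R[i]) :
  ccont f -> ccont g -> ccont (fun x => f x + g x).
Proof.
move=> [rf jf] [rg jg]; split.
- have -> : @complex.Re R \o (fun x => f x + g x) =
    (@complex.Re R \o f) + (@complex.Re R \o g).
    by apply/funext => x; rewrite !fctE /=; case: (f x); case: (g x).
  by move=> x; apply: continuousD; [exact: rf|exact: rg].
- have -> : @complex.Im R \o (fun x => f x + g x) =
    (@complex.Im R \o f) + (@complex.Im R \o g).
    by apply/funext => x; rewrite !fctE /=; case: (f x); case: (g x).
  by move=> x; apply: continuousD; [exact: jf|exact: jg].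
Qed.

Lemma ccontZD (R : realType) (T : topologicalType) (a : R[i]) (f g : T -> R[i]) :
  ccont f -> ccont g -> ccont (fun x => a * f x + g x).
Proof.
by move=> cf cg; apply: ccontD => //; apply: ccontM => //; exact: ccont_cst.
Qed.

Lemma ccont_comp (R : realType) (S T : topologicalType) (f : T -> R[i])
  (h : S -> T) : continuous h -> ccont f -> ccont (f \o h).
Proof.
move=> ch [rf jf]; split=> x.
- exact: (@continuous_comp _ _ _ h (@complex.Re R \o f) x (ch x) (rf (h x))).
- exact: (@continuous_comp _ _ _ h (@complex.Im R \o f) x (ch x) (jf (h x))).
Qed.

Definition in_cube (R : realType) (n : nat) (x : 'rV[R]_n) : Prop :=
  forall j, 0 <= x ord0 j <= 2 * pi.

(** Written exactly as in [cube_int], so that [cube_int_succ] holds by conversion. *)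
Definition slice (R : realType) (n : nat) (t : R) (x : 'rV[R]_n) :
  'rV[R]_n.+1 := row_mx (const_mx t : 'rV[R]_1) x.

Lemma slice0 (R : realType) (n : nat) (t : R) (x : 'rV[R]_n) :
  slice t x ord0 ord0 = t.
Proof.
rewrite /slice (_ : ord0 = lshift n (ord0 : 'I_1)); last exact/val_inj.
by rewrite (@row_mxEl _ 1 1 n) mxE.
Qed.

Lemma slice_lift (R : realType) (n : nat) (t : R) (x : 'rV[R]_n) j :
  slice t x ord0 (lift ord0 j) = x ord0 j.
Proof.
rewrite /slice (_ : lift ord0 j = rshift 1 j); last exact/val_inj.
by rewrite (@row_mxEr _ 1 1 n).
Qed.

Lemma slice_cube (R : realType) (n : nat) (t : R) (x : 'rV[R]_n) :
  0 <= t <= 2 * pi -> in_cube x -> in_cube (slice t x).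
Proof.
move=> ht hx j; case: (unliftP ord0 j) => [i ->|->].
  by rewrite slice_lift.
by rewrite slice0.
Qed.

Lemma slice_continuous2 (R : realType) (n : nat) :
  continuous (fun p : 'rV[R]_n * R => slice p.2 p.1).
Proof.
move=> [x t] /=; apply/cvg_ballP => e e0.
have := @nbhsx_ballx _ _ (x, t) e e0; apply: filterS => -[y s] [/= [_ hx] ht].
split=> // i j; rewrite (ord1 i); case: (unliftP ord0 j) => [k ->|->].
  by rewrite !slice_lift; exact: hx.
by rewrite !slice0.
Qed.

Lemma slice_continuous (R : realType) (n : nat) (t : R) :
  continuous (@slice R n t).
Proof.
move=> x; have FF : Filter (nbhs x) by exact: nbhs_filter.
apply/(@cvg_ballP _ _ _ (nbhs x) FF) => e e0.
have := @nbhsx_ballx _ _ x e e0; apply: filterS => y [_ hx].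
split=> // i j; rewrite (ord1 i); case: (unliftP ord0 j) => [k ->|->].
  by rewrite !slice_lift; exact: hx.
by rewrite !slice0; exact: ballxx.
Qed.

Lemma cube_compact (R : realType) (n : nat) : compact (@in_cube R n).
Proof.
have := @rV_compact R n (fun=> `[0, 2 * pi]%classic)
  (fun=> @segment_compact _ _ _).
by congr (compact _); apply/funext => x; apply/propext; split=> H j;
  have := H j; rewrite /= in_itv.
Qed.

(** Compactness of the cube makes the continuity in t uniform in x; this is what lets limits and
    derivatives in t pass under the inner integral. *)
Lemma slice_unif (R : realType) (n : nat) (g : 'rV[R]_n.+1 -> R) (t0 e : R) :
  continuous g -> 0 < e -> \forall t \near t0, forall x, in_cube x ->
  `|g (slice t x) - g (slice t0 x)| <= e.
Proof.
move=> cg e0.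
have /compact_near_coveringP/(_ R (nbhs t0)
  (fun t x => `|g (slice t x) - g (slice t0 x)| <= e) _) := @cube_compact R n.
apply => x _.
have c2 : continuous (fun p : 'rV[R]_n * R =>
    g (slice p.2 p.1) - g (slice t0 p.1)).
  move=> p; apply: continuousB.
    by apply: (@continuous_comp _ _ _ (fun p : 'rV[R]_n * R => slice p.2 p.1) g);
      [exact: slice_continuous2|exact: cg].
  apply: (@continuous_comp _ _ _ (fun p : 'rV[R]_n * R => slice t0 p.1) g);
    last exact: cg.
  apply: (@continuous_comp _ _ _ fst (slice t0)); last exact: slice_continuous.
  exact: cvg_fst.
have /cvgrPdist_le/(_ e e0) := c2 (x, t0); rewrite /= subrr.
by apply: filterS => -[y s]; rewrite /= sub0r normrN.
Qed.

(** * Iterated integrals of continuous functions *)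

Lemma cont_comp (S T U : topologicalType) (f : S -> T) (g : T -> U) :
  continuous f -> continuous g -> continuous (g \o f).
Proof. by move=> cf cg x; apply: continuous_comp; [exact: cf|exact: cg]. Qed.

Lemma contZ (R : realType) (T : topologicalType) (a : R) (f : T -> R) :
  continuous f -> continuous (fun x => a * f x).
Proof.
move=> cf x; apply: (@continuousM _ _ (cst a) f); last exact: cf.
exact: (@cst_continuous _ _ a).
Qed.

Lemma contD (R : realType) (T : topologicalType) (f g : T -> R) :
  continuous f -> continuous g -> continuous (fun x => f x + g x).
Proof.
by move=> cf cg x; apply: (@continuousD _ _ _ f g); [exact: cf|exact: cg].
Qed.

Lemma cont_cst (R : realType) (T : topologicalType) (a : R) :
  continuous (fun _ : T => a).
Proof. exact: cst_continuous. Qed.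

Lemma cube_int_succ (R : realType) (n : nat) (g : 'rV[R]_n.+1 -> R) :
  cube_int g = \int[@lebesgue_measure R]_(t in `[0, 2 * pi])
    cube_int (g \o slice t).
Proof. by []. Qed.

Lemma cont_itv_integrable (R : realType) (a b : R) (f : R -> R) :
  continuous f -> (@lebesgue_measure R).-integrable `[a, b] (EFin \o f).
Proof.
move=> cf; apply: continuous_compact_integrable; first exact: segment_compact.
exact: continuous_subspaceT.
Qed.

Lemma twopi_gt0 (R : realType) : 0 < 2 * pi :> R.
Proof. by rewrite mulr_gt0// pi_gt0. Qed.

Lemma lebesgue_itvcc (R : realType) (a b : R) : a <= b ->
  fine (@lebesgue_measure R `[a, b]) = b - a.
Proof.
rewrite lebesgue_measure_itv/= lte_fin le_eqVlt => /orP[/eqP->|->//].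
by rewrite ltxx subrr.
Qed.

Lemma lebesgue_period (R : realType) :
  fine (@lebesgue_measure R `[0, 2 * pi]) = 2 * pi.
Proof.
by rewrite lebesgue_itvcc ?subr0// ltW// twopi_gt0.
Qed.

(** The laws are bundled because one induction must prove them together: integrability of the outer
    integrand follows from its continuity, which uses all three laws in the lower dimension. *)
Definition cube_int_laws (R : realType) (n : nat) : Prop :=
  [/\ forall (a : R) (g h : 'rV[R]_n -> R), continuous g -> continuous h ->
        cube_int (fun x => a * g x + h x) = a * cube_int g + cube_int h,
      forall g h : 'rV[R]_n -> R, continuous g -> continuous h ->
        (forall x, in_cube x -> g x <= h x) -> cube_int g <= cube_int h &
      forall a : R, cube_int (fun _ : 'rV[R]_n => a) = a * (2 * pi) ^+ n].

Lemma cube_int_laws_norm (R : realType) (n : nat) : cube_int_laws R n ->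
  forall (g h : 'rV[R]_n -> R) (e : R), continuous g -> continuous h ->
    (forall x, in_cube x -> `|g x - h x| <= e) ->
    `|cube_int g - cube_int h| <= e * (2 * pi) ^+ n.
Proof.
move=> [lin mono cst] g h e cg ch gh.
have ce : continuous (fun _ : 'rV[R]_n => e) by exact: cst_continuous.
have cplus (f : 'rV[R]_n -> R) : continuous f ->
    cube_int (fun x => 1 * f x + e) = cube_int f + e * (2 * pi) ^+ n.
  by move=> cf; rewrite lin// cst mul1r.
have ccplus (f : 'rV[R]_n -> R) : continuous f ->
    continuous (fun x => 1 * f x + e).
  move=> cf x; apply: (@continuousD _ _ _ (fun x => 1 * f x)); last exact: ce.
  exact: contZ.
have gle : cube_int g <= cube_int h + e * (2 * pi) ^+ n.
  rewrite -cplus//; apply: mono => // [|x xc]; first exact: ccplus.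
  by have := gh x xc; rewrite ler_norml mul1r; lra.
have hle : cube_int h <= cube_int g + e * (2 * pi) ^+ n.
  rewrite -cplus//; apply: mono => // [|x xc]; first exact: ccplus.
  by have := gh x xc; rewrite ler_norml mul1r; lra.
by rewrite ler_norml; apply/andP; split; lra.
Qed.

Lemma slice_int_continuous_of (R : realType) (n : nat) (g : 'rV[R]_n.+1 -> R) :
  cube_int_laws R n -> continuous g ->
  continuous (fun t => cube_int (g \o slice t)).
Proof.
move=> laws cg t0; apply/cvgrPdist_le => e e0.
pose e' := e / (2 * pi) ^+ n.
have e'0 : 0 < e' by rewrite divr_gt0// exprn_gt0// twopi_gt0.
have := slice_unif t0 cg e'0; apply: filterS => t ht.
have -> : e = e' * (2 * pi) ^+ n by rewrite mulfVK// expf_neq0// gt_eqF// twopi_gt0.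
apply: cube_int_laws_norm => //; first exact: cont_comp (@slice_continuous _ _ _) cg.
  exact: cont_comp (@slice_continuous _ _ _) cg.
by move=> x xc; rewrite distrC ht.
Qed.

Lemma cube_int_lawsP (R : realType) (n : nat) : cube_int_laws R n.
Proof.
elim: n => [|n IH].
  split=> [a g h _ _|g h _ _ gh|a] //=; first by apply: gh => -[].
  by rewrite expr0 mulr1.
have [lin mono cst] := IH.
have mI : measurable (`[0, 2 * pi]%classic : set R) by exact: measurable_itv.
have cs (f : 'rV[R]_n.+1 -> R) t : continuous f -> continuous (f \o slice t).
  by move=> cf; exact: cont_comp (@slice_continuous _ _ _) cf.
have int (f : 'rV[R]_n.+1 -> R) : continuous f ->
    (@lebesgue_measure R).-integrable `[0, 2 * pi]
      (EFin \o (fun t => cube_int (f \o slice t))).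
  by move=> cf; apply: cont_itv_integrable; exact: slice_int_continuous_of.
split=> [a g h cg ch|g h cg ch gh|a]; rewrite !cube_int_succ.
- under eq_Rintegral => t _.
    rewrite (_ : _ \o _ = (fun x => a * (g \o slice t) x + (h \o slice t) x))//.
    rewrite lin; [|exact: cs|exact: cs]; over.
  rewrite RintegralD//; last exact: int.
    by rewrite RintegralZl//; exact: int.
  by apply: cont_itv_integrable; apply: contZ; exact: slice_int_continuous_of.
- apply: le_Rintegral => //; [exact: int|exact: int|move=> t].
  rewrite /= in_itv/= => ht; apply: mono => [||x xc]; [exact: cs|exact: cs|].
  by apply: gh; exact: slice_cube.
- under eq_Rintegral => t _ do rewrite (_ : _ \o _ = (fun=> a))// cst.
  by rewrite Rintegral_cst// lebesgue_period -mulrA -exprSr.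
Qed.

Lemma cube_intZD (R : realType) (n : nat) (a : R) (g h : 'rV[R]_n -> R) :
  continuous g -> continuous h ->
  cube_int (fun x => a * g x + h x) = a * cube_int g + cube_int h.
Proof. by have [+ _ _] := @cube_int_lawsP R n; exact. Qed.

Lemma cube_int_le (R : realType) (n : nat) (g h : 'rV[R]_n -> R) :
  continuous g -> continuous h -> (forall x, in_cube x -> g x <= h x) ->
  cube_int g <= cube_int h.
Proof. by have [_ + _] := @cube_int_lawsP R n; exact. Qed.

Lemma cube_int_cst (R : realType) (n : nat) (a : R) :
  cube_int (fun _ : 'rV[R]_n => a) = a * (2 * pi) ^+ n.
Proof. by have [_ _ +] := @cube_int_lawsP R n; exact. Qed.

Lemma cube_int_dist (R : realType) (n : nat) (g h : 'rV[R]_n -> R) (e : R) :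
  continuous g -> continuous h ->
  (forall x, in_cube x -> `|g x - h x| <= e) ->
  `|cube_int g - cube_int h| <= e * (2 * pi) ^+ n.
Proof. exact: cube_int_laws_norm (@cube_int_lawsP R n) _ _ _. Qed.

Lemma slice_int_continuous (R : realType) (n : nat) (g : 'rV[R]_n.+1 -> R) :
  continuous g -> continuous (fun t => cube_int (g \o slice t)).
Proof. exact: slice_int_continuous_of (@cube_int_lawsP R n). Qed.

Lemma twopiX_gt0 (R : realType) n : 0 < (2 * pi) ^+ n :> R.
Proof. by rewrite exprn_gt0// twopi_gt0. Qed.

Lemma torus_intZD (R : realType) (n : nat) (a : R[i]) (f g : 'rV[R]_n -> R[i]) :
  ccont f -> ccont g ->
  torus_int (fun x => a * f x + g x) = a * torus_int f + torus_int g.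
Proof.
move=> [rf jf] [rg jg]; rewrite /torus_int.
have step (b c : R) (u v w : 'rV[R]_n -> R) :
    continuous u -> continuous v -> continuous w ->
    cube_int (fun x => b * u x + (c * v x + w x)) =
    b * cube_int u + (c * cube_int v + cube_int w).
  move=> cu cv cw; rewrite cube_intZD// ?cube_intZD//.
  move=> x; apply: (@continuousD _ _ _ (fun x => c * v x)); last exact: cw.
  exact: contZ.
case: a => a1 a2; rewrite -[X in X + _]/((_ +i* _) : R[i]) /=.
have -> : @complex.Re R \o (fun x => (a1 +i* a2) * f x + g x) =
  (fun x => a1 * (@complex.Re R \o f) x +
    (- a2 * (@complex.Im R \o f) x + (@complex.Re R \o g) x)).
  by apply/funext => x /=; case: (f x) => ? ?; case: (g x) => ? ? /=; ring.
have -> : @complex.Im R \o (fun x => (a1 +i* a2) * f x + g x) =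
  (fun x => a1 * (@complex.Im R \o f) x +
    (a2 * (@complex.Re R \o f) x + (@complex.Im R \o g) x)).
  by apply/funext => x /=; case: (f x) => ? ?; case: (g x) => ? ? /=; ring.
by rewrite !step//; simpc; congr (_ +i* _); ring.
Qed.

Lemma torus_int0 (R : realType) (n : nat) :
  torus_int (fun _ : 'rV[R]_n => 0) = 0.
Proof.
rewrite /torus_int; have -> : @complex.Re R \o (fun _ : 'rV[R]_n => 0) = (fun=> 0) by [].
have -> : @complex.Im R \o (fun _ : 'rV[R]_n => 0) = (fun=> 0) by [].
by rewrite cube_int_cst mul0r.
Qed.

(** The factor 2 comes from bounding real and imaginary parts separately; it is harmless, since only
    orders of growth and decay matter later. *)
Lemma torus_int_norm (R : realType) (n : nat) (f : 'rV[R]_n -> R[i]) (e : R) :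
  ccont f -> (forall x, in_cube x -> Normc.normc (f x) <= e) ->
  Normc.normc (torus_int f) <= 2 * (2 * pi) ^+ n * e.
Proof.
move=> [rf jf] fe; apply: le_trans (normc_le_ReIm _) _ => /=.
have c0 : continuous (fun _ : 'rV[R]_n => 0 : R) by exact: cst_continuous.
have bnd (u : 'rV[R]_n -> R) : continuous u ->
    (forall x, in_cube x -> `|u x| <= e) -> `|cube_int u| <= e * (2 * pi) ^+ n.
  move=> cu ue; have := @cube_int_dist _ _ u (fun=> 0) e cu c0.
  rewrite cube_int_cst mul0r subr0; apply=> x xc; rewrite subr0; exact: ue.
rewrite -mulrA mulr2n mulrDl mul1r [_ * e]mulrC; apply: lerD; apply: bnd => // x xc.
- by apply: le_trans (fe x xc) => /=; exact: Re_le_normc.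
- by apply: le_trans (fe x xc) => /=; exact: Im_le_normc.
Qed.

(** * Derivatives under the integral *)

Lemma is_derive_of_bound (R : realType) (V : normedModType R) (f : V -> R)
    (x v : V) (l : R) :
  (forall e : R, 0 < e -> \forall h \near (0 : R),
     `|f (h *: v + x) - f x - h * l| <= `|h| * e) ->
  is_derive x v f l.
Proof.
move=> H.
have lim : (fun h : R => h^-1 *: ((f \o shift x) (h *: v) - f x)) @ 0^' --> l.
  apply/cvgrPdist_le => e e0.
  have := H e e0; rewrite /dnbhs => /(@nbhs_dnbhs _ (0 : R)).
  move=> near1; near=> h.
  have h0 : h != 0 by near: h; exact: nbhs_dnbhs_neq.
  have hh : `|f (h *: v + x) - f x - h * l| <= `|h| * e by near: h.
  have -> : l - h^-1 *: ((f \o shift x) (h *: v) - f x) =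
      - h^-1 * (f (h *: v + x) - f x - h * l).
    rewrite /= /GRing.scale/= mulNr [in RHS]mulrBr mulrA mulVf// mul1r; ring.
  by rewrite normrM normrN normfV ler_pdivrMl ?normr_gt0.
apply: DeriveDef; first by apply/cvg_ex; exists l.
exact: cvg_lim.
Unshelve. all: by end_near. Qed.

Lemma is_derive_line (R : realType) (V : normedModType R) (g : V -> R)
    (x v : V) (s : R) : (forall y, derivable g y v) ->
  is_derive s 1 (fun s : R => g (x + s *: v)) ('D_v g (x + s *: v)).
Proof.
move=> dg; have dgs := dg (x + s *: v).
have E : (fun h : R => h^-1 *: (((fun s : R => g (x + s *: v)) \o shift s)
      (h *: (1 : R)) - g (x + s *: v))) =
    (fun h : R => h^-1 *: ((g \o shift (x + s *: v)) (h *: v) -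
      g (x + s *: v))).
  apply/funext => h /=; congr (_ *: (g _ - _)).
  by rewrite -[h%:A]/(h * 1) mulr1 scalerDl addrCA.
apply: DeriveDef; first by rewrite /derivable E.
by rewrite /derive E.
Qed.

Lemma mean_value_line (R : realType) (V : normedModType R) (g : V -> R)
    (x v : V) (h : R) : (forall y, derivable g y v) ->
  exists2 s : R, `|s| <= `|h| & g (x + h *: v) - g x = h * 'D_v g (x + s *: v).
Proof.
move=> dg; pose u (s : R) := g (x + s *: v).
have du (s : R) : is_derive s 1 u ('D_v g (x + s *: v)) by exact: is_derive_line.
(* Rescaling to [0, 1] avoids a case distinction on the sign of h. *)
pose p (s : R) := u (h * s).
have dp (s : R) : is_derive s 1 p (h * 'D_v g (x + (h * s) *: v)).
  have d1 : is_derive s 1 (fun s : R => h * s) h.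
    have -> : (fun s : R => h * s) = h \*: (@id R) by [].
    by apply: is_derive_eq; rewrite /GRing.scale/= mulr1.
  have := @is_derive1_comp _ u (fun s => h * s) s _ _ (du (h * s)) d1.
  by move=> /is_derive_eq; apply; rewrite mulrC.
have cp : {within `[0, 1], continuous p}.
  apply: continuous_subspaceT => s; apply: differentiable_continuous.
  by apply/derivable1_diffP; have [] := dp s.
have [c c01 E] := MVT_segment ler01 (fun s _ => dp s) cp.
exists (h * c).
  move: c01; rewrite in_itv/= => /andP[c0 c1].
  by rewrite normrM ler_piMr// ger0_norm.
by move: E; rewrite /p /u mulr1 mulr0 scale0r addr0 subr0 mulr1.
Qed.

Lemma shift_coord (R : realType) (n : nat) (h : R) (x : 'rV[R]_n) j k :
  (x + h *: 'e_j) ord0 k = x ord0 k + h * (k == j)%:R.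
Proof. by rewrite !mxE. Qed.

Lemma slice_shift0 (R : realType) (n : nat) (t h : R) (x : 'rV[R]_n) :
  slice t x + h *: 'e_ord0 = slice (t + h) x.
Proof.
apply/matrixP => k j; rewrite (ord1 k) shift_coord.
case: (unliftP ord0 j) => [i ->|->].
  by rewrite !slice_lift /= mulr0 addr0.
by rewrite !slice0 eqxx mulr1.
Qed.

Lemma slice_shift_lift (R : realType) (n : nat) (t h : R) (x : 'rV[R]_n) j :
  slice t (x + h *: 'e_j) = slice t x + h *: 'e_(lift ord0 j).
Proof.
apply/matrixP => i k; rewrite (ord1 i) shift_coord.
case: (unliftP ord0 k) => [l ->|->].
  by rewrite !slice_lift shift_coord (inj_eq lift_inj).
by rewrite !slice0 /= mulr0 addr0.
Qed.

(** The mean value theorem turns the difference quotient into the partial derivative at a nearby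
    slice, which [slice_unif] compares with the slice at t uniformly in x. *)
Lemma slice_int_derive (R : realType) (n : nat) (g : 'rV[R]_n.+1 -> R) (t : R) :
  continuous g -> (forall x, derivable g x 'e_ord0) ->
  continuous ('D_('e_ord0) g) ->
  is_derive t 1 (fun t => cube_int (g \o slice t))
    (cube_int ('D_('e_ord0) g \o slice t)).
Proof.
move=> cg dg cdg; apply: is_derive_of_bound => e e0.
pose e' := e / (2 * pi) ^+ n.
have e'0 : 0 < e' by rewrite divr_gt0// twopiX_gt0.
have := slice_unif t cdg e'0; move=> /nbhs_ballP[d /= d0 hd].
near=> h.
have hd0 : `|h| < d.
  by rewrite -normrN -[- h]add0r; near: h; exact: (@nbhsx_ballx _ _ (0 : R) d d0).
have cs (f : 'rV[R]_n.+1 -> R) s : continuous f -> continuous (f \o slice s).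
  by move=> cf; exact: cont_comp (@slice_continuous _ _ _) cf.
have -> : h *: 1 + t = t + h by rewrite /GRing.scale/= mulr1 addrC.
rewrite -addrA -opprD [_ + h * _]addrC -cube_intZD; [|exact: cs|exact: cs].
have -> : `|h| * e = `|h| * e' * (2 * pi) ^+ n.
  by rewrite -mulrA mulfVK// gt_eqF// twopiX_gt0.
apply: cube_int_dist => [||x xc]; first exact: cs.
  move=> x; apply: (@continuousD _ _ _ (fun x => h * _ x)); last exact: cs.
  by apply: contZ; exact: cs.
have [s sh E] := mean_value_line (slice t x) h dg.
move: E; rewrite !slice_shift0 => E; set D := 'D_('e_ord0) g.
have -> : (g \o slice (t + h)) x - (h * (D \o slice t) x + (g \o slice t) x) =
    h * (D (slice (t + s) x) - D (slice t x)).
  by rewrite mulrBr -E /=; ring.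
rewrite normrM ler_wpM2l//; apply: hd => //=.
rewrite /ball/= opprD addrA subrr sub0r normrN.
exact: le_lt_trans hd0.
Unshelve. all: by end_near. Qed.

(** The source of integration by parts. A derivative in a later coordinate is treated by induction
    inside each slice; in the first coordinate the fundamental theorem leaves the slice integrals at
    2 pi and 0, which cancel by periodicity. *)
Lemma cube_int_derive (R : realType) (n : nat) (g : 'rV[R]_n -> R) (j : 'I_n) :
  continuous g -> (forall x, derivable g x 'e_j) ->
  continuous ('D_('e_j) g) -> periodic g ((2 * pi) *: 'e_j) ->
  cube_int ('D_('e_j) g) = 0.
Proof.
elim: n g j => [|n IH] g j; first by case: j.
case: (unliftP ord0 j) => [i ->|->] cg dg cdg pg; rewrite cube_int_succ.
- under eq_Rintegral => t _.
    have E x : (fun h : R => h^-1 *: (((g \o slice t) \o shift x) (h *: 'e_i) -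
          (g \o slice t) x)) =
        (fun h : R => h^-1 *: ((g \o shift (slice t x)) (h *: 'e_(lift ord0 i)) -
          g (slice t x))).
      apply/funext => h /=; congr (_ *: (g _ - _)).
      by rewrite addrC slice_shift_lift addrC.
    rewrite (_ : _ \o _ = 'D_('e_i) (g \o slice t)); last first.
      by apply/funext => x; rewrite /= /derive E.
    rewrite IH; first over.
    + exact: cont_comp (@slice_continuous _ _ _) cg.
    + by move=> x; rewrite /derivable E; exact: dg.
    + have -> : 'D_('e_i) (g \o slice t) = ('D_('e_(lift ord0 i)) g) \o slice t.
        by apply/funext => x; rewrite /= /derive E.
      exact: cont_comp (@slice_continuous _ _ _) cdg.
    + by move=> x; rewrite /= slice_shift_lift pg.
  by rewrite Rintegral_cst// mul0r.
- pose G t := cube_int (g \o slice t).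
  pose D t := cube_int ('D_('e_ord0) g \o slice t).
  have dG (t : R) : is_derive t 1 G (D t) by exact: slice_int_derive.
  have cG : continuous G by exact: slice_int_continuous.
  have cD : continuous D by exact: slice_int_continuous.
  rewrite /Rintegral (@continuous_FTC2 _ D G)//.
  + rewrite -EFinB/= (_ : G (2 * pi) = G 0) ?subrr// /G; congr cube_int.
    apply/funext => x /=; rewrite -[in RHS](pg (slice 0 x)).
    by rewrite slice_shift0 add0r.
  + exact: twopi_gt0.
  + exact: continuous_subspaceT.
  + split; first by move=> t _; have [] := dG t.
    * by apply: cvg_at_right_filter; exact: cG.
    * by apply: cvg_at_left_filter; exact: cG.
  + by move=> t _; rewrite derive1E; have [_ ->] := dG t.
Qed.

(** * Characters of the torus *)

Definition cis (R : realType) (t : R) : R[i] := cos t +i* sin t.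

Lemma cisD (R : realType) (s t : R) : cis (s + t) = cis s * cis t.
Proof. by rewrite /cis cosD sinD; simpc; rewrite [sin s * _ + _]addrC. Qed.

Lemma cis0 (R : realType) : cis (0 : R) = 1.
Proof. by rewrite /cis cos0 sin0. Qed.

Lemma normc_cis (R : realType) (t : R) : Normc.normc (cis t) = 1.
Proof. by rewrite /= cos2Dsin2 sqrtr1. Qed.

Lemma conj_cis (R : realType) (t : R) : conjc (cis t) = cis (- t).
Proof. by rewrite /cis cosN sinN. Qed.

Lemma ccont_cis (R : realType) : ccont (@cis R).
Proof. by split; [exact: continuous_cos|exact: continuous_sin]. Qed.

Lemma cis_2pi (R : realType) : cis (2 * pi : R) = 1.
Proof. by rewrite mulrC mulr_natr /cis cos2pi sin2pi. Qed.

Lemma cis_mulz2pi (R : realType) (k : int) : cis (k%:~R * (2 * pi) : R) = 1.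
Proof.
have nat_case (m : nat) : cis (m%:R * (2 * pi) : R) = 1.
  elim: m => [|m IH]; first by rewrite mul0r cis0.
  by rewrite -addn1 natrD mulrDl mul1r cisD IH cis_2pi mulr1.
case: k => m; first exact: nat_case.
by rewrite NegzE rmorphN /= mulNr -conj_cis nat_case conjc1.
Qed.

Lemma cos_dist1 (R : realType) (t : R) : `|cos t - 1| <= `|t|.
Proof.
have [s _] := mean_value_line (0 : R) (v := 1) t
  (fun y => @ex_derive _ _ _ _ _ _ _ (is_derive_cos y)).
rewrite add0r /GRing.scale/= mulr1 cos0 => ->.
rewrite normrM ler_piMr// derive_val normrN ler_norml.
by rewrite sin_geN1 sin_le1.
Qed.

(** Real and imaginary parts contribute t ^+ 2 each. The error does not depend on a base point, as
    [is_pderive_quad] requires for characters and for series of them. *)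
Lemma cis_taylor (R : realType) (t : R) :
  Normc.normc (cis t - 1 - t%:C * 'i) <= 2 * t ^+ 2.
Proof.
have -> : cis t - 1 - t%:C * 'i = (cos t - 1) +i* (sin t - t).
  by rewrite /cis; simpc.
apply: le_trans (normc_le_ReIm _) _; rewrite mulr2n mulrDl mul1r /=.
have sinle : forall u : R, `|sin u| <= `|u|.
  move=> u; have [s _] := mean_value_line (0 : R) (v := 1) u
    (fun y => @ex_derive _ _ _ _ _ _ _ (is_derive_sin y)).
  rewrite add0r /GRing.scale/= mulr1 sin0 subr0 => ->.
  rewrite normrM ler_piMr// derive_val ler_norml.
  by rewrite cos_geN1 cos_le1.
rewrite -(@real_normK _ t) ?num_real// expr2; apply: lerD.
  have [s sh] := mean_value_line (0 : R) (v := 1) t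
    (fun y => @ex_derive _ _ _ _ _ _ _ (is_derive_cos y)).
  rewrite add0r /GRing.scale/= mulr1 cos0 => ->.
  rewrite normrM ler_wpM2l// derive_val normrN.
  by apply: le_trans sh; rewrite add0r mulr1 sinle.
pose g (u : R) := sin u - u.
have dg (y : R) : is_derive y 1 g (cos y - 1).
  by apply: is_derive_eq; rewrite //=.
have [s sh] := mean_value_line (0 : R) (v := 1) t
    (fun y => @ex_derive _ _ _ _ _ _ _ (dg y)).
rewrite add0r /GRing.scale/= mulr1 {1 2}/g sin0 subrr subr0 => ->.
rewrite normrM ler_wpM2l// derive_val add0r mulr1.
exact: le_trans (cos_dist1 _) sh.
Qed.

Lemma cis_dist1 (R : realType) (t : R) : Normc.normc (cis t - 1) <= 2 * `|t|.
Proof.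
have -> : cis t - 1 = (cos t - 1) +i* (sin t - 0).
  by rewrite /cis; simpc.
apply: le_trans (normc_le_ReIm _) _; rewrite mulr2n mulrDl mul1r /=.
apply: lerD; first exact: cos_dist1.
have [s _] := mean_value_line (0 : R) (v := 1) t
    (fun y => @ex_derive _ _ _ _ _ _ _ (is_derive_sin y)).
rewrite add0r /GRing.scale/= mulr1 sin0 => ->.
by rewrite normrM ler_piMr// derive_val ler_norml cos_geN1 cos_le1.
Qed.

Definition dotz (R : realType) (n : nat) (k : 'rV[int]_n) (x : 'rV[R]_n) : R :=
  \sum_j (k ord0 j)%:~R * x ord0 j.

Definition torus_chr (R : realType) (n : nat) (k : 'rV[int]_n)
  (x : 'rV[R]_n) : R[i] := cis (dotz k x).

Lemma dotz_shift (R : realType) (n : nat) (k : 'rV[int]_n) (x : 'rV[R]_n) h j :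
  dotz k (x + h *: 'e_j) = dotz k x + (k ord0 j)%:~R * h.
Proof.
rewrite /dotz; under eq_bigr => l _ do rewrite shift_coord mulrDr.
rewrite big_split/=; congr (_ + _).
rewrite (bigD1 j)//= eqxx mulr1 big1 ?addr0// => i ij.
by rewrite (negPf ij) !mulr0.
Qed.

Lemma chr_shift (R : realType) (n : nat) (k : 'rV[int]_n) (x : 'rV[R]_n) h j :
  torus_chr k (x + h *: 'e_j) = torus_chr k x * cis ((k ord0 j)%:~R * h).
Proof. by rewrite /torus_chr dotz_shift cisD. Qed.

Lemma chr_periodic (R : realType) (n : nat) (k : 'rV[int]_n) j :
  periodic (@torus_chr R n k) ((2 * pi) *: 'e_j).
Proof. by move=> x; rewrite chr_shift cis_mulz2pi mulr1. Qed.

Lemma chrD (R : realType) (n : nat) (k l : 'rV[int]_n) (x : 'rV[R]_n) :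
  torus_chr (k + l) x = torus_chr k x * torus_chr l x.
Proof.
rewrite /torus_chr -cisD -big_split/=; congr cis; apply: eq_bigr => j _.
by rewrite mxE rmorphD mulrDl.
Qed.

Lemma chrN (R : realType) (n : nat) (k : 'rV[int]_n) (x : 'rV[R]_n) :
  torus_chr (- k) x = conjc (torus_chr k x).
Proof.
rewrite /torus_chr conj_cis -sumrN; congr cis; apply: eq_bigr => j _.
by rewrite mxE rmorphN mulNr.
Qed.

Lemma chr0 (R : realType) (n : nat) (x : 'rV[R]_n) : torus_chr 0 x = 1.
Proof.
by rewrite /torus_chr /dotz big1 ?cis0// => j _; rewrite mxE mul0r.
Qed.

Lemma normc_chr (R : realType) (n : nat) (k : 'rV[int]_n) (x : 'rV[R]_n) :
  Normc.normc (torus_chr k x) = 1.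
Proof. exact: normc_cis. Qed.

Lemma dotz_continuous (R : realType) (n : nat) (k : 'rV[int]_n) :
  continuous (@dotz R n k).
Proof.
rewrite /dotz; elim: (index_enum _) => [|j r IH].
  under eq_fun do rewrite big_nil.
  by move=> x; exact: (@cst_continuous _ _ (0 : R)).
under eq_fun do rewrite big_cons.
move=> x; apply: (@continuousD _ _ _ (fun x : 'rV[R]_n => _ * x ord0 j));
  last exact: IH.
by apply: contZ; exact: coord_continuous.
Qed.

Lemma ccont_chr (R : realType) (n : nat) (k : 'rV[int]_n) :
  ccont (@torus_chr R n k).
Proof. exact: ccont_comp (@dotz_continuous R n k) (@ccont_cis R). Qed.

(** A relation instead of an equation on [partial], because [partial] has a value even where the
    derivative does not exist. *)
Definition is_pderive (R : realType) (n : nat) (j : 'I_n)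
    (f df : 'rV[R]_n -> R[i]) : Prop :=
  forall x, is_derive x 'e_j (@complex.Re R \o f) (complex.Re (df x)) /\
            is_derive x 'e_j (@complex.Im R \o f) (complex.Im (df x)).

Lemma is_pderive_partial (R : realType) (n : nat) (j : 'I_n)
    (f df : 'rV[R]_n -> R[i]) : is_pderive j f df -> partial j f = df.
Proof.
move=> H; apply/funext => x; rewrite /partial.
by have [[_ ->] [_ ->]] := H x; case: (df x).
Qed.

(** A quadratic remainder with a uniform constant survives summation and passage to the limit, so
    series can be differentiated term by term through this criterion. *)
Lemma is_pderive_quad (R : realType) (n : nat) (j : 'I_n)
    (f df : 'rV[R]_n -> R[i]) (C : R) :
  (forall x h, Normc.normc (f (x + h *: 'e_j) - f x - h%:C * df x) <=
     C * h ^+ 2) ->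
  is_pderive j f df.
Proof.
move=> H x; have near0 (e : R) : 0 < e -> \forall h \near (0 : R),
    Normc.normc (f (h *: 'e_j + x) - f x - h%:C * df x) <= `|h| * e.
  move=> e0; have d0 : 0 < e / (`|C| + 1) by rewrite divr_gt0// ltr_wpDl.
  apply: filterS (@nbhsx_ballx _ _ (0 : R) _ d0) => h.
  rewrite /ball/= sub0r normrN => hd; rewrite [h *: _ + x]addrC.
  apply: le_trans (H x h) _; rewrite -(@real_normK _ h) ?num_real// expr2 mulrA.
  rewrite [leRHS]mulrC ler_wpM2r// (@le_trans _ _ ((`|C| + 1) * `|h|))//.
    by rewrite ler_wpM2r// (le_trans (ler_norm _))// lerDl.
  by rewrite mulrC -ler_pdivlMr ?ltr_wpDl// ltW.
split; apply: is_derive_of_bound => e /near0; apply: filterS => h;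
  apply: le_trans.
- rewrite /comp; move: (f (h *: _ + x)) (f x) (df x) => [a1 b1] [a2 b2] [a3 b3] /=.
  by rewrite mul0r subr0; exact: (Re_le_normc (Complex _ _)).
- rewrite /comp; move: (f (h *: _ + x)) (f x) (df x) => [a1 b1] [a2 b2] [a3 b3] /=.
  by rewrite !mul0r subr0 addr0; exact: (Im_le_normc (Complex _ _)).
Qed.

Lemma is_pderive_chr (R : realType) (n : nat) (k : 'rV[int]_n) (j : 'I_n) :
  is_pderive j (@torus_chr R n k)
    (fun x => ((k ord0 j)%:~R)%:C * 'i * torus_chr k x).
Proof.
apply: (@is_pderive_quad _ _ _ _ _ (2 * ((k ord0 j)%:~R) ^+ 2)) => x h.
rewrite chr_shift; set z := torus_chr k x; set c := (k ord0 j)%:~R.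
have -> : z * cis (c * h) - z - h%:C * (c%:C * 'i * z) =
    z * (cis (c * h) - 1 - (c * h)%:C * 'i).
  by rewrite rmorphM /=; ring.
rewrite Normc.normcM normc_chr mul1r -mulrA -exprMn; exact: cis_taylor.
Qed.

Lemma is_pderiveM (R : realType) (n : nat) (j : 'I_n)
    (f g df dg : 'rV[R]_n -> R[i]) :
  is_pderive j f df -> is_pderive j g dg ->
  is_pderive j (fun x => f x * g x) (fun x => df x * g x + f x * dg x).
Proof.
move=> Hf Hg x; have [rf jf] := Hf x; have [rg jg] := Hg x; split.
- have -> : @complex.Re R \o (fun x => f x * g x) =
    (@complex.Re R \o f) * (@complex.Re R \o g) -
    (@complex.Im R \o f) * (@complex.Im R \o g).
    by apply/funext => y; rewrite !fctE /=; case: (f y); case: (g y).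
  apply: (is_derive_eq (is_deriveB (is_deriveM rf rg) (is_deriveM jf jg))).
  rewrite /GRing.scale /=.
  by case: (f x) (g x) (df x) (dg x) => ? ? [? ?] [? ?] [? ?] /=; ring.
- have -> : @complex.Im R \o (fun x => f x * g x) =
    (@complex.Re R \o f) * (@complex.Im R \o g) +
    (@complex.Im R \o f) * (@complex.Re R \o g).
    by apply/funext => y; rewrite !fctE /=; case: (f y); case: (g y).
  apply: (is_derive_eq (is_deriveD (is_deriveM rf jg) (is_deriveM jf rg))).
  rewrite /GRing.scale /=.
  by case: (f x) (g x) (df x) (dg x) => ? ? [? ?] [? ?] [? ?] /=; ring.
Qed.

Lemma torus_int_pderive (R : realType) (n : nat) (j : 'I_n)
    (f df : 'rV[R]_n -> R[i]) :
  is_pderive j f df -> ccont f -> ccont df ->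
  periodic f ((2 * pi) *: 'e_j) -> torus_int df = 0.
Proof.
move=> H [rf jf] [rd jd] pf.
have E1 : @complex.Re R \o df = 'D_('e_j) (@complex.Re R \o f).
  by apply/funext => x; have [[_ ->] _] := H x.
have E2 : @complex.Im R \o df = 'D_('e_j) (@complex.Im R \o f).
  by apply/funext => x; have [_ [_ ->]] := H x.
rewrite /torus_int E1 E2 !cube_int_derive//.
- by move=> x; have [_ [+ _]] := H x.
- by rewrite -E2.
- by move=> x; rewrite /= pf.
- by move=> x; have [[+ _] _] := H x.
- by rewrite -E1.
- by move=> x; rewrite /= pf.
Qed.

(** * Fourier coefficients *)

Lemma periodic_int (R : realType) (n : nat) (f : 'rV[R]_n -> R[i]) (j : 'I_n)
    (m : int) x :
  torus_periodic f -> f (x + (m%:~R * (2 * pi)) *: 'e_j) = f x.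
Proof.
move=> pf; have nat_case (l : nat) y :
    f (y + (l%:R * (2 * pi)) *: 'e_j) = f y.
  elim: l => [|l IH]; first by rewrite mul0r scale0r addr0.
  by rewrite -[in l.+1%:R]addn1 natrD mulrDl mul1r scalerDl addrA pf IH.
case: m => m; first exact: nat_case.
rewrite NegzE rmorphN /= mulNr -[LHS](nat_case m.+1) scaleNr -addrA.
by rewrite addNr addr0.
Qed.

Lemma cube_repr (R : realType) (n : nat) (x : 'rV[R]_n) :
  exists2 y, in_cube y &
    forall f : 'rV[R]_n -> R[i], torus_periodic f -> f y = f x.
Proof.
pose m j : int := - Num.floor (x ord0 j / (2 * pi)).
pose y := x + \sum_j ((m j)%:~R * (2 * pi)) *: 'e_j.
exists y => [j|f pf]; last first.
  rewrite /y; elim: (index_enum _) => [|j r IH]; first by rewrite big_nil addr0.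
  by rewrite big_cons [X in x + X]addrC addrA periodic_int.
have -> : y ord0 j = x ord0 j + (m j)%:~R * (2 * pi).
  rewrite mxE; congr (_ + _); rewrite summxE (bigD1 j)//= !mxE !eqxx mulr1.
  rewrite big1 ?addr0// => i ij.
  by rewrite !mxE eqxx /= eq_sym (negPf ij) mulr0.
have P0 := @twopi_gt0 R; set z := x ord0 j.
have fl := floor_le (z / (2 * pi)); have fg := floorD1_gt (z / (2 * pi)).
rewrite /m -/z rmorphN /=; move: fl fg; set F := (Num.floor _)%:~R.
rewrite intrD -/F ler_pdivlMr// ltr_pdivrMr// => fl fg; apply/andP; split; lra.
Qed.

Lemma torus_bounded (R : realType) (n : nat) (f : 'rV[R]_n -> R[i]) :
  ccont f -> torus_periodic f -> exists C, forall x, Normc.normc (f x) <= C.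
Proof.
move=> [rf jf] pf.
have bnd (g : 'rV[R]_n -> R) : continuous g ->
    exists C, forall x, in_cube x -> `|g x| <= C.
  move=> cg.
  have cK : compact (g @` @in_cube R n).
    apply: continuous_compact; last exact: cube_compact.
    exact: continuous_subspaceT.
  have [M [Mr HM]] := compact_bounded cK.
  exists (M + 1) => x xc; apply: (HM (M + 1)); first by rewrite ltrDl.
  by exists x.
have [C1 H1] := bnd _ rf; have [C2 H2] := bnd _ jf.
exists (C1 + C2) => x; have [y yc <-//] := cube_repr x.
by apply: le_trans (normc_le_ReIm _) _; apply: lerD; [exact: H1|exact: H2].
Qed.

Definition coef (R : realType) (n : nat) (f : 'rV[R]_n -> R[i])
    (k : 'rV[int]_n) : R[i] :=
  (((2 * pi) ^+ n)^-1)%:C * torus_int (fun x => f x * torus_chr (- k) x).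

Lemma ccontM_chr (R : realType) (n : nat) (f : 'rV[R]_n -> R[i]) k :
  ccont f -> ccont (fun x => f x * torus_chr k x).
Proof. by move=> cf; apply: ccontM => //; exact: ccont_chr. Qed.

Lemma coefZD (R : realType) (n : nat) (a : R[i]) (f g : 'rV[R]_n -> R[i]) k :
  ccont f -> ccont g ->
  coef (fun x => a * f x + g x) k = a * coef f k + coef g k.
Proof.
move=> cf cg; rewrite /coef.
under eq_fun do rewrite mulrDl -mulrA.
by rewrite torus_intZD ?mulrDr 1?mulrCA//; exact: ccontM_chr.
Qed.

Lemma coef_norm (R : realType) (n : nat) (f : 'rV[R]_n -> R[i]) k (e : R) :
  ccont f -> (forall x, in_cube x -> Normc.normc (f x) <= e) ->
  Normc.normc (coef f k) <= 2 * e.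
Proof.
move=> cf fe; rewrite /coef Normc.normcM normc_realC.
have P0 := @twopiX_gt0 R n.
rewrite ger0_norm ?invr_ge0; last exact: ltW.
rewrite ler_pdivrMl// mulrCA mulrA.
apply: torus_int_norm; first exact: ccontM_chr.
by move=> x xc; rewrite Normc.normcM normc_chr mulr1 fe.
Qed.

(** Integration by parts: the derivative of the periodic product of f and the character - k has
    integral 0. *)
Lemma coef_pderive (R : realType) (n : nat) (j : 'I_n)
    (f df : 'rV[R]_n -> R[i]) k :
  is_pderive j f df -> ccont f -> ccont df -> periodic f ((2 * pi) *: 'e_j) ->
  coef df k = ((k ord0 j)%:~R)%:C * 'i * coef f k.
Proof.
move=> H cf cdf pf; rewrite /coef mulrCA; congr (_ * _).
have cc := ccontM_chr (- k) cf; have cd := ccontM_chr (- k) cdf.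
have HM := is_pderiveM H (@is_pderive_chr R n (- k) j).
have c1 : ccont (fun x => f x * ((((- k) ord0 j)%:~R)%:C * 'i * torus_chr (- k) x)).
  apply: ccontM => //; apply: ccontM; last exact: ccont_chr.
  exact: ccont_cst.
have := torus_int_pderive HM cc (ccontD cd c1) _.
have -> : (fun x => df x * torus_chr (- k) x +
    f x * ((((- k) ord0 j)%:~R)%:C * 'i * torus_chr (- k) x)) =
  (fun x => (- (((k ord0 j)%:~R)%:C * 'i)) * (f x * torus_chr (- k) x) +
    df x * torus_chr (- k) x).
  by apply/funext => x; rewrite mxE !rmorphN /=; ring.
rewrite torus_intZD// mulNr => /(_ _)/eqP.
rewrite addrC subr_eq0 => E; apply/eqP; apply: E => x.
by rewrite pf chr_periodic.
Qed.

Lemma torus_int_conj (R : realType) (n : nat) (f : 'rV[R]_n -> R[i]) :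
  ccont f -> torus_int (fun x => conjc (f x)) = conjc (torus_int f).
Proof.
move=> [rf jf]; rewrite /torus_int /=; congr (_ +i* _).
  by congr cube_int; apply/funext => x /=; case: (f x).
have c0 : continuous (fun _ : 'rV[R]_n => 0 : R) by exact: cst_continuous.
have := cube_intZD (-1) jf c0; rewrite cube_int_cst mul0r addr0 mulN1r => <-.
congr cube_int; apply/funext => x /=; case: (f x) => a b /=.
by rewrite addr0 mulN1r.
Qed.

Lemma coef_conj (R : realType) (n : nat) (f : 'rV[R]_n -> R[i]) k :
  ccont f -> coef (fun x => conjc (f x)) k = conjc (coef f (- k)).
Proof.
move=> cf; rewrite /coef.
rewrite conjcM conjc_real; congr (_ * _).
rewrite -torus_int_conj; last exact: ccontM_chr.
congr torus_int; apply/funext => x.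
by rewrite conjcM -chrN opprK.
Qed.

(** Orthogonality: a nontrivial character is, up to a nonzero factor, one of its own partial
    derivatives, so its integral vanishes. *)
Lemma coef_chr (R : realType) (n : nat) (k l : 'rV[int]_n) :
  coef (@torus_chr R n l) k = (l == k)%:R.
Proof.
rewrite /coef.
have -> : (fun x => torus_chr l x * torus_chr (- k) x) = @torus_chr R n (l - k).
  by apply/funext => x; rewrite chrD.
have [->|lk] := eqVneq l k.
  have -> : @torus_chr R n (k - k) = (fun=> 1).
    by apply/funext => x; rewrite subrr chr0.
  rewrite /torus_int (_ : _ \o _ = (fun=> 1))// (_ : _ \o _ = (fun=> 0))//.
  rewrite !cube_int_cst mul0r mul1r -[(_ +i* 0)]/(_%:C) -rmorphM /=.
  by rewrite mulVf// gt_eqF// twopiX_gt0.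
suff -> : torus_int (@torus_chr R n (l - k)) = 0 by rewrite mulr0.
have [j kj] : exists j, (l - k) ord0 j != 0.
  apply/existsP; apply: contraNT lk; rewrite negb_exists => /forallP H.
  rewrite -subr_eq0; apply/eqP/rowP => j; rewrite [RHS]mxE.
  by have := H j; rewrite negbK => /eqP.
have cd : ccont (fun x => (((l - k) ord0 j)%:~R)%:C * 'i *
    @torus_chr R n (l - k) x).
  by apply: ccontM; [exact: ccont_cst|exact: ccont_chr].
have := torus_int_pderive (@is_pderive_chr R n (l - k) j) (@ccont_chr R n _) cd
  (@chr_periodic R n _ _).
have c0 : ccont (fun _ : 'rV[R]_n => 0 : R[i]) by exact: ccont_cst.
have := torus_intZD ((((l - k) ord0 j)%:~R)%:C * 'i) (@ccont_chr R n (l - k)) c0.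
rewrite torus_int0 addr0.
under eq_fun do rewrite addr0.
move=> -> /eqP; rewrite mulf_eq0 => /orP[|/eqP//].
rewrite mulf_eq0 eq_complex /= intr_eq0 (negPf kj) /=.
by rewrite eq_complex /= oner_eq0 andbF.
Qed.

(** * Positive peaking kernels *)

Definition in_box (R : realType) (n : nat) (t : 'rV[R]_n) (r : R)
  (x : 'rV[R]_n) : Prop := forall j, `|x ord0 j - t ord0 j| <= r.

(** Slices through the box are bounded by induction; nonnegativity of the other slices allows
    restricting the outer integral to the side of the box. *)
Lemma cube_int_box (R : realType) (n : nat) (g : 'rV[R]_n -> R) (t : 'rV[R]_n)
    (r c : R) :
  continuous g -> 0 <= r -> 0 <= c ->
  (forall x, in_box t r x -> in_cube x) ->
  (forall x, in_cube x -> 0 <= g x) -> (forall x, in_box t r x -> c <= g x) ->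
  c * (2 * r) ^+ n <= cube_int g.
Proof.
move=> + r0 c0; elim: n g t => [|n IH] g t cg bc g0 cle.
  by rewrite expr0 mulr1 /=; apply: cle => -[].
pose t0 := t ord0 ord0; pose t' := \row_j t ord0 (lift ord0 j).
have inb s x : `|s - t0| <= r -> in_box t' r x -> in_box t r (slice s x).
  move=> hs hx j; case: (unliftP ord0 j) => [i ->|->].
    by rewrite slice_lift; have := hx i; rewrite mxE.
  by rewrite slice0.
have t'b : in_box t' r t' by move=> j; rewrite subrr normr0.
have cub s : `|s - t0| <= r -> 0 <= s <= 2 * pi.
  by move=> hs; have := bc _ (inb s t' hs t'b) ord0; rewrite slice0.
have cs s : continuous (g \o slice s).
  exact: cont_comp (@slice_continuous _ _ _) cg.
have cG := slice_int_continuous cg.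
have G0 s : 0 <= s <= 2 * pi -> 0 <= cube_int (g \o slice s).
  move=> hs; have := @cube_int_le _ _ (fun=> 0) (g \o slice s) _ (cs s).
  rewrite cube_int_cst mul0r; apply; first exact: cst_continuous.
  by move=> x xc; apply: g0; exact: slice_cube.
have G1 s : `|s - t0| <= r -> c * (2 * r) ^+ n <= cube_int (g \o slice s).
  move=> hs; apply: (IH _ t') => // [x xb j|x xc|x xb].
  - by have := bc _ (inb s x hs xb) (lift ord0 j); rewrite slice_lift.
  - by apply: g0; apply: slice_cube => //; exact: cub.
  - by apply: cle; exact: inb.
have hs1 : 0 <= t0 - r.
  have : `|(t0 - r) - t0| <= r by rewrite addrAC subrr sub0r normrN ger0_norm.
  by move=> /cub/andP[].
have hs2 : t0 + r <= 2 * pi.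
  have : `|(t0 + r) - t0| <= r by rewrite addrAC subrr add0r ger0_norm.
  by move=> /cub/andP[].
rewrite cube_int_succ; set G := fun s => cube_int (g \o slice s).
have mI a b : measurable (`[a, b]%classic : set R) by exact: measurable_itv.
have iG a b : (@lebesgue_measure R).-integrable `[a, b] (EFin \o G).
  exact: cont_itv_integrable.
have sub : `[t0 - r, t0 + r]%classic `<=` (`[0, 2 * pi]%classic : set R).
  by move=> s /=; rewrite !in_itv/= => /andP[? ?]; apply/andP; split; lra.
apply: (@le_trans _ _ (\int[@lebesgue_measure R]_(s in `[t0 - r, t0 + r]) G s)).
  have HI : \int[@lebesgue_measure R]_(s in `[t0 - r, t0 + r])
      (c * (2 * r) ^+ n) <=
      \int[@lebesgue_measure R]_(s in `[t0 - r, t0 + r]) G s.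
    apply: le_Rintegral => //; last first.
      move=> s /=; rewrite in_itv/= => /andP[? ?]; apply: G1.
      by rewrite ler_norml; apply/andP; split; lra.
    by apply: cont_itv_integrable => x; exact: (@cst_continuous _ _ (_ : R)).
  apply: le_trans HI; rewrite Rintegral_cst// lebesgue_itvcc; last by lra.
  by rewrite exprSr mulrA (_ : t0 + r - (t0 - r) = 2 * r)//; ring.
rewrite /Rintegral; apply: fine_le; [exact: integrable_fin_num|
  exact: integrable_fin_num|].
apply: ge0_subset_integral => //.
by have /integrableP[] := iG 0 (2 * pi).
Qed.

(* The kernel of Rudin's proof that characters separate continuous functions:
   |T| <= 1 on the cube off the box of radius d around t, T >= 0 on this box
   and T > 1 near t. *)
Definition peak (R : realType) (n : nat) (t : 'rV[R]_n) (d : R)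
    (x : 'rV[R]_n) : R :=
  1 + (\sum_j (cos (x ord0 j - t ord0 j) - 1) + (1 - cos d)) / n.+1%:R.

Lemma peak_continuous (R : realType) (n : nat) (t : 'rV[R]_n) (d : R) :
  continuous (peak t d).
Proof.
have cc : continuous (fun x : 'rV[R]_n =>
    \sum_j (cos (x ord0 j - t ord0 j) - 1)).
  elim: (index_enum _) => [|j r IH].
    under eq_fun do rewrite big_nil.
    exact: cont_cst.
  under eq_fun do rewrite big_cons.
  apply: contD => //; apply: contD; last exact: cont_cst.
  apply: cont_comp (@continuous_cos R).
  by apply: contD; [exact: coord_continuous|exact: cont_cst].
have -> : peak t d = (fun x => n.+1%:R^-1 *
    (\sum_j (cos (x ord0 j - t ord0 j) - 1)) + (1 + (1 - cos d) / n.+1%:R)).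
  by apply/funext => x; rewrite /peak; ring.
by apply: contD; [exact: contZ|exact: cont_cst].
Qed.

(** The window from d to 2 pi - d is symmetric about pi, so its upper half folds back onto [d, pi],
    where cosine decreases. *)
Lemma cos_far (R : realType) (d u : R) : 0 <= d -> d <= `|u| ->
  `|u| <= 2 * pi - d -> cos u <= cos d.
Proof.
move=> d0.
have -> : cos u = cos `|u| by case: (ger0P u) => // _; rewrite cosN.
move: `|u| => v dv vd.
have p0 := pi_gt0 R.
have mono : forall w : R, d <= w -> w <= pi -> cos w <= cos d.
  move=> w dw wp; rewrite le_eqVlt; apply/orP.
  move: dw; rewrite le_eqVlt => /orP[/eqP->|dw]; [by left|right].
  by rewrite ltr_cos// in_itv/=; apply/andP; split; lra.
have [vp|pv] := leP v pi; first exact: mono.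
have -> : cos v = cos (2 * pi - v).
  rewrite -[in RHS]cosN opprB -(@cosD2pi R (v - 2 * pi)); congr cos.
  by rewrite -mulr_natl; ring.
by apply: mono; lra.
Qed.

Lemma peak_off_box (R : realType) (n : nat) (t x : 'rV[R]_n) (d : R) :
  0 <= d -> in_cube x -> (forall j, d <= t ord0 j <= 2 * pi - d) ->
  ~ in_box t d x -> `|peak t d x| <= 1.
Proof.
move=> d0 xc tc /existsNP[j /negP]; rewrite -ltNge => dj.
set S := \sum_j (cos (x ord0 j - t ord0 j) - 1).
have Sle : S <= cos d - 1.
  rewrite /S (bigD1 j)//= -[leRHS]addr0; apply: lerD.
    rewrite lerB//; apply: cos_far => //; first exact: ltW.
    (* As t_j keeps distance d from both ends of [0, 2 pi], the difference x_j - t_j is at most 2 pi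
       - d in absolute value. *)
    have := xc j; have := tc j; rewrite ler_norml => /andP[? ?] /andP[? ?].
    by apply/andP; split; lra.
  by apply: sumr_le0 => i _; rewrite subr_le0 cos_le1.
(* The division by n + 1 in [peak] is made for this bound: it gives [peak] >= 1 - 2 n / (n + 1) >= -
   1. *)
have Sge : - (2 * n%:R) <= S.
  have -> : - (2 * n%:R) = \sum_(i < n) (- 2) :> R.
    by rewrite sumr_const card_ord mulNrn mulr_natr.
  apply: ler_sum => i _; have := cos_geN1 (x ord0 i - t ord0 i); lra.
have := cos_le1 d; have := cos_geN1 d => c1 c2.
have n0 : 0 < n.+1%:R :> R by rewrite ltr0n.
have nE : n.+1%:R = n%:R + 1 :> R by rewrite -addn1 natrD.
rewrite /peak -/S ler_norml; apply/andP; split.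
  rewrite -lerBlDl ler_pdivlMr// nE; lra.
rewrite gerDl pmulr_lle0 ?invr_gt0//; lra.
Qed.

Lemma peak_on_box (R : realType) (n : nat) (t x : 'rV[R]_n) (d : R) :
  0 <= d -> d <= pi / 2 -> in_box t d x -> 0 <= peak t d x.
Proof.
move=> d0 dp xb; set S := \sum_j (cos (x ord0 j - t ord0 j) - 1).
have Sge : - n%:R <= S.
  have -> : - n%:R = \sum_(i < n) (- 1) :> R.
    by rewrite sumr_const card_ord mulNrn.
  apply: ler_sum => i _; rewrite lerBrDl subrr; apply: cos_ge0_pihalf.
  by have := xb i; rewrite ler_norml => /andP[? ?]; apply/andP; split; lra.
have c2 := cos_le1 d.
have n0 : 0 < n.+1%:R :> R by rewrite ltr0n.
have nE : n.+1%:R = n%:R + 1 :> R by rewrite -addn1 natrD.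
rewrite /peak -/S -lerBlDl ler_pdivlMr// nE; lra.
Qed.

Lemma bernoulli_ineq (R : realType) (q : R) N : 0 <= q ->
  1 + N%:R * q <= (1 + q) ^+ N.
Proof.
move=> q0; elim: N => [|N IH]; first by rewrite mul0r addr0 expr0.
rewrite exprS (le_trans (y := (1 + q) * (1 + N%:R * q)))//; last first.
  by rewrite ler_wpM2l// addr_ge0.
rewrite -addn1 natrD mulrDl mulrDr !mulrDl !mul1r !mulr1.
have : 0 <= q * (N%:R * q) by rewrite !mulr_ge0.
lra.
Qed.

Lemma exprn_unbounded (R : realType) (q A C : R) : 0 < q -> 0 < A ->
  exists N, C < A * (1 + q) ^+ N.
Proof.
move=> q0 A0; exists (Num.bound (`|C| / (A * q))).
have H := archi_boundP (x := `|C| / (A * q)) _.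
have Aq : 0 < A * q by rewrite mulr_gt0.
have {}H : `|C| < (Num.bound (`|C| / (A * q)))%:R * (A * q).
  by rewrite -ltr_pdivrMr// H// divr_ge0// ltW.
apply: le_lt_trans (ler_norm C) _; apply: lt_le_trans H _.
rewrite mulrCA ler_pM2l//; apply: le_trans (bernoulli_ineq _ (ltW q0)).
by rewrite lerDr.
Qed.

Lemma near_box (R : realType) (n : nat) (g : 'rV[R]_n -> R) (t : 'rV[R]_n) c :
  continuous g -> c < g t ->
  exists2 r : R, 0 < r & forall x, in_box t r x -> c <= g x.
Proof.
move=> cg ct; have e0 : 0 < g t - c by rewrite subr_gt0.
have /cvgrPdist_lt/(_ _ e0)/nbhs_ballP[d /= d0 hd] := cg t.
exists (d / 2); first by rewrite divr_gt0.
move=> x xb; have xd : ball t d x.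
  split=> // i j; rewrite (ord1 i) /ball/= distrC.
  by apply: le_lt_trans (xb j) _; rewrite ltr_pdivrMr// ltr_pMr// ltr1n.
by have := hd x xd; rewrite /= ltr_norml => /andP[_ ?]; lra.
Qed.

(** If [g t] were positive, g would be positive on a box around t. Against [peak t d x ^+ N] the
    rest of the cube contributes a bounded amount, the box a nonnegative one, and a smaller box at
    least a multiple of (1 + q) ^+ N, so the integral could not vanish for large N. *)
Lemma peak_test (R : realType) (n : nat) (g : 'rV[R]_n -> R) (t : 'rV[R]_n) :
  continuous g -> (forall j, 0 < t ord0 j < 2 * pi) ->
  (forall d N, cube_int (fun x => g x * peak t d x ^+ N) = 0) -> g t <= 0.
Proof.
move=> cg tc H; rewrite leNgt; apply/negP => gt0.
have P0 := pi_gt0 R.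
have [r r0 hr] : exists2 r : R, 0 < r & forall x, in_box t r x -> g t / 2 <= g x.
  by apply: near_box => //; rewrite ltr_pdivrMr// ltr_pMr// ltr1n.
have [d0 d00 hd0] : exists2 d : R, 0 < d &
    forall j, d <= t ord0 j <= 2 * pi - d.
  have near1 : exists2 d : R, 0 < d & forall j : 'I_n, d <= t ord0 j.
    exists (\big[Num.min/1]_j t ord0 j).
      by apply/bigmin_gtP; split=> // j _; have /andP[] := tc j.
    by move=> j; exact: bigmin_le.
  have near2 : exists2 d : R, 0 < d & forall j : 'I_n, d <= 2 * pi - t ord0 j.
    exists (\big[Num.min/1]_j (2 * pi - t ord0 j)).
      by apply/bigmin_gtP; split=> // j _; have /andP[] := tc j; rewrite subr_gt0.
    by move=> j; exact: bigmin_le.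
  have [a a0 ha] := near1; have [b b0 hb] := near2.
  exists (Num.min a b); first by rewrite lt_min a0.
  move=> j; rewrite (le_trans _ (ha j)) ?ge_min ?lexx//=.
  have : Num.min a b <= b by rewrite ge_min lexx orbT.
  have := hb j; lra.
pose d := Num.min r (Num.min d0 (pi / 2)).
have dd0 : 0 < d by rewrite !lt_min r0 d00 divr_gt0.
have dr : d <= r by rewrite ge_min lexx.
have dd : d <= d0 by rewrite !ge_min lexx orbT.
have dp : d <= pi / 2 by rewrite !ge_min lexx !orbT.
have cT := @peak_continuous R n t d.
have cosd : cos d < 1.
  rewrite -[ltRHS]cos0 ltr_cos// in_itv/=; apply/andP; split; lra.
(* At its centre [peak] equals 1 + 2 q, hence it exceeds 1 + q on a smaller box. *)
pose q := (1 - cos d) / n.+1%:R / 2.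
have q0 : 0 < q by rewrite !divr_gt0// subr_gt0.
have [rho rho0 hrho] : exists2 r : R, 0 < r &
    forall x, in_box t r x -> 1 + q <= peak t d x.
  apply: near_box => //.
  rewrite /peak big1 ?add0r ?ltrD2l ?/q; last first.
    by move=> j _; rewrite subrr cos0 subrr.
  by rewrite ltr_pdivrMr// ltr_pMr ?ltr1n// divr_gt0// subr_gt0.
pose s := Num.min rho d.
have s0 : 0 < s by rewrite lt_min rho0.
have srho : s <= rho by rewrite ge_min lexx.
have sd : s <= d by rewrite ge_min lexx orbT.
have box_mono (a b : R) x : a <= b -> in_box t a x -> in_box t b x.
  by move=> ab xb j; exact: le_trans (xb j) ab.
have box_cube x : in_box t s x -> in_cube x.
  move=> xb j; have := xb j; have := hd0 j; rewrite ler_norml.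
  by move=> /andP[? ?] /andP[? ?]; apply/andP; split; lra.
have [C C0 HC] : exists2 C : R, 0 <= C & forall x, in_cube x -> `|g x| <= C.
  have cK : compact (g @` @in_cube R n).
    apply: continuous_compact; last exact: cube_compact.
    exact: continuous_subspaceT.
  have [M [Mr HM]] := compact_bounded cK.
  exists (`|M| + 1) => [|x xc]; first by rewrite addr_ge0.
  apply: (HM (`|M| + 1)); last by exists x.
  by rewrite (le_lt_trans (ler_norm M))// ltrDl.
have A0 : 0 < g t / 2 * (2 * s) ^+ n.
  by rewrite mulr_gt0// ?divr_gt0// exprn_gt0// mulr_gt0.
have [N] := exprn_unbounded (C * (2 * pi) ^+ n) q0 A0; rewrite ltNge => /negP; apply.
have cgT : continuous (fun x => g x * peak t d x ^+ N).
  move=> x; apply: (@continuousM _ _ g); first exact: cg.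
  apply: (@continuous_comp _ _ _ (peak t d) (fun y => y ^+ N)); first exact: cT.
  exact: exprn_continuous.
have cC : continuous (fun _ : 'rV[R]_n => C) by exact: cst_continuous.
(* Adding the constant C, which bounds the integrand off the box, makes it nonnegative on the whole
   cube, as [cube_int_box] demands. *)
have := cube_intZD 1 cgT cC; rewrite H mulr0 add0r cube_int_cst => <-.
rewrite mulrAC; apply: (@cube_int_box _ _ _ t) => //.
- move=> x; apply: (@continuousD _ _ _ (fun x => 1 * (g x * peak t d x ^+ N)));
    last exact: cC.
  exact: contZ.
- exact: ltW.
- by apply: mulr_ge0; [rewrite divr_ge0// ltW|rewrite exprn_ge0// addr_ge0// ltW].
- move=> x xc; rewrite mul1r; have [xb|xb] := pselect (in_box t d x).
    rewrite addr_ge0// mulr_ge0//.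
      apply: le_trans (hr x (box_mono _ _ _ dr xb)).
      by rewrite divr_ge0// ltW.
    by rewrite exprn_ge0//; apply: peak_on_box => //; exact: ltW.
  have T1 : `|peak t d x ^+ N| <= 1.
    rewrite normrX exprn_ile1//; apply: peak_off_box => //; first exact: ltW.
    by move=> j; have := hd0 j => /andP[? ?]; apply/andP; split; lra.
  have : `|g x * peak t d x ^+ N| <= C.
    by rewrite normrM (le_trans _ (HC x xc))// ler_piMr.
  by rewrite ler_norml => /andP[]; lra.
- move=> x xb; rewrite mul1r -[leLHS]addr0; apply: lerD => //.
  apply: ler_pM.
  + by rewrite divr_ge0// ltW.
  + by rewrite exprn_ge0// addr_ge0// ltW.
  + by apply: hr; apply: box_mono xb; lra.
  + apply: lerXn2r; rewrite ?nnegrE; first by rewrite addr_ge0// ltW.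
      by apply: peak_on_box => //; [exact: ltW|exact: box_mono xb].
    by apply: hrho; exact: box_mono xb.
Qed.

(** * Uniqueness of Fourier coefficients *)

(** Quantifying over all k makes the class of these phi stable under multiplication by characters,
    hence by [peak]; powers of the kernel are thus reached without representing trigonometric
    polynomials. *)
Definition annihilates (R : realType) (n : nat) (f phi : 'rV[R]_n -> R[i]) :
    Prop :=
  ccont phi /\ forall k, torus_int (fun x => f x * phi x * torus_chr k x) = 0.

Lemma annihilatesZD (R : realType) (n : nat) (f phi psi : 'rV[R]_n -> R[i]) a :
  ccont f -> annihilates f phi -> annihilates f psi ->
  annihilates f (fun x => a * phi x + psi x).
Proof.
move=> cf [cp Hp] [cq Hq]; split=> [|k]; first exact: ccontZD.
have -> : (fun x => f x * (a * phi x + psi x) * torus_chr k x) =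
    (fun x => a * (f x * phi x * torus_chr k x) + f x * psi x * torus_chr k x).
  by apply/funext => x; ring.
by rewrite torus_intZD ?Hp ?Hq ?mulr0 ?addr0//; apply: ccontM_chr; exact: ccontM.
Qed.

Lemma annihilates0 (R : realType) (n : nat) (f : 'rV[R]_n -> R[i]) :
  annihilates f (fun=> 0).
Proof.
split=> [|k]; first exact: ccont_cst.
by under eq_fun do rewrite mulr0 mul0r; exact: torus_int0.
Qed.

Lemma annihilates_chr (R : realType) (n : nat) (f phi : 'rV[R]_n -> R[i]) l :
  annihilates f phi -> annihilates f (fun x => phi x * torus_chr l x).
Proof.
move=> [cp Hp]; split=> [|k]; first exact: ccontM_chr.
rewrite -[RHS](Hp (l + k)); congr torus_int; apply/funext => x.
by rewrite chrD; ring.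
Qed.

Lemma dotz_delta (R : realType) (n : nat) (x : 'rV[R]_n) (j : 'I_n) :
  dotz ('e_j : 'rV[int]_n) x = x ord0 j.
Proof.
rewrite /dotz (bigD1 j)//= !mxE !eqxx mul1r big1 ?addr0// => i ij.
by rewrite !mxE eqxx (negPf ij) mul0r.
Qed.

Lemma cos_cis (R : realType) (u : R) :
  (cos u)%:C = (2%:R^-1)%:C * (cis u + conjc (cis u)).
Proof. by rewrite /cis; simpc; congr (_ +i* _); lra. Qed.

Lemma annihilates_peak (R : realType) (n : nat) (f phi : 'rV[R]_n -> R[i]) t d :
  ccont f -> annihilates f phi ->
  annihilates f (fun x => phi x * (peak t d x)%:C).
Proof.
move=> cf Hp; pose c : R := n.+1%:R^-1.
(* [z j] and [w j] are the Fourier coefficients of [peak t d] at the frequencies e_j and - e_j. *)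
pose z (j : 'I_n) : R[i] := (c / 2)%:C * cis (- t ord0 j).
pose w (j : 'I_n) : R[i] := (c / 2)%:C * cis (t ord0 j).
have E x : phi x * (peak t d x)%:C = (1 + (1 - cos d) * c)%:C * phi x +
    \sum_j (z j * (phi x * torus_chr 'e_j x) +
      (w j * (phi x * torus_chr (- 'e_j) x) + (- c)%:C * phi x)).
  rewrite /peak -/c; set S := \sum_j (cos _ - 1).
  have -> : (1 + (S + (1 - cos d)) * c)%:C =
      (1 + (1 - cos d) * c)%:C + (S * c)%:C.
    by rewrite -rmorphD /=; congr (_%:C); ring.
  rewrite mulrDr mulrC; congr (_ + _).
  rewrite rmorphM /= [S%:C]rmorph_sum /= mulr_suml mulr_sumr.
  apply: eq_bigr => j _.
  rewrite chrN /torus_chr dotz_delta rmorphB /= cos_cis cisD conjcM.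
  rewrite [conjc (cis (- _))]conj_cis opprK /z /w !rmorphM !rmorphN /=.
  ring.
rewrite (funext E).
apply: annihilatesZD => //; elim: (index_enum _) => [|j r IH].
  by under eq_fun do rewrite big_nil; exact: annihilates0.
under eq_fun do rewrite big_cons -addrA.
apply: annihilatesZD => //; first exact: annihilates_chr.
under eq_fun do rewrite -addrA.
apply: annihilatesZD => //; first exact: annihilates_chr.
exact: annihilatesZD.
Qed.

Lemma annihilated_Re_le0 (R : realType) (n : nat) (f : 'rV[R]_n -> R[i]) x :
  ccont f -> annihilates f (fun=> 1) -> in_cube x -> complex.Re (f x) <= 0.
Proof.
move=> cf Hf xc.
have inner (t : 'rV[R]_n) : (forall j, 0 < t ord0 j < 2 * pi) -> complex.Re (f t) <= 0.
  move=> ht; apply: (peak_test (g := @complex.Re R \o f) cf.1 ht) => d N.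
  have [_ /(_ 0)] : annihilates f (fun x => (peak t d x)%:C ^+ N).
    elim: N => [|N IH]; first by under eq_fun do rewrite expr0.
    by under eq_fun do rewrite exprSr; exact: annihilates_peak.
  move=> /(congr1 (@complex.Re R)) /= <-; congr cube_int; apply/funext => y /=.
  rewrite chr0 mulr1 -rmorphXn /=.
  by case: (f y) => a b /=; rewrite mulr0 subr0.
rewrite leNgt; apply/negP => gt0.
have P0 := pi_gt0 R.
have [r r0 hr] : exists2 r : R, 0 < r &
    forall y, in_box x r y -> complex.Re (f x) / 2 <= complex.Re (f y).
  apply: (@near_box _ _ (@complex.Re R \o f)); first exact: cf.1.
  by rewrite /= ltr_pdivrMr// ltr_pMr// ltr1n.
pose s := Num.min 2^-1 (r / pi).
have s0 : 0 < s by rewrite lt_min invr_gt0 ltr0n divr_gt0.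
have s1 : s <= 2^-1 by rewrite ge_min lexx.
have sr : s * pi <= r by rewrite -ler_pdivlMr// ge_min lexx orbT.
(* [peak_test] covers interior points only; a boundary point is moved slightly towards the centre
   (pi, ..., pi), and continuity does the rest. *)
pose y : 'rV[R]_n := \row_j (x ord0 j + s * (pi - x ord0 j)).
have yj j : y ord0 j = x ord0 j + s * (pi - x ord0 j) by rewrite mxE.
have : complex.Re (f y) <= 0.
  apply: inner => j; rewrite yj; have /andP[x0 x1] := xc j.
  have sp : 0 < s * pi by rewrite mulr_gt0.
  have sx : s * x ord0 j <= 2^-1 * x ord0 j by rewrite ler_wpM2r.
  have sx2 : s * (2 * pi - x ord0 j) <= 2^-1 * (2 * pi - x ord0 j).
    by rewrite ler_wpM2r// subr_ge0.
  by apply/andP; split; nra.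
have : complex.Re (f x) / 2 <= complex.Re (f y).
  apply: hr => j; rewrite yj addrAC subrr add0r normrM gtr0_norm//.
  apply: le_trans sr; apply: ler_wpM2l; first exact: ltW.
  rewrite ler_norml.
  by have /andP[x0 x1] := xc j; apply/andP; split; lra.
have : 0 < complex.Re (f x) / 2 by rewrite divr_gt0.
lra.
Qed.

(** The one-sided bound [annihilated_Re_le0], applied to c f for c = 1, - 1, i and - i, squeezes
    both parts of f to 0. *)
Lemma coef_eq0 (R : realType) (n : nat) (f : 'rV[R]_n -> R[i]) :
  ccont f -> torus_periodic f -> (forall k, coef f k = 0) -> f = (fun=> 0).
Proof.
move=> cf pf Hf.
have ann (c : R[i]) : annihilates (fun x => c * f x) (fun=> 1).
  split=> [|k]; first exact: ccont_cst.
  have c0 : ccont (fun _ : 'rV[R]_n => 0 : R[i]) by exact: ccont_cst.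
  have := torus_intZD c (ccontM_chr k cf) c0.
  rewrite torus_int0 addr0 => E; rewrite (_ : (fun x => _) =
    (fun x => c * (f x * torus_chr k x) + 0)); last first.
    by apply/funext => x; ring.
  rewrite E; have /eqP := Hf (- k); rewrite /coef mulf_eq0 opprK => /orP[|/eqP->].
    by rewrite eq_complex /= invr_eq0 (gt_eqF (twopiX_gt0 _ _)).
  by rewrite mulr0.
have cc (c : R[i]) : ccont (fun x => c * f x).
  by apply: ccontM => //; exact: ccont_cst.
have H c x := annihilated_Re_le0 (cc c) (ann c) (x := x).
apply/funext => x; have [y yc <-//] := cube_repr x.
have := H 1 y yc; have := H (-1) y yc; have := H 'i y yc; have := H (- 'i) y yc.
case: (f y) => a b /=.
rewrite !mul0r !mul1r !oppr0 !mul0r ?mulN1r ?add0r ?subr0 ?opprK.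
move=> h1 h2 h3 h4; apply/eqP; rewrite eq_complex /=; apply/andP; split.
  by rewrite eq_le; apply/andP; split; lra.
by rewrite eq_le; apply/andP; split; lra.
Qed.

(** * Sums over lattice boxes *)

(** The successor keeps the weight at least 1, so that its powers are invertible and increase with
    the exponent. *)
Definition wt (n : nat) (k : 'rV[int]_n) : nat :=
  (\sum_j absz (k ord0 j)).+1.

Definition box (n M : nat) : seq 'rV[int]_n :=
  [seq (\row_j ((a j : nat)%:Z - M%:Z)) |
    a : {ffun 'I_n -> 'I_((M + M).+1)} <- enum {: {ffun 'I_n -> 'I_((M + M).+1)}}].

Lemma mem_box (n M : nat) (k : 'rV[int]_n) :
  (k \in box n M) = [forall j, (absz (k ord0 j) <= M)%N].
Proof.
apply/mapP/forallP => [[a _ ->] j|H].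
  rewrite mxE; move: (nat_of_ord (a j)) (ltn_ord (a j)) => i; lia.
have kb (j : 'I_n) : (absz (k ord0 j + M%:Z)%R < (M + M).+1)%N.
  by have := H j; lia.
exists [ffun j => Ordinal (kb j)]; first by rewrite mem_enum.
apply/rowP => j; rewrite !mxE ffunE /= (_ : k 0 j = k ord0 j)//.
by move: (k ord0 j) (H j) => z; lia.
Qed.

Lemma box_uniq (n M : nat) : uniq (box n M).
Proof.
rewrite map_inj_uniq ?enum_uniq// => a b /rowP ab.
apply/ffunP => j; apply/val_inj => /=.
by have := ab j; rewrite !mxE; lia.
Qed.

Lemma boxS (n M M' : nat) k : (M <= M')%N -> k \in box n M -> k \in box n M'.
Proof.
rewrite !mem_box => MM /forallP H; apply/forallP => j.
exact: leq_trans (H j) MM.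
Qed.

Lemma box_oppr (n M : nat) k : (- k \in box n M) = (k \in box n M).
Proof.
by rewrite !mem_box; apply: eq_forallb => j; rewrite mxE abszN.
Qed.

Lemma box_sum_sub (n M M' : nat) (V : zmodType) (F : 'rV[int]_n -> V) :
  (M <= M')%N ->
  \sum_(k <- box n M) F k = \sum_(k <- box n M' | k \in box n M) F k.
Proof.
move=> MM; rewrite -[RHS]big_filter; apply: perm_big; apply: uniq_perm.
- exact: box_uniq.
- by rewrite filter_uniq// box_uniq.
move=> k; rewrite mem_filter; case: (boolP (k \in box n M)) => //= kb.
by rewrite (boxS MM kb).
Qed.

Lemma wt_box (n M : nat) k : (wt k <= M)%N -> k \in box n M.
Proof.
rewrite mem_box /wt => H; apply/forallP => j.
by move: H; rewrite (bigD1 j)//=; lia.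
Qed.

Lemma wt_notin_box (n M : nat) k : k \notin box n M -> (M.+1 <= wt k)%N.
Proof. by move=> kb; rewrite ltnS leqNgt; apply: contra kb => /wt_box. Qed.

Lemma wtN (n : nat) (k : 'rV[int]_n) : wt (- k) = wt k.
Proof. by rewrite /wt; congr _.+1; apply: eq_bigr => j _; rewrite mxE abszN. Qed.

Lemma coord_le_wt (n : nat) (k : 'rV[int]_n) j : (absz (k ord0 j) < wt k)%N.
Proof. by rewrite /wt (bigD1 j)//=; lia. Qed.

(** A weight chosen to telescope: each half of the integers contributes at most 1, which gives the
    bound 2 of [sum_wtc]. *)
Definition wtc (R : realType) (i : int) : R :=
  ((absz i).+1%:R * (absz i).+2%:R)^-1.

Lemma wtc_ge0 (R : realType) (i : int) : 0 <= wtc R i.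
Proof. by rewrite invr_ge0 mulr_ge0. Qed.

Lemma sum_telescope_inv (R : realType) m :
  \sum_(0 <= i < m) ((i.+1%:R * i.+2%:R)^-1 : R) <= 1.
Proof.
have -> : \sum_(0 <= i < m) ((i.+1%:R * i.+2%:R)^-1 : R) = 1 - m.+1%:R^-1.
  elim: m => [|m IH]; first by rewrite big_geq// invr1 subrr.
  rewrite big_nat_recr//= IH -[m.+2]addn1 natrD.
  have : m.+1%:R != 0 :> R by rewrite pnatr_eq0.
  have : m.+1%:R + 1 != 0 :> R by rewrite natr1 pnatr_eq0.
  by move: (m.+1%:R : R) => x x1 x0; field; rewrite x1 x0.
by rewrite gerBl invr_ge0.
Qed.

Lemma sum_wtc (R : realType) M :
  \sum_(i < (M + M).+1) wtc R ((i : nat)%:Z - M%:Z) <= 2.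
Proof.
rewrite -(big_mkord xpredT (fun i : nat => wtc R (i%:Z - M%:Z))).
rewrite (@big_cat_nat _ _ _ M)//=; last by lia.
rewrite -[2]/(1 + 1); apply: lerD.
  rewrite big_nat_rev /= add0n.
  apply: le_trans (sum_telescope_inv R M).
  rewrite !big_nat; apply: ler_sum => i /andP[_ iM].
  rewrite /wtc (_ : absz _ = i.+1); last by lia.
  rewrite lef_pV2 ?posrE ?mulr_gt0 ?ltr0n//.
  by apply: ler_pM; rewrite ?ler0n// ler_nat.
rewrite -{1}[M]add0n big_addn (_ : ((M + M).+1 - M)%N = M.+1); last by lia.
apply: le_trans (sum_telescope_inv R M.+1).
apply: ler_sum => i _.
by rewrite /wtc (_ : absz _ = i)//; lia.
Qed.

Lemma box_sum_prod (R : realType) (n M : nat) :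
  \sum_(k <- box n M) \prod_j wtc R (k ord0 j) <= 2 ^+ n.
Proof.
rewrite big_map big_enum /=.
have -> : \sum_(a : {ffun 'I_n -> 'I_((M + M).+1)})
    \prod_j wtc R ((\row_l ((a l : nat)%:Z - M%:Z)) ord0 j) =
    \prod_(j < n) \sum_(i < (M + M).+1) wtc R ((i : nat)%:Z - M%:Z).
  rewrite bigA_distr_bigA /=; apply: eq_bigr => a _; apply: eq_bigr => j _.
  by rewrite mxE.
rewrite prodr_const card_ord lerXn2r ?nnegrE ?sum_wtc//.
by apply: sumr_ge0 => i _; exact: wtc_ge0.
Qed.

(** A coordinate a of k satisfies |a| < [wt k], whence (|a| + 1) (|a| + 2) <= 2 (wt k)^2. The
    product over the n coordinates explains the exponent 2 n in the summability hypotheses below. *)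
Lemma wt_prod (R : realType) (n : nat) (k : 'rV[int]_n) :
  ((wt k)%:R ^+ (2 * n))^-1 <= 2 ^+ n * \prod_j wtc R (k ord0 j).
Proof.
have w0 : 0 < (wt k)%:R :> R by rewrite ltr0n.
have -> : ((wt k)%:R ^+ (2 * n))^-1 = \prod_(j < n) ((wt k)%:R ^+ 2)^-1 :> R.
  by rewrite prodr_const card_ord exprVn -exprM.
have -> : 2 ^+ n * \prod_j wtc R (k ord0 j) = \prod_j (2 * wtc R (k ord0 j)).
  by rewrite big_split/= prodr_const card_ord.
apply: ler_prod => j _.
rewrite invr_ge0 exprn_ge0//= /wtc.
have c0 : 0 < ((absz (k ord0 j)).+1%:R * (absz (k ord0 j)).+2%:R) :> R.
  by rewrite mulr_gt0.
rewrite -[leLHS]mul1r ler_pdivrMr ?exprn_gt0// mulrAC ler_pdivlMr// mul1r.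
rewrite expr2 -!natrM ler_nat; have := coord_le_wt k j.
by move: (absz _) (wt k) => a b; nia.
Qed.

Lemma box_sum_le (R : realType) (n M : nat) (a : 'rV[int]_n -> R) (C : R) :
  0 <= C -> (forall k, a k * (wt k)%:R ^+ (2 * n) <= C) ->
  \sum_(k <- box n M) a k <= C * 4 ^+ n.
Proof.
move=> C0 H.
have -> : C * 4 ^+ n = (C * 2 ^+ n) * 2 ^+ n.
  by rewrite -mulrA -exprMn -natrM.
apply: le_trans (ler_wpM2l _ (@box_sum_prod R n M)); last first.
  by rewrite mulr_ge0// exprn_ge0.
rewrite mulr_sumr; apply: ler_sum => k _.
have w0 : 0 < (wt k)%:R ^+ (2 * n) :> R by rewrite exprn_gt0// ltr0n.
rewrite -mulrA; apply: le_trans (ler_wpM2l C0 (wt_prod R k)).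
by rewrite ler_pdivlMr.
Qed.

(** The power beyond 2 n pays for the rate: outside [box n M] the weight is at least M + 1. *)
Lemma box_tail_le (R : realType) (n M M' : nat) (a : 'rV[int]_n -> R) (C : R) :
  (M <= M')%N -> 0 <= C -> (forall k, 0 <= a k) ->
  (forall k, a k * (wt k)%:R ^+ (2 * n).+1 <= C) ->
  \sum_(k <- box n M' | k \notin box n M) a k <= C * 4 ^+ n / M.+1%:R.
Proof.
move=> MM C0 a0 H; rewrite big_mkcond /= mulrAC.
apply: box_sum_le => [|k]; first by rewrite divr_ge0.
have w0 : 0 < (wt k)%:R :> R by rewrite ltr0n.
case: ifP => [kb|_]; last by rewrite mul0r divr_ge0.
rewrite ler_pdivlMr ?ltr0n//; apply: le_trans (H k).
rewrite -mulrA; apply: ler_wpM2l => //.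
by rewrite exprSr ler_wpM2l ?exprn_ge0// ler_nat wt_notin_box.
Qed.

Lemma box_tail_norm (R : realType) (n M M' : nat) (b : 'rV[int]_n -> R[i])
    (C : R) :
  (M <= M')%N -> (forall k, Normc.normc (b k) * (wt k)%:R ^+ (2 * n).+1 <= C) ->
  Normc.normc (\sum_(k <- box n M') b k - \sum_(k <- box n M) b k) <=
    C * 4 ^+ n / M.+1%:R.
Proof.
move=> MM H; have C0 : 0 <= C.
  by apply: le_trans (H 0); apply: mulr_ge0; [exact: normc_ge0|exact: exprn_ge0].
rewrite (box_sum_sub b MM) (bigID (fun k => k \in box n M)) /= addrAC subrr add0r.
rewrite -big_filter; apply: le_trans (normc_sum _ _) _; rewrite big_filter.
by apply: box_tail_le => // k; exact: normc_ge0.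
Qed.

(** Stands in for passing to the limit: estimates for synthesised functions are checked on partial
    sums, up to an error D / (M + 1). *)
Lemma le_of_harmonic (R : realType) (x y D : R) :
  (forall M : nat, x <= y + D / M.+1%:R) -> x <= y.
Proof.
move=> H; rewrite leNgt; apply/negP => yx.
have e0 : 0 < x - y by rewrite subr_gt0.
have := archi_boundP (x := `|D| / (x - y)) _.
rewrite divr_ge0// ?ltW// => /(_ isT); set M := Num.bound _ => HM.
have := H M; rewrite -lerBlDl leNgt => /negP; apply.
rewrite ltr_pdivrMr ?ltr0n//; apply: le_lt_trans (ler_norm D) _.
move: HM; rewrite ltr_pdivrMr// mulrC => /lt_le_trans; apply.
by apply: ler_wpM2l; [exact: ltW|rewrite ler_nat].
Qed.

Lemma cauchy_rate_lim (R : realType) (u : nat -> R) (D : R) :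
  (forall M M', (M <= M')%N -> `|u M' - u M| <= D / M.+1%:R) ->
  forall M, `|limn u - u M| <= D / M.+1%:R.
Proof.
move=> H; have cu : cvgn u.
  apply/cauchy_cvgP/cauchyP => e e0.
  have := archi_boundP (x := `|D| / e) _.
  rewrite divr_ge0// ?ltW// => /(_ isT); set M := Num.bound _ => HM.
  exists (u M); exists M => // M' /= MM; rewrite /ball/= distrC.
  apply: le_lt_trans (H _ _ MM) _; rewrite ltr_pdivrMr ?ltr0n//.
  apply: le_lt_trans (ler_norm D) _; move: HM; rewrite ltr_pdivrMr// mulrC.
  by move=> /lt_le_trans; apply; apply: ler_wpM2l; [exact: ltW|rewrite ler_nat].
move=> M; apply: (@cvgr_to_le _ \oo _ _ (fun M' => `|u M' - u M|)).
  apply: cvg_norm; apply: cvgB => //; exact: cvg_cst.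
by exists M => // M' /= MM; exact: H.
Qed.

Definition csum (R : realType) (n : nat) (b : 'rV[int]_n -> R[i]) : R[i] :=
  limn (fun M => complex.Re (\sum_(k <- box n M) b k)) +i*
  limn (fun M => complex.Im (\sum_(k <- box n M) b k)).

Lemma csum_rate (R : realType) (n : nat) (b : 'rV[int]_n -> R[i]) (C : R) :
  (forall k, Normc.normc (b k) * (wt k)%:R ^+ (2 * n).+1 <= C) ->
  forall M, Normc.normc (csum b - \sum_(k <- box n M) b k) <=
    2 * (C * 4 ^+ n) / M.+1%:R.
Proof.
move=> H M; pose S M := \sum_(k <- box n M) b k.
have SH M1 M2 : (M1 <= M2)%N ->
    Normc.normc (S M2 - S M1) <= C * 4 ^+ n / M1.+1%:R.
  by move=> MM; exact: box_tail_norm.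
have hr := @cauchy_rate_lim _ (fun M => complex.Re (S M)) (C * 4 ^+ n).
have hi := @cauchy_rate_lim _ (fun M => complex.Im (S M)) (C * 4 ^+ n).
rewrite -/(S M) -mulrA mulr2n mulrDl mul1r.
apply: le_trans (normc_le_ReIm _) _; apply: lerD.
  apply: le_trans (hr _ M); first by rewrite /csum; case: (S M).
  move=> M1 M2 MM; apply: le_trans (SH _ _ MM).
  apply: le_trans (Re_le_normc _).
  by case: (S M1) (S M2) => ? ? [? ?].
apply: le_trans (hi _ M); first by rewrite /csum; case: (S M).
move=> M1 M2 MM; apply: le_trans (SH _ _ MM).
apply: le_trans (Im_le_normc _).
by case: (S M1) (S M2) => ? ? [? ?].
Qed.

(** * Synthesis of smooth functions from rapidly decreasing coefficients *)

(** The coefficient families of smooth functions: [rapid_coef] gives one direction, [smooth_synth]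
    and [coef_synth] the other. *)
Definition rapid (R : realType) (n : nat) (b : 'rV[int]_n -> R[i]) : Prop :=
  forall p : nat, exists C : R, forall k, Normc.normc (b k) * (wt k)%:R ^+ p <= C.

Definition poly_bounded (R : realType) (n : nat) (b : 'rV[int]_n -> R[i]) :
    Prop :=
  exists (C : R) (q : nat), forall k, Normc.normc (b k) <= C * (wt k)%:R ^+ q.

Lemma rapid_polyM (R : realType) (n : nat) (a b : 'rV[int]_n -> R[i]) :
  poly_bounded a -> rapid b -> rapid (fun k => a k * b k).
Proof.
move=> [C [q Ha]] Hb p; have [D HD] := Hb (q + p)%N.
exists (`|C| * D) => k; rewrite Normc.normcM.
have w0 : 0 <= (wt k)%:R :> R by [].
apply: le_trans (ler_wpM2l (normr_ge0 C) (HD k)).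
rewrite exprD mulrCA mulrA -mulrA mulrCA -mulrA.
rewrite [leRHS](_ : _ = (`|C| * (wt k)%:R ^+ q) *
  (Normc.normc (b k) * (wt k)%:R ^+ p)); last by ring.
rewrite [leLHS](_ : _ = Normc.normc (a k) *
  (Normc.normc (b k) * (wt k)%:R ^+ p)); last by ring.
apply: ler_wpM2r; first by rewrite mulr_ge0 ?normc_ge0// exprn_ge0.
by apply: le_trans (Ha k) _; rewrite ler_wpM2r ?exprn_ge0// ler_norm.
Qed.

Lemma rapidD (R : realType) (n : nat) (a b : 'rV[int]_n -> R[i]) :
  rapid a -> rapid b -> rapid (fun k => a k + b k).
Proof.
move=> Ha Hb p; have [C HC] := Ha p; have [D HD] := Hb p.
exists (C + D) => k; apply: le_trans (lerD (HC k) (HD k)).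
by rewrite -mulrDl ler_wpM2r ?exprn_ge0// normcD_le.
Qed.

Lemma poly_bounded_cst (R : realType) (n : nat) (z : R[i]) :
  poly_bounded (fun _ : 'rV[int]_n => z).
Proof. by exists (Normc.normc z), 0%N => k; rewrite expr0 mulr1. Qed.

Lemma poly_boundedM (R : realType) (n : nat) (a b : 'rV[int]_n -> R[i]) :
  poly_bounded a -> poly_bounded b -> poly_bounded (fun k => a k * b k).
Proof.
move=> [C [q Ha]] [D [p Hb]]; exists (C * D), (q + p)%N => k.
rewrite Normc.normcM exprD mulrACA; apply: ler_pM => //; exact: normc_ge0.
Qed.

Lemma poly_boundedD (R : realType) (n : nat) (a b : 'rV[int]_n -> R[i]) :
  poly_bounded a -> poly_bounded b -> poly_bounded (fun k => a k + b k).
Proof.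
move=> [C [q Ha]] [D [p Hb]]; exists (`|C| + `|D|), (q + p)%N => k.
have w1 : 1 <= (wt k)%:R :> R by rewrite ler1n.
apply: le_trans (normcD_le _ _) _; rewrite mulrDl; apply: lerD.
  apply: le_trans (Ha k) _; apply: ler_pM; rewrite ?exprn_ge0 ?ler_norm//.
    by have := Ha k; rewrite -(pmulr_lge0 _ (exprn_gt0 q (lt_le_trans ltr01 w1)));
      apply: le_trans; exact: normc_ge0.
  by rewrite ler_weXn2l// leq_addr.
apply: le_trans (Hb k) _; apply: ler_pM; rewrite ?exprn_ge0 ?ler_norm//.
  by have := Hb k; rewrite -(pmulr_lge0 _ (exprn_gt0 p (lt_le_trans ltr01 w1)));
    apply: le_trans; exact: normc_ge0.
by rewrite ler_weXn2l// leq_addl.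
Qed.

Lemma poly_bounded_conjN (R : realType) (n : nat) (a : 'rV[int]_n -> R[i]) :
  poly_bounded a -> poly_bounded (fun k => conjc (a (- k))).
Proof. by move=> [C [q H]]; exists C, q => k; rewrite normc_conj -wtN. Qed.

Lemma rapid_conjN (R : realType) (n : nat) (a : 'rV[int]_n -> R[i]) :
  rapid a -> rapid (fun k => conjc (a (- k))).
Proof.
by move=> H p; have [C HC] := H p; exists C => k; rewrite normc_conj -wtN.
Qed.

(** The symbol of the partial derivative in direction j. *)
Definition dsym (R : realType) (n : nat) (j : 'I_n) (k : 'rV[int]_n) : R[i] :=
  ((k ord0 j)%:~R)%:C * 'i.

Lemma normc_i (R : realType) : Normc.normc ('i : R[i]) = 1.
Proof. by rewrite /= expr0n/= add0r expr1n sqrtr1. Qed.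

Lemma normc_dsym (R : realType) (n : nat) (j : 'I_n) (k : 'rV[int]_n) :
  Normc.normc (dsym R j k) = (absz (k ord0 j))%:R.
Proof.
by rewrite /dsym Normc.normcM normc_i mulr1 normc_realC -intr_norm.
Qed.

Lemma dsym_le_wt (R : realType) (n : nat) (j : 'I_n) (k : 'rV[int]_n) :
  Normc.normc (dsym R j k) <= (wt k)%:R.
Proof. by rewrite normc_dsym ler_nat ltnW// coord_le_wt. Qed.

Lemma poly_bounded_dsym (R : realType) (n : nat) (j : 'I_n) :
  poly_bounded (@dsym R n j).
Proof. by exists 1, 1%N => k; rewrite expr1 mul1r dsym_le_wt. Qed.

Lemma rapid_dsym (R : realType) (n : nat) (j : 'I_n) (b : 'rV[int]_n -> R[i]) :
  rapid b -> rapid (fun k => dsym R j k * b k).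
Proof. exact: rapid_polyM (poly_bounded_dsym _ _). Qed.

Definition synth (R : realType) (n : nat) (b : 'rV[int]_n -> R[i])
  (x : 'rV[R]_n) : R[i] := csum (fun k => b k * torus_chr k x).

Lemma synth_rate (R : realType) (n : nat) (b : 'rV[int]_n -> R[i]) :
  rapid b -> exists2 D : R, 0 <= D & forall M x,
    Normc.normc (synth b x - \sum_(k <- box n M) b k * torus_chr k x) <=
    D / M.+1%:R.
Proof.
move=> /(_ (2 * n).+1)[C HC].
have C0 : 0 <= C by apply: le_trans (HC 0); rewrite mulr_ge0 ?normc_ge0// exprn_ge0.
exists (2 * (C * 4 ^+ n)) => [|M x]; first by rewrite !mulr_ge0// exprn_ge0.
by apply: csum_rate => k; rewrite Normc.normcM normc_chr mulr1.
Qed.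

Lemma normc_triangle3 (R : realType) (a b c a' b' c' : R[i]) (e1 e2 e3 e : R) :
  Normc.normc (a - a') <= e1 -> Normc.normc (b - b') <= e2 ->
  Normc.normc (c - c') <= e3 -> Normc.normc (a' - b' - c') <= e ->
  Normc.normc (a - b - c) <= e + (e1 + e2 + e3).
Proof.
move=> h1 h2 h3 h4.
have -> : a - b - c = (a' - b' - c') + ((a - a') + (b' - b) + (c' - c)) by ring.
apply: le_trans (normcD_le _ _) _; apply: lerD => //.
apply: le_trans (normcD_le _ _) _; apply: lerD; last by rewrite normc_sub.
by apply: le_trans (normcD_le _ _) _; apply: lerD; last by rewrite normc_sub.
Qed.

Lemma is_pderive_synth (R : realType) (n : nat) (j : 'I_n)
    (b : 'rV[int]_n -> R[i]) :
  rapid b -> is_pderive j (synth b) (synth (fun k => dsym R j k * b k)).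
Proof.
(* 2 n powers of the weight make the sum converge; the other two absorb the square of k_j in the
   remainder of [cis_taylor], so the constant is independent of the truncation M. *)
move=> rb; have [C HC] := rb (2 * n + 2)%N.
have C0 : 0 <= C by apply: le_trans (HC 0); rewrite mulr_ge0 ?normc_ge0// exprn_ge0.
have [D D0 HD] := synth_rate rb; have [D' D'0 HD'] := synth_rate (rapid_dsym j rb).
apply: (@is_pderive_quad _ _ _ _ _ (2 * (C * 4 ^+ n))) => x h.
apply: (@le_of_harmonic _ _ _ (D + D + `|h| * D')) => M.
have -> : (D + D + `|h| * D') / M.+1%:R =
    D / M.+1%:R + D / M.+1%:R + `|h| * (D' / M.+1%:R) by ring.
have Hc : Normc.normc (h%:C * synth (fun k => dsym R j k * b k) x -
    h%:C * \sum_(k <- box n M) dsym R j k * b k * torus_chr k x) <=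
    `|h| * (D' / M.+1%:R).
  by rewrite -mulrBr Normc.normcM normc_realC; apply: ler_wpM2l.
apply: normc_triangle3 (HD M (x + h *: 'e_j)) (HD M x) Hc _.
rewrite mulr_sumr -!sumrB; apply: le_trans (normc_sum _ _) _.
have -> : 2 * (C * 4 ^+ n) * h ^+ 2 = (2 * h ^+ 2 * C) * 4 ^+ n by ring.
apply: box_sum_le => [|k]; first by rewrite mulr_ge0// mulr_ge0// sqr_ge0.
rewrite chr_shift /dsym; set z := torus_chr k x; set c := (k ord0 j)%:~R.
have -> : b k * (z * cis (c * h)) - b k * z - h%:C * (c%:C * 'i * b k * z) =
    b k * z * (cis (c * h) - 1 - (c * h)%:C * 'i).
  by rewrite rmorphM /=; ring.
rewrite !Normc.normcM normc_chr mulr1.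
apply: le_trans (ler_wpM2l _ (HC k)); last by rewrite mulr_ge0// sqr_ge0.
rewrite exprD.
have T := cis_taylor (c * h).
have cw : c ^+ 2 <= (wt k)%:R ^+ 2.
  rewrite -[c ^+ 2]real_normK ?num_real// lerXn2r ?nnegrE//.
  by have := dsym_le_wt R j k; rewrite /dsym Normc.normcM normc_i mulr1 normc_realC.
have {T} : Normc.normc (cis (c * h) - 1 - (c * h)%:C * 'i) <=
    2 * h ^+ 2 * (wt k)%:R ^+ 2.
  apply: le_trans T _; rewrite exprMn [c ^+ 2 * _]mulrC mulrA ler_wpM2l//.
  by rewrite mulr_ge0// sqr_ge0.
move: (Normc.normc (cis _ - _ - _)) => T HT.
rewrite [leLHS](_ : _ = T * (Normc.normc (b k) * (wt k)%:R ^+ (2 * n))); last by ring.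
rewrite [leRHS](_ : _ = 2 * h ^+ 2 * (wt k)%:R ^+ 2 *
  (Normc.normc (b k) * (wt k)%:R ^+ (2 * n))); last by ring.
by apply: ler_wpM2r => //; rewrite mulr_ge0 ?normc_ge0// exprn_ge0.
Qed.

Lemma dotz_box (R : realType) (n : nat) (k : 'rV[int]_n) (x y : 'rV[R]_n) r :
  in_box x r y -> 0 <= r -> `|dotz k y - dotz k x| <= (wt k)%:R * r.
Proof.
move=> xy r0; rewrite /dotz -sumrB.
apply: le_trans (ler_norm_sum _ _ _) _.
apply: (@le_trans _ _ (\sum_j ((absz (k ord0 j))%:R * r))).
  apply: ler_sum => j _; rewrite -mulrBr normrM -intr_norm.
  by apply: ler_wpM2l => //; exact: xy.
rewrite -mulr_suml ler_wpM2r// -natr_sum ler_nat; exact: leqnSn.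
Qed.

Lemma in_box_near (R : realType) (n : nat) (x : 'rV[R]_n) (r : R) : 0 < r ->
  \forall y \near x, in_box x r y.
Proof.
move=> r0; apply: filterS (@nbhsx_ballx _ _ x r r0) => y [_ xy] j.
by have := xy ord0 j; rewrite /ball/= distrC => /ltW.
Qed.

Lemma ccont_lipschitz (R : realType) (n : nat) (f : 'rV[R]_n -> R[i]) (L : R) :
  (forall x y r, 0 <= r -> in_box x r y -> Normc.normc (f y - f x) <= L * r) ->
  ccont f.
Proof.
move=> H.
have near0 x (e : R) : 0 < e -> \forall y \near x, Normc.normc (f y - f x) <= e.
  move=> e0; have r0 : 0 < e / (`|L| + 1) by rewrite divr_gt0// ltr_wpDl.
  apply: filterS (in_box_near x r0) => y xy.
  apply: le_trans (H x y _ (ltW r0) xy) _.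
  rewrite mulrA ler_pdivrMr; last by rewrite ltr_wpDl.
  rewrite mulrC; apply: ler_wpM2l; first exact: ltW.
  by apply: le_trans (ler_norm _) _; rewrite lerDl.
split=> x; have FF : Filter (nbhs x) by exact: nbhs_filter.
- apply/(@cvgrPdist_le _ _ _ (nbhs x) FF) => e e0.
  apply: filterS (near0 x e e0) => y; rewrite distrC; apply: le_trans.
  by apply: le_trans (Re_le_normc _) => /=; case: (f x) (f y) => ? ? [? ?].
- apply/(@cvgrPdist_le _ _ _ (nbhs x) FF) => e e0.
  apply: filterS (near0 x e e0) => y; rewrite distrC; apply: le_trans.
  by apply: le_trans (Im_le_normc _) => /=; case: (f x) (f y) => ? ? [? ?].
Qed.

Lemma ccont_synth (R : realType) (n : nat) (b : 'rV[int]_n -> R[i]) :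
  rapid b -> ccont (synth b).
Proof.
move=> rb; have [C HC] := rb (2 * n + 1)%N.
have C0 : 0 <= C by apply: le_trans (HC 0); rewrite mulr_ge0 ?normc_ge0// exprn_ge0.
have [D D0 HD] := synth_rate rb.
apply: (@ccont_lipschitz _ _ _ (2 * (C * 4 ^+ n))) => x y r r0 xy.
apply: (@le_of_harmonic _ _ _ (D + D)) => M.
have -> : (D + D) / M.+1%:R = D / M.+1%:R + D / M.+1%:R + 0 by ring.
rewrite -[X in Normc.normc X]subr0.
have Hc : Normc.normc ((0 : R[i]) - 0) <= 0 by rewrite subrr Normc.normc0.
apply: normc_triangle3 (HD M y) (HD M x) Hc _.
rewrite subr0 -!sumrB; apply: le_trans (normc_sum _ _) _.
have -> : 2 * (C * 4 ^+ n) * r = (2 * r * C) * 4 ^+ n by ring.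
apply: box_sum_le => [|k]; first by rewrite !mulr_ge0.
have -> : b k * torus_chr k y - b k * torus_chr k x =
    b k * torus_chr k x * (cis (dotz k y - dotz k x) - 1).
  rewrite -mulrA mulrBr mulr1 /torus_chr -cisD mulrBr; congr (_ * cis _ - _).
  by rewrite addrC subrK.
rewrite !Normc.normcM normc_chr mulr1.
apply: le_trans (ler_wpM2l _ (HC k)); last by rewrite mulr_ge0.
have : Normc.normc (cis (dotz k y - dotz k x) - 1) <= 2 * r * (wt k)%:R.
  apply: le_trans (cis_dist1 _) _; rewrite -mulrA ler_wpM2l// mulrC.
  exact: dotz_box.
move: (Normc.normc (cis _ - _)) => T HT.
rewrite exprD expr1.
rewrite [leLHS](_ : _ = T * (Normc.normc (b k) * (wt k)%:R ^+ (2 * n))); last by ring.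
rewrite [leRHS](_ : _ = 2 * r * (wt k)%:R *
  (Normc.normc (b k) * (wt k)%:R ^+ (2 * n))); last by ring.
by apply: ler_wpM2r => //; rewrite mulr_ge0 ?normc_ge0// exprn_ge0.
Qed.

Lemma synth_periodic (R : realType) (n : nat) (b : 'rV[int]_n -> R[i]) :
  torus_periodic (synth b).
Proof.
move=> j x; rewrite /synth; congr csum; apply/funext => k.
by rewrite chr_periodic.
Qed.

Lemma iter_partial_synth (R : realType) (n : nat) (b : 'rV[int]_n -> R[i]) s :
  rapid b -> exists2 b', rapid b' & iter_partial s (synth b) = synth b'.
Proof.
move=> rb; elim: s => [|j s [b' rb' E]]; first by exists b.
exists (fun k => dsym R j k * b' k); first exact: rapid_dsym.
rewrite /= -/(iter_partial s _) E.
exact: is_pderive_partial (is_pderive_synth j rb').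
Qed.

Lemma smooth_synth (R : realType) (n : nat) (b : 'rV[int]_n -> R[i]) :
  rapid b -> smooth (synth b).
Proof.
move=> rb s; have [b' rb' ->] := iter_partial_synth s rb.
have [cr ci] := ccont_synth rb'.
split; split; [exact: cr| |exact: ci|] => j x.
  by have [[dr _] _] := is_pderive_synth j rb' x; exact: dr.
by have [_ [di _]] := is_pderive_synth j rb' x; exact: di.
Qed.

Lemma coef_sum_chr (R : realType) (n : nat) (b : 'rV[int]_n -> R[i])
    (r : seq 'rV[int]_n) k : uniq r ->
  ccont (fun x : 'rV[R]_n => \sum_(l <- r) b l * torus_chr l x) /\
  coef (fun x : 'rV[R]_n => \sum_(l <- r) b l * torus_chr l x) k =
    if k \in r then b k else 0.
Proof.
elim: r => [_|l r IH /= /andP[lr ur]].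
  under eq_fun do rewrite big_nil.
  split; first exact: ccont_cst.
  rewrite /coef; under eq_fun do rewrite mul0r.
  by rewrite torus_int0 mulr0.
have {IH}[cr IH] := IH ur.
under eq_fun do rewrite big_cons.
split; first by apply: ccontZD => //; exact: ccont_chr.
rewrite coefZD//; last exact: ccont_chr.
rewrite coef_chr IH in_cons eq_sym; have [->|kl] := eqVneq k l.
  by rewrite (negPf lr) mulr1 addr0.
by rewrite mulr0 add0r.
Qed.

Lemma coef_synth (R : realType) (n : nat) (b : 'rV[int]_n -> R[i]) k :
  rapid b -> coef (synth b) k = b k.
Proof.
move=> rb; have [D D0 HD] := synth_rate rb.
apply/eqP; rewrite -subr_eq0 -normc_eq0 eq_le normc_ge0 andbT.
apply: (@le_of_harmonic _ _ _ (2 * D)) => M; rewrite add0r.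
(* The box is enlarged to contain k, so that the partial sum already has coefficient [b k]. *)
pose M' := maxn M (wt k); have [cS cE] := coef_sum_chr b k (box_uniq n M').
rewrite wt_box ?leq_maxr// in cE.
have cs := ccont_synth rb.
have -> : coef (synth b) k - b k = coef (fun x => -1 *
    (\sum_(l <- box n M') b l * torus_chr l x) + synth b x) k.
  by rewrite coefZD// cE mulN1r addrC.
rewrite -mulrA.
apply: (@le_trans _ _ (2 * (D / M'.+1%:R))).
  apply: coef_norm => [|x _]; first exact: ccontZD.
  by rewrite mulN1r addrC; exact: HD.
rewrite ler_wpM2l// ler_wpM2l// lef_pV2 ?posrE ?ltr0n// ler_nat ltnS.
exact: leq_maxl.
Qed.

(** * Fourier coefficients of smooth functions *)

Lemma Cinf_ZDE (R : realType) (n : nat) (a : R[i]) (f g : Cinf R n) :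
  (a *: f + g : Cinf R n) = (fun x => a * f x + g x) :> ('rV[R]_n -> R[i]).
Proof. by []. Qed.

Lemma Cinf_ccont (R : realType) (n : nat) (f : Cinf R n) : ccont f.
Proof.
by have [sf _] := CinfP f; have [[cr _] [ci _]] := sf [::]; split.
Qed.

Lemma Cinf_periodic (R : realType) (n : nat) (f : Cinf R n) : torus_periodic f.
Proof. by have [] := CinfP f. Qed.

Lemma Cinf_pderive (R : realType) (n : nat) (j : 'I_n) (f : Cinf R n) :
  is_pderive j f (pderiv j f).
Proof.
have [sf _] := CinfP f; have [[_ dr] [_ di]] := sf [::] => x.
by split; apply: DeriveDef => //.
Qed.

Lemma coef_CinfZD (R : realType) (n : nat) (a : R[i]) (f g : Cinf R n) k :
  coef (a *: f + g : Cinf R n) k = a * coef f k + coef g k.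
Proof. by rewrite Cinf_ZDE coefZD//; exact: Cinf_ccont. Qed.

Lemma coef_Cinf0 (R : realType) (n : nat) k : coef (0 : Cinf R n) k = 0.
Proof.
have /eqP := coef_CinfZD 1 (0 : Cinf R n) 0 k.
by rewrite scale1r addr0 mul1r eq_sym -subr_eq0 addrK => /eqP.
Qed.

Lemma coef_CinfD (R : realType) (n : nat) (f g : Cinf R n) k :
  coef (f + g : Cinf R n) k = coef f k + coef g k.
Proof. by rewrite -{1}[f]scale1r coef_CinfZD mul1r. Qed.

Lemma coef_CinfZ (R : realType) (n : nat) (a : R[i]) (f : Cinf R n) k :
  coef (a *: f : Cinf R n) k = a * coef f k.
Proof. by rewrite -[a *: f]addr0 coef_CinfZD coef_Cinf0 addr0. Qed.

Lemma coef_CinfN (R : realType) (n : nat) (f : Cinf R n) k :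
  coef (- f : Cinf R n) k = - coef f k.
Proof. by rewrite -scaleN1r coef_CinfZ mulN1r. Qed.

Lemma coef_Cinf_sum (R : realType) (n : nat) (I : Type) (r : seq I) (P : pred I)
    (F : I -> Cinf R n) k :
  coef (\sum_(i <- r | P i) F i : Cinf R n) k =
  \sum_(i <- r | P i) coef (F i) k.
Proof.
elim/big_rec2: _ => [|i y z _ <-]; first exact: coef_Cinf0.
exact: coef_CinfD.
Qed.

(** From here on, identities between smooth functions, such as the compatibility of derivatives and
    conjugation with truncation, are checked on coefficients. *)
Lemma Cinf_inj (R : realType) (n : nat) (f g : Cinf R n) :
  (forall k, coef f k = coef g k) -> f = g.
Proof.
move=> H; apply/eqP; rewrite -subr_eq0; apply/eqP/val_inj.
apply: (@coef_eq0 _ _ (f - g : Cinf R n)).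
- exact: Cinf_ccont.
- exact: Cinf_periodic.
by move=> k; rewrite coef_CinfD coef_CinfN H subrr.
Qed.

Lemma coef_pderiv (R : realType) (n : nat) (j : 'I_n) (f : Cinf R n) k :
  coef (pderiv j f) k = dsym R j k * coef f k.
Proof.
by apply: coef_pderive (Cinf_pderive j f) (Cinf_ccont f) (Cinf_ccont _) _;
  exact: Cinf_periodic.
Qed.

Lemma coef_conjf (R : realType) (n : nat) (f : Cinf R n) k :
  coef (conjf f) k = conjc (coef f (- k)).
Proof. by rewrite -coef_conj//; exact: Cinf_ccont. Qed.

Definition msym (R : realType) (n m : nat) (a : {ffun 'I_n -> 'I_m.+1})
  (k : 'rV[int]_n) : R[i] := \prod_j dsym R j k ^+ a j.

Lemma coef_mderiv (R : realType) (n m : nat) (a : {ffun 'I_n -> 'I_m.+1})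
    (f : Cinf R n) k :
  coef (mderiv a f) k = msym R a k * coef f k.
Proof.
rewrite /mderiv /msym -(big_enum _ _ xpredT (fun j => dsym R j k ^+ a j)) /=.
elim: (enum 'I_n) => [|j r IH]; first by rewrite big_nil mul1r.
rewrite big_cons -mulrA -IH /=; elim: (nat_of_ord (a j)) => [|p IHp].
  by rewrite expr0 mul1r.
by rewrite iterS coef_pderiv IHp exprS mulrA.
Qed.

Definition lsym (R : realType) (n m : nat)
    (c : {ffun 'I_n -> 'I_m.+1} -> R[i]) (k : 'rV[int]_n) : R[i] :=
  \sum_(a : {ffun 'I_n -> 'I_m.+1} | (0 < mabs a <= m)%N) c a * msym R a k.

Lemma coef_diffop (R : realType) (n m : nat)
    (c : {ffun 'I_n -> 'I_m.+1} -> R[i]) (f : Cinf R n) k :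
  coef (diffop c f) k = lsym c k * coef f k.
Proof.
rewrite /diffop coef_Cinf_sum /lsym mulr_suml; apply: eq_bigr => a _.
by rewrite coef_CinfZ coef_mderiv mulrA.
Qed.

Lemma coef_operP (R : realType) (n m : nat)
    (c : {ffun 'I_n -> 'I_m.+1} -> R[i]) A B (u : Cinf R n) k :
  coef (operP c A B u) k =
  (lsym c k - A) * coef u k - B * conjc (coef u (- k)).
Proof.
rewrite /operP 2!coef_CinfD 2!coef_CinfN 2!coef_CinfZ coef_diffop coef_conjf.
by rewrite mulrBl.
Qed.

Lemma poly_bounded_msym (R : realType) (n m : nat)
    (a : {ffun 'I_n -> 'I_m.+1}) : poly_bounded (@msym R n m a).
Proof.
rewrite /msym; elim: (index_enum _) => [|j r IH].
  by under eq_fun do rewrite big_nil; exact: poly_bounded_cst.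
under eq_fun do rewrite big_cons.
apply: poly_boundedM => //; elim: (nat_of_ord (a j)) => [|p IHp].
  by under eq_fun do rewrite expr0; exact: poly_bounded_cst.
under eq_fun do rewrite exprS.
by apply: poly_boundedM => //; exact: poly_bounded_dsym.
Qed.

Lemma poly_bounded_lsym (R : realType) (n m : nat)
    (c : {ffun 'I_n -> 'I_m.+1} -> R[i]) : poly_bounded (lsym c).
Proof.
rewrite /lsym; elim: (index_enum _) => [|a r IH].
  by under eq_fun do rewrite big_nil; exact: poly_bounded_cst.
under eq_fun do rewrite big_cons.
case: (0 < mabs a <= m)%N => //; apply: poly_boundedD => //.
apply: poly_boundedM.
  exact: poly_bounded_cst.
exact: poly_bounded_msym.
Qed.

(** * Norms, decay of coefficients and truncation of smooth functions *)

Lemma normc_le_supnorm (R : realType) (n : nat) (f : Cinf R n) x :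
  Normc.normc (f x) <= supnorm f.
Proof.
have [C HC] := torus_bounded (Cinf_ccont f) (@Cinf_periodic _ _ f).
apply: ub_le_sup; last by exists x.
by exists C => _ [y _ <-]; exact: HC.
Qed.

Lemma supnorm_le (R : realType) (n : nat) (f : Cinf R n) (C : R) :
  (forall x, Normc.normc (f x) <= C) -> supnorm f <= C.
Proof.
move=> H; apply: ge_sup; first by exists (Normc.normc (f 0)), 0.
by move=> _ [y _ <-]; exact: H.
Qed.

Lemma supnorm_ge0 (R : realType) (n : nat) (f : Cinf R n) : 0 <= supnorm f.
Proof. exact: le_trans (normc_ge0 _) (normc_le_supnorm f 0). Qed.

Lemma coef_le_supnorm (R : realType) (n : nat) (f : Cinf R n) k :
  Normc.normc (coef f k) <= 2 * supnorm f.
Proof.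
by apply: coef_norm; [exact: Cinf_ccont|move=> x _; exact: normc_le_supnorm].
Qed.

Lemma supnorm_mderiv_le (R : realType) (n N : nat) (f : Cinf R n)
    (a : {ffun 'I_n -> 'I_N.+1}) :
  (mabs a <= N)%N -> supnorm (mderiv a f) <= Cnorm N f.
Proof.
move=> aN; rewrite /Cnorm (bigD1 a)//= lerDl; apply: sumr_ge0 => b _.
exact: supnorm_ge0.
Qed.

Lemma Cnorm_ge0 (R : realType) (n N : nat) (f : Cinf R n) : 0 <= Cnorm N f.
Proof. by apply: sumr_ge0 => b _; exact: supnorm_ge0. Qed.

(** The weight is at most n + 1 times the largest coordinate, so its powers are controlled by pure
    derivatives in single directions, without mixed ones. *)
Lemma wt_pow_le (R : realType) (n p : nat) (k : 'rV[int]_n) :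
  (wt k)%:R ^+ p <=
  n.+1%:R ^+ p * (1 + \sum_j Normc.normc (dsym R j k) ^+ p) :> R.
Proof.
have [M HM HM2] : exists2 M : nat, (wt k <= n.+1 * M)%N &
    M%:R ^+ p <= 1 + \sum_j Normc.normc (dsym R j k) ^+ p :> R.
  have S0 (P : pred 'I_n) : 0 <= \sum_(j | P j) Normc.normc (dsym R j k) ^+ p :> R.
    by apply: sumr_ge0 => j _; rewrite exprn_ge0// normc_ge0.
  pose M := \max_(j < n) absz (k ord0 j).
  have sumM : (\sum_j absz (k ord0 j) <= n * M)%N.
    rewrite -[n in (n * _)%N]card_ord -sum_nat_const.
    by apply: leq_sum => j _; exact: leq_bigmax.
  (* If all coordinates vanish, the bound 1 replaces their maximum; this is what the summand 1 in
     the statement accounts for. *)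
  have [M0|M0] := posnP M.
    exists 1%N; first by rewrite /wt muln1; move: sumM; rewrite M0 muln0; lia.
    by rewrite expr1n lerDl.
  exists M; first by rewrite /wt mulSn; lia.
  have [j ->] : exists j, M = absz (k ord0 j).
    have n0 : (0 < #|'I_n|)%N.
      rewrite card_ord lt0n; apply: contraTN M0 => /eqP n0.
      by rewrite /M; move: k {S0 sumM M}; rewrite n0 => k; rewrite big_ord0.
    by have [j] := @bigop.eq_bigmax _ (fun j : 'I_n => absz (k ord0 j)) n0; exists j.
  by rewrite (bigD1 j)//= -normc_dsym addrCA lerDl addr_ge0.
apply: (@le_trans _ _ ((n.+1 * M)%:R ^+ p)).
  by rewrite lerXn2r ?nnegrE// ler_nat.
by rewrite natrM exprMn ler_wpM2l// exprn_ge0.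
Qed.

(** By [wt_pow_le] only f and its p-th derivatives in single directions are involved. The dependence
    on f is kept explicit through [Cnorm p f], which yields the continuity estimate in
    [distribution_of_coef]. *)
Lemma coef_decay (R : realType) (n p : nat) (f : Cinf R n) k :
  Normc.normc (coef f k) * (wt k)%:R ^+ p <=
  n.+1%:R ^+ p * (n.+1%:R * (2 * Cnorm p f)).
Proof.
apply: le_trans (ler_wpM2l (normc_ge0 _) (wt_pow_le R p k)) _.
rewrite mulrCA ler_wpM2l ?exprn_ge0// mulrDr mulr1 mulr_sumr.
have nE : n.+1%:R = 1 + n%:R :> R by rewrite -add1n natrD.
rewrite nE mulrDl mul1r; apply: lerD.
  apply: le_trans (coef_le_supnorm f k) _; rewrite ler_wpM2l//.
  have a0 : (mabs [ffun _ : 'I_n => (ord0 : 'I_p.+1)] <= p)%N.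
    by rewrite /mabs big1// => j _; rewrite ffunE.
  apply: le_trans (supnorm_mderiv_le f a0).
  rewrite (_ : mderiv _ f = f)//; apply: Cinf_inj => l.
  by rewrite coef_mderiv /msym big1 ?mul1r// => j _; rewrite ffunE expr0.
have -> : n%:R * (2 * Cnorm p f) = \sum_(j < n) (2 * Cnorm p f).
  by rewrite sumr_const card_ord mulr_natl.
apply: ler_sum => j _; rewrite mulrC -normcX -Normc.normcM.
pose a := [ffun i : 'I_n => if i == j then (ord_max : 'I_p.+1) else ord0].
have ap : (mabs a <= p)%N.
  rewrite /mabs (bigD1 j)//= ffunE eqxx big1 ?addn0// => i ij.
  by rewrite ffunE (negPf ij).
have -> : dsym R j k ^+ p * coef f k = coef (mderiv a f) k.
  rewrite coef_mderiv /msym (bigD1 j)//= ffunE eqxx big1 ?mulr1// => i ij.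
  by rewrite ffunE (negPf ij) expr0.
apply: le_trans (coef_le_supnorm _ k) _; rewrite ler_wpM2l//.
exact: supnorm_mderiv_le.
Qed.

Lemma rapid_coef (R : realType) (n : nat) (f : Cinf R n) : rapid (coef f).
Proof. by move=> p; eexists => k; exact: coef_decay. Qed.

Definition synthC (R : realType) (n : nat) (b : 'rV[int]_n -> R[i])
  (rb : rapid b) : Cinf R n :=
  Cinf_of (conj (smooth_synth rb) (@synth_periodic R n b)).

Lemma coef_synthC (R : realType) (n : nat) (b : 'rV[int]_n -> R[i])
  (rb : rapid b) k : coef (synthC rb) k = b k.
Proof. exact: coef_synth. Qed.

Lemma Cinf_synth (R : realType) (n : nat) (f : Cinf R n) :
  f = synth (coef f) :> ('rV[R]_n -> R[i]).
Proof.
rewrite -[synth _]/(synthC (rapid_coef f) : _ -> _); congr Cinf_fun.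
by apply: Cinf_inj => k; rewrite coef_synthC.
Qed.

Lemma rapid_delta (R : realType) (n : nat) (l : 'rV[int]_n) :
  rapid (fun k => (l == k)%:R : R[i]).
Proof.
move=> p; exists ((wt l)%:R ^+ p) => k; have [->|lk] := eqVneq l k.
  by rewrite Normc.normc1 mul1r.
by rewrite Normc.normc0 mul0r exprn_ge0.
Qed.

(** Synthesised from a Kronecker delta, which gives smoothness for free; [chrCE] identifies the
    result with [torus_chr]. *)
Definition chrC (R : realType) (n : nat) (l : 'rV[int]_n) : Cinf R n :=
  synthC (@rapid_delta R n l).

Lemma coef_chrC (R : realType) (n : nat) (l k : 'rV[int]_n) :
  coef (chrC R l) k = (l == k)%:R.
Proof. exact: coef_synthC. Qed.

Lemma chrCE (R : realType) (n : nat) (l : 'rV[int]_n) :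
  chrC R l = @torus_chr R n l :> (_ -> _).
Proof.
apply/funext => x; apply/eqP; rewrite -subr_eq0; apply/eqP.
rewrite addrC -mulN1r.
apply: (congr1 (fun g => g x) (y := fun=> 0)
  (x := fun x => -1 * torus_chr l x + chrC R l x)).
apply: coef_eq0.
- by apply: ccontZD; [exact: ccont_chr|exact: Cinf_ccont].
- by move=> j y; rewrite chr_periodic Cinf_periodic.
move=> k; rewrite coefZD; [|exact: ccont_chr|exact: Cinf_ccont].
by rewrite coef_chr coef_chrC mulN1r addNr.
Qed.

Definition truncC (R : realType) (n M : nat) (f : Cinf R n) : Cinf R n :=
  \sum_(k <- box n M) coef f k *: chrC R k.

Lemma coef_truncC (R : realType) (n M : nat) (f : Cinf R n) k :
  coef (truncC M f) k = if k \in box n M then coef f k else 0.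
Proof.
rewrite coef_Cinf_sum.
under eq_bigr do rewrite coef_CinfZ coef_chrC.
case: ifPn => kb.
  rewrite (bigD1_seq k)//= ?box_uniq// eqxx mulr1 big1 ?addr0// => l lk.
  by rewrite (negPf lk) mulr0.
rewrite big_seq big1// => l lb; case: eqVneq => [lk|]; last by rewrite mulr0.
by rewrite -lk lb in kb.
Qed.

Lemma Cinf_sumE (R : realType) (n : nat) (I : Type) (r : seq I)
    (F : I -> Cinf R n) x :
  (\sum_(i <- r) F i : Cinf R n) x = \sum_(i <- r) F i x.
Proof. by elim/big_rec2: _ => // i y z _ <-. Qed.

Lemma supnorm_truncC (R : realType) (n : nat) (f : Cinf R n) :
  exists2 D : R, 0 <= D & forall M, supnorm (f - truncC M f) <= D / M.+1%:R.
Proof.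
have [D D0 HD] := synth_rate (rapid_coef f); exists D => // M.
apply: supnorm_le => x; apply: le_trans (HD M x).
rewrite -Cinf_synth -[(f - _ : Cinf R n) x]/(f x - truncC M f x).
rewrite Cinf_sumE; under [in leRHS]eq_bigr do rewrite -chrCE.
by rewrite lexx.
Qed.

Lemma mderiv_truncC (R : realType) (n m M : nat) (a : {ffun 'I_n -> 'I_m.+1})
    (f : Cinf R n) : mderiv a (truncC M f) = truncC M (mderiv a f).
Proof.
apply: Cinf_inj => k; rewrite coef_mderiv !coef_truncC coef_mderiv.
by case: ifP => // _; rewrite mulr0.
Qed.

Lemma conjf_truncC (R : realType) (n M : nat) (f : Cinf R n) :
  conjf (truncC M f) = truncC M (conjf f).
Proof.
apply: Cinf_inj => k; rewrite coef_conjf !coef_truncC coef_conjf box_oppr.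
by case: ifP => // _; rewrite conjc0.
Qed.

Lemma mderivB (R : realType) (n m : nat) (a : {ffun 'I_n -> 'I_m.+1})
    (f g : Cinf R n) : mderiv a (f - g) = mderiv a f - mderiv a g.
Proof.
apply: Cinf_inj => k.
by rewrite coef_mderiv !coef_CinfD !coef_CinfN !coef_mderiv mulrBr.
Qed.

Lemma Cnorm_truncC (R : realType) (n N : nat) (f : Cinf R n) :
  exists2 D : R, 0 <= D & forall M, Cnorm N (f - truncC M f) <= D / M.+1%:R.
Proof.
rewrite /Cnorm; elim: (index_enum _) => [|a r [D D0 IH]].
  by exists 0 => // M; rewrite big_nil mul0r.
have [D' D'0 HD'] := supnorm_truncC (mderiv a f).
exists (D' + D) => [|M]; first exact: addr_ge0.
rewrite big_cons mulrDl; case: ifP => _.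
  by apply: lerD => //; rewrite mderivB mderiv_truncC.
by rewrite -[leLHS]add0r lerD// divr_ge0.
Qed.

(** * Fourier coefficients of distributions *)

(* Unlike a bound by some [Cnorm N], this property passes to derivatives
   without commuting partial derivatives, and it still makes a functional
   determined by its values on characters. *)
Definition fourier_cont (R : realType) (n : nat) (u : Cinf R n -> R[i]) : Prop :=
  forall f, exists D : R, forall M,
    Normc.normc (u f - u (truncC M f)) <= D / M.+1%:R.

Lemma linear_for0 (R : realType) (n : nat) (u : Cinf R n -> R[i]) :
  linear_for *%R u -> u 0 = 0.
Proof.
move=> H; have /eqP := H 1 0 0.
by rewrite scale1r addr0 mul1r eq_sym -subr_eq0 addrK => /eqP.
Qed.

Lemma linear_forB (R : realType) (n : nat) (u : Cinf R n -> R[i]) f g :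
  linear_for *%R u -> u (f - g) = u f - u g.
Proof. by move=> H; rewrite addrC -scaleN1r H mulN1r addrC. Qed.

Lemma linear_for_sum (R : realType) (n : nat) (u : Cinf R n -> R[i])
    (I : Type) (r : seq I) (a : I -> R[i]) (F : I -> Cinf R n) :
  linear_for *%R u ->
  u (\sum_(i <- r) a i *: F i) = \sum_(i <- r) a i * u (F i).
Proof.
move=> H; elim: r => [|i r IH]; first by rewrite !big_nil linear_for0.
by rewrite !big_cons H IH.
Qed.

Lemma fourier_cont_inj (R : realType) (n : nat) (u v : Cinf R n -> R[i]) :
  linear_for *%R u -> linear_for *%R v ->
  fourier_cont u -> fourier_cont v ->
  (forall k, u (chrC R k) = v (chrC R k)) -> u = v.
Proof.
move=> lu lv cu cv H; apply/funext => f; apply/eqP.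
rewrite -subr_eq0 -normc_eq0 eq_le normc_ge0 andbT.
have [D HD] := cu f; have [D' HD'] := cv f.
apply: (@le_of_harmonic _ _ _ (D + D')) => M; rewrite add0r mulrDl.
have E : u (truncC M f) = v (truncC M f).
  by rewrite /truncC !linear_for_sum//; apply: eq_bigr => k _; rewrite H.
have -> : u f - v f = (u f - u (truncC M f)) + (v (truncC M f) - v f).
  by rewrite E addrA subrK.
by apply: le_trans (normcD_le _ _) _; apply: lerD => //; rewrite normc_sub.
Qed.

Lemma distribution_fourier_cont (R : realType) (n : nat)
    (u : Cinf R n -> R[i]) : is_distribution u -> fourier_cont u.
Proof.
move=> [lu [K [N H]]] f; have [D D0 HD] := Cnorm_truncC N f.
exists (`|K| * D) => M; rewrite -linear_forB//.
apply: le_trans (H _) _; rewrite -mulrA.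
apply: le_trans (ler_wpM2r (Cnorm_ge0 _ _) (ler_norm K)) _.
by apply: ler_wpM2l.
Qed.

Lemma fourier_contZD (R : realType) (n : nat) (u v : Cinf R n -> R[i]) a :
  fourier_cont u -> fourier_cont v -> fourier_cont (fun f => a * u f + v f).
Proof.
move=> cu cv f; have [D HD] := cu f; have [D' HD'] := cv f.
exists (Normc.normc a * D + D') => M; rewrite mulrDl -mulrA.
have -> : a * u f + v f - (a * u (truncC M f) + v (truncC M f)) =
   a * (u f - u (truncC M f)) + (v f - v (truncC M f)) by ring.
apply: le_trans (normcD_le _ _) _; apply: lerD => //.
by rewrite Normc.normcM ler_wpM2l// normc_ge0.
Qed.

Lemma fourier_cont0 (R : realType) (n : nat) :
  fourier_cont (fun _ : Cinf R n => 0).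
Proof. by move=> f; exists 0 => M; rewrite subrr Normc.normc0 mul0r. Qed.

Lemma fourier_cont_mderivd (R : realType) (n m : nat)
    (a : {ffun 'I_n -> 'I_m.+1}) (u : Cinf R n -> R[i]) :
  fourier_cont u -> fourier_cont (mderivd a u).
Proof.
move=> cu f; have [D HD] := cu (mderiv a f); exists D => M.
rewrite /mderivd mderiv_truncC -mulrBr Normc.normcM normcX normc_opp.
by rewrite Normc.normc1 expr1n mul1r.
Qed.

Lemma fourier_cont_conjd (R : realType) (n : nat) (u : Cinf R n -> R[i]) :
  fourier_cont u -> fourier_cont (conjd u).
Proof.
move=> cu f; have [D HD] := cu (conjf f); exists D => M.
by rewrite /conjd conjf_truncC -raddfB normc_conj.
Qed.

Lemma conjfZD (R : realType) (n : nat) (a : R[i]) (f g : Cinf R n) :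
  conjf (a *: f + g) = conjc a *: conjf f + conjf g.
Proof.
apply: Cinf_inj => k; rewrite coef_conjf !coef_CinfZD !coef_conjf.
by rewrite conjcD conjcM.
Qed.

Lemma mderivZD (R : realType) (n m : nat) (b : {ffun 'I_n -> 'I_m.+1})
    (a : R[i]) (f g : Cinf R n) :
  mderiv b (a *: f + g) = a *: mderiv b f + mderiv b g.
Proof.
apply: Cinf_inj => k; rewrite coef_mderiv !coef_CinfZD !coef_mderiv.
by rewrite mulrDr mulrCA.
Qed.

Lemma linear_conjd (R : realType) (n : nat) (u : Cinf R n -> R[i]) :
  linear_for *%R u -> linear_for *%R (conjd u).
Proof.
by move=> H a f g; rewrite /conjd conjfZD H conjcD conjcM conjcK.
Qed.

Lemma linear_mderivd (R : realType) (n m : nat) (b : {ffun 'I_n -> 'I_m.+1})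
    (u : Cinf R n -> R[i]) :
  linear_for *%R u -> linear_for *%R (mderivd b u).
Proof.
by move=> H a f g; rewrite /mderivd mderivZD H mulrDr mulrCA.
Qed.

Lemma linear_for_comb (R : realType) (n : nat) (u v : Cinf R n -> R[i]) a :
  linear_for *%R u -> linear_for *%R v ->
  linear_for *%R (fun f => a * u f + v f).
Proof. by move=> Hu Hv b f g; rewrite Hu Hv; ring. Qed.

Lemma linear_for_cst0 (R : realType) (n : nat) :
  linear_for *%R (fun _ : Cinf R n => 0 : R[i]).
Proof. by move=> b f g; rewrite mulr0 addr0. Qed.

Lemma diffopdE (R : realType) (n m : nat)
    (c : {ffun 'I_n -> 'I_m.+1} -> R[i]) (u : Cinf R n -> R[i]) f :
  diffopd c u f =
  \sum_(a : {ffun 'I_n -> 'I_m.+1} | (0 < mabs a <= m)%N) c a * mderivd a u f.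
Proof. by rewrite /diffopd fct_sumE. Qed.

(** Nested in the form a u + v so that [linear_for_comb] and [fourier_contZD] apply directly. *)
Lemma operPdE (R : realType) (n m : nat)
    (c : {ffun 'I_n -> 'I_m.+1} -> R[i]) A B (u : Cinf R n -> R[i]) f :
  operPd c A B u f = (- B) * conjd u f + ((- A) * u f + (1 * diffopd c u f + 0)).
Proof.
rewrite /operPd -[LHS]/(diffopd c u f - A * u f - B * conjd u f); ring.
Qed.

Lemma diffopd_cont (R : realType) (n m : nat)
    (c : {ffun 'I_n -> 'I_m.+1} -> R[i]) (u : Cinf R n -> R[i]) :
  linear_for *%R u -> fourier_cont u ->
  linear_for *%R (diffopd c u) /\ fourier_cont (diffopd c u).
Proof.
move=> lu cu; rewrite (funext (diffopdE c u)).
elim: (index_enum _) => [|a r [lS cS]].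
  under eq_fun do rewrite big_nil.
  by split; [exact: linear_for_cst0|exact: fourier_cont0].
under eq_fun do rewrite big_cons.
case: (0 < mabs a <= m)%N => //; split.
  by apply: linear_for_comb => //; exact: linear_mderivd.
by apply: fourier_contZD => //; exact: fourier_cont_mderivd.
Qed.

Lemma operPd_cont (R : realType) (n m : nat)
    (c : {ffun 'I_n -> 'I_m.+1} -> R[i]) A B (u : Cinf R n -> R[i]) :
  linear_for *%R u -> fourier_cont u ->
  linear_for *%R (operPd c A B u) /\ fourier_cont (operPd c A B u).
Proof.
move=> lu cu; have [lL cL] := diffopd_cont c lu cu.
rewrite (funext (operPdE c A B u)); split.
  apply: linear_for_comb; first exact: linear_conjd.
  by apply: linear_for_comb => //; apply: linear_for_comb => //; exact: linear_for_cst0.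
apply: fourier_contZD; first exact: fourier_cont_conjd.
by apply: fourier_contZD => //; apply: fourier_contZD => //; exact: fourier_cont0.
Qed.

Definition dcoef (R : realType) (n : nat) (u : Cinf R n -> R[i])
  (k : 'rV[int]_n) : R[i] := (((2 * pi) ^+ n)^-1)%:C * u (chrC R (- k)).

Lemma dcoef_dist_of (R : realType) (n : nat) (f : Cinf R n) k :
  dcoef (dist_of f) k = coef f k.
Proof. by rewrite /dcoef /dist_of chrCE. Qed.

Lemma mderiv_chrC (R : realType) (n m : nat) (a : {ffun 'I_n -> 'I_m.+1}) k :
  mderiv a (chrC R k) = msym R a k *: chrC R k.
Proof.
apply: Cinf_inj => l; rewrite coef_mderiv coef_CinfZ coef_chrC.
by case: eqVneq => [->//|_]; rewrite !mulr0.
Qed.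

Lemma msymN (R : realType) (n m : nat) (a : {ffun 'I_n -> 'I_m.+1}) k :
  msym R a (- k) = (-1) ^+ mabs a * msym R a k.
Proof.
rewrite /msym /mabs -prodrXr -big_split/=; apply: eq_bigr => j _.
by rewrite -exprMn /dsym mxE rmorphN /= rmorphN /= mulN1r mulNr.
Qed.

Lemma conjf_chrC (R : realType) (n : nat) (k : 'rV[int]_n) :
  conjf (chrC R k) = chrC R (- k).
Proof.
apply: Cinf_inj => l; rewrite coef_conjf !coef_chrC.
rewrite -(inj_eq oppr_inj) opprK; case: eqP => _; [exact: conjc1|exact: conjc0].
Qed.

Lemma dcoef_operPd (R : realType) (n m : nat)
    (c : {ffun 'I_n -> 'I_m.+1} -> R[i]) A B (u : Cinf R n -> R[i]) k :
  linear_for *%R u ->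
  dcoef (operPd c A B u) k =
  (lsym c k - A) * dcoef u k - B * conjc (dcoef u (- k)).
Proof.
move=> lu; rewrite /dcoef operPdE diffopdE.
have -> : \sum_(a : {ffun 'I_n -> 'I_m.+1} | (0 < mabs a <= m)%N)
    c a * mderivd a u (chrC R (- k)) = lsym c k * u (chrC R (- k)).
  rewrite /lsym mulr_suml; apply: eq_bigr => a _.
  rewrite /mderivd mderiv_chrC -[_ *: _]addr0 lu linear_for0// addr0.
  (* The sign of the distributional derivative cancels the sign of the symbol at - k. *)
  rewrite msymN !mulrA; congr (_ * _); rewrite -!mulrA; congr (_ * _).
  by rewrite mulrA -exprMn mulrNN mulr1 expr1n mul1r.
rewrite /conjd conjf_chrC opprK conjcM conjc_real; ring.
Qed.

Lemma dist_of_distribution (R : realType) (n : nat) (g : Cinf R n) :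
  is_distribution (dist_of g).
Proof.
split=> [a f h|].
  rewrite /dist_of -torus_intZD; last 2 first.
  - by apply: ccontM; exact: Cinf_ccont.
  - by apply: ccontM; exact: Cinf_ccont.
  by congr torus_int; apply/funext => x; rewrite Cinf_ZDE; ring.
exists (2 * (2 * pi) ^+ n * supnorm g), 0%N => f; rewrite -mulrA.
apply: torus_int_norm => [|x _]; first by apply: ccontM; exact: Cinf_ccont.
rewrite Normc.normcM; apply: ler_pM; try exact: normc_ge0.
  exact: normc_le_supnorm.
apply: le_trans (normc_le_supnorm f x) _.
have a0 : (mabs [ffun _ : 'I_n => (ord0 : 'I_1)] <= 0)%N.
  by rewrite /mabs big1// => j _; rewrite ffunE.
apply: le_trans (supnorm_mderiv_le f a0).
rewrite (_ : mderiv _ f = f)//; apply: Cinf_inj => l.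
by rewrite coef_mderiv /msym big1 ?mul1r// => j _; rewrite ffunE expr0.
Qed.

Lemma dcoef_inj (R : realType) (n : nat) (u v : Cinf R n -> R[i]) :
  linear_for *%R u -> linear_for *%R v ->
  fourier_cont u -> fourier_cont v ->
  (forall k, dcoef u k = dcoef v k) -> u = v.
Proof.
move=> lu lv cu cv H; apply: fourier_cont_inj => // k.
have := H (- k); rewrite /dcoef opprK => /mulfI; apply.
by rewrite eq_complex /= invr_eq0 (gt_eqF (twopiX_gt0 _ _)).
Qed.

Lemma rapid_pairing (R : realType) (n : nat) (a : 'rV[int]_n -> R[i])
    (f : Cinf R n) :
  poly_bounded a -> rapid (fun k => a (- k) * coef f k).
Proof.
move=> [C [q Ha]]; apply: rapid_polyM (rapid_coef f).
by exists C, q => k; rewrite -wtN.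
Qed.

Lemma distribution_of_coef (R : realType) (n : nat) (a : 'rV[int]_n -> R[i]) :
  poly_bounded a ->
  exists2 u : Cinf R n -> R[i], is_distribution u & forall k, dcoef u k = a k.
Proof.
move=> pa; pose z : R[i] := ((2 * pi) ^+ n)%:C.
have rp f := rapid_pairing f pa.
(* The pairing (2 pi)^n sum_k a(- k) coef f k is realised as the value at 0, where all characters
   equal 1, of a synthesised function. *)
pose u (f : Cinf R n) : R[i] := z * synthC (rp f) 0.
have z0 : (((2 * pi) ^+ n)^-1)%:C * z = 1.
  by rewrite /z -rmorphM /= mulVf// gt_eqF// twopiX_gt0.
exists u; last first.
  move=> k; rewrite /dcoef /u mulrA z0 mul1r.
  rewrite (_ : synthC _ = a k *: chrC R (- k)); last first.
    apply: Cinf_inj => l; rewrite coef_synthC coef_CinfZ coef_chrC.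
    by case: eqVneq => [<-|_]; rewrite ?opprK// !mulr0.
  by rewrite -[(_ *: _ : Cinf R n) 0]/(a k * chrC R (- k) 0) chrCE
    /torus_chr /dotz big1 ?cis0 ?mulr1// => j _; rewrite !mxE mulr0.
split=> [b f g|].
  rewrite /u (_ : synthC (rp (b *: f + g)) = b *: synthC (rp f) + synthC (rp g)).
    by rewrite Cinf_ZDE; ring.
  apply: Cinf_inj => k; rewrite !coef_CinfZD !coef_synthC coef_CinfZD.
  ring.
(* q derivatives compensate the growth of a, and 2 n more make the series summable. *)
have [C [q Ha]] := pa; pose p := (q + 2 * n)%N.
pose K : R := `|C| * (n.+1%:R ^+ p * (n.+1%:R * 2)).
exists (Normc.normc z * (K * 4 ^+ n)), p => f.
rewrite /u Normc.normcM -mulrA; apply: ler_wpM2l; first exact: normc_ge0.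
have [D D0 HD] := synth_rate (rp f).
apply: (@le_of_harmonic _ _ _ D) => M.
rewrite -[synthC _ _]/(synth _ 0); set S := \sum_(k <- box n M)
  a (- k) * coef f k * torus_chr k (0 : 'rV[R]_n).
rewrite -[synth _ 0](subrK S) addrC.
apply: le_trans (normcD_le _ _) _; apply: lerD; last exact: HD.
apply: le_trans (normc_sum _ _) _; rewrite mulrAC.
apply: box_sum_le => [|k].
  by rewrite !mulr_ge0// ?exprn_ge0// Cnorm_ge0.
rewrite 2!Normc.normcM normc_chr mulr1.
have w0 : 0 <= (wt k)%:R :> R by [].
have := coef_decay p f k; rewrite exprD => HC.
have HA := Ha (- k); rewrite wtN in HA.
have {}HA : Normc.normc (a (- k)) <= `|C| * (wt k)%:R ^+ q.
  by apply: le_trans HA _; rewrite ler_wpM2r ?exprn_ge0// ler_norm.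
apply: (@le_trans _ _ (`|C| * (Normc.normc (coef f k) *
    ((wt k)%:R ^+ q * (wt k)%:R ^+ (2 * n))))).
  rewrite [leRHS](_ : _ = (`|C| * (wt k)%:R ^+ q) *
    (Normc.normc (coef f k) * (wt k)%:R ^+ (2 * n))); last by ring.
  rewrite -[leLHS]mulrA; apply: ler_wpM2r => //.
  by rewrite mulr_ge0 ?normc_ge0// exprn_ge0.
rewrite /K -mulrA ler_wpM2l//; apply: le_trans HC _.
by rewrite -!mulrA.
Qed.

(** * The Diophantine condition *)

Definition psym (R : realType) (n m : nat)
  (c : {ffun 'I_n -> 'I_m.+1} -> R[i]) (A : R[i]) (k : 'rV[int]_n) : R[i] :=
  lsym c k - A.

(** The second diagonal entry of the block, produced by conjugating the equation at - k. *)
Definition psymJ (R : realType) (n m : nat)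
  (c : {ffun 'I_n -> 'I_m.+1} -> R[i]) (A : R[i]) (k : 'rV[int]_n) : R[i] :=
  conjc (psym c A (- k)).

(* The determinant of the system coupling the coefficient of u at k with the
   conjugate of its coefficient at - k. *)
Definition pdet (R : realType) (n m : nat)
  (c : {ffun 'I_n -> 'I_m.+1} -> R[i]) (A B : R[i]) (k : 'rV[int]_n) : R[i] :=
  psym c A k * psymJ c A k - B * conjc B.

(** One number serves as exponent and as threshold: enlarging p weakens both requirements, and a
    constant other than 1 is absorbed by one more power of a large weight. *)
Definition diophantine (R : realType) (n m : nat)
    (c : {ffun 'I_n -> 'I_m.+1} -> R[i]) (A B : R[i]) : Prop :=
  exists p : nat, forall k, (p <= wt k)%N ->
    1 <= Normc.normc (pdet c A B k) * (wt k)%:R ^+ p.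

Lemma poly_bounded_psym (R : realType) (n m : nat)
    (c : {ffun 'I_n -> 'I_m.+1} -> R[i]) A : poly_bounded (psym c A).
Proof.
by apply: poly_boundedD; [exact: poly_bounded_lsym|exact: poly_bounded_cst].
Qed.

Lemma conjcB (R : realType) (x y : R[i]) : conjc (x - y) = conjc x - conjc y.
Proof. exact: raddfB. Qed.

Lemma conj_block (R : realType) (s x b y : R[i]) :
  conjc (s * x - b * conjc y) = conjc s * conjc x - conjc b * y.
Proof. by rewrite conjcB !conjcM conjcK. Qed.

Lemma conj_blockD (R : realType) (s x b y : R[i]) :
  conjc (s * x + b * conjc y) = conjc s * conjc x + conjc b * y.
Proof. by rewrite conjcD !conjcM conjcK. Qed.

Lemma pdetN (R : realType) (n m : nat)
    (c : {ffun 'I_n -> 'I_m.+1} -> R[i]) A B k :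
  pdet c A B (- k) = conjc (pdet c A B k).
Proof.
rewrite /pdet /psymJ opprK; move: (psym c A k) (psym c A (- k)) => x y.
by rewrite conjcB !conjcM !conjcK; ring.
Qed.

(** Cramer's rule: the equation at k and the conjugated equation at - k are combined with the first
    row of the adjugate. *)
Lemma pdet_solve (R : realType) (n m : nat)
    (c : {ffun 'I_n -> 'I_m.+1} -> R[i]) A B (b f : 'rV[int]_n -> R[i]) :
  (forall k, f k = psym c A k * b k - B * conjc (b (- k))) ->
  forall k, pdet c A B k * b k = psymJ c A k * f k + B * conjc (f (- k)).
Proof.
move=> H k; rewrite !H opprK conjcB !conjcM conjcK /pdet -/(psymJ c A k).
by rewrite -/(psymJ c A k); ring.
Qed.

(** Dividing by the determinant costs p powers of the weight, which the rapid right-hand side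
    affords; the finitely many k of weight below p are covered by the sum over [box n p]. *)
Lemma rapid_of_pdet (R : realType) (n m : nat)
    (c : {ffun 'I_n -> 'I_m.+1} -> R[i]) A B (b f : 'rV[int]_n -> R[i]) :
  diophantine c A B -> rapid f ->
  (forall k, pdet c A B k * b k = psymJ c A k * f k + B * conjc (f (- k))) ->
  rapid b.
Proof.
move=> [p Hp] rf H q.
have rr : rapid (fun k => psymJ c A k * f k + B * conjc (f (- k))).
  apply: rapidD; apply: rapid_polyM => //.
  - by apply: poly_bounded_conjN; exact: poly_bounded_psym.
  - exact: poly_bounded_cst.
  - exact: rapid_conjN.
have [C HC] := rr (p + q)%N.
have S0 : 0 <= \sum_(l <- box n p) Normc.normc (b l) * (wt l)%:R ^+ q.
  by apply: sumr_ge0 => l _; rewrite mulr_ge0 ?normc_ge0// exprn_ge0.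
have C0 : 0 <= C.
  by apply: le_trans (HC 0); rewrite mulr_ge0 ?normc_ge0// exprn_ge0.
exists (C + \sum_(l <- box n p) Normc.normc (b l) * (wt l)%:R ^+ q) => k.
have [pk|kp] := leqP p (wt k).
  rewrite -[leLHS]addr0; apply: lerD => //; apply: le_trans (HC k).
  rewrite -H Normc.normcM exprD mulrACA ler_peMl ?Hp//.
  by rewrite mulr_ge0 ?normc_ge0// exprn_ge0.
rewrite -[leLHS]add0r; apply: lerD => //.
rewrite (bigD1_seq k) ?box_uniq ?wt_box//=; last exact: ltnW.
rewrite lerDl; apply: sumr_ge0 => l _.
by rewrite mulr_ge0 ?normc_ge0// exprn_ge0.
Qed.

Lemma diophantine_hypoelliptic (R : realType) (n m : nat)
    (c : {ffun 'I_n -> 'I_m.+1} -> R[i]) A B :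
  diophantine c A B -> globally_hypoelliptic (operPd c A B).
Proof.
move=> DC u du [f Hf]; have [lu _] := du.
have rb : rapid (dcoef u).
  apply: rapid_of_pdet DC (rapid_coef f) _; apply: pdet_solve => k.
  by rewrite -dcoef_dist_of -Hf dcoef_operPd.
exists (synthC rb); have dg := dist_of_distribution (synthC rb).
apply: dcoef_inj => //; [exact: dg.1|exact: distribution_fourier_cont|
  exact: distribution_fourier_cont|] => k.
by rewrite dcoef_dist_of coef_synthC.
Qed.

Lemma diophantine_solvable (R : realType) (n m : nat)
    (c : {ffun 'I_n -> 'I_m.+1} -> R[i]) A B :
  diophantine c A B -> solvable (operP c A B).
Proof.
move=> DC; have [p Hp] := DC.
(* The blocks are invertible from weight p on. As k and - k have the same weight, the excluded
   frequencies fill whole blocks, and u can consistently be given zero coefficients there. *)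
pose F : {pred Cinf R n} :=
  fun f => `[< forall k, (wt k < p)%N -> coef f k = 0 >].
exists F; split.
- split; first by apply/asboolP => k _; exact: coef_Cinf0.
  move=> a f g /asboolP Hf /asboolP Hg; apply/asboolP => k kp.
  by rewrite coef_CinfZD Hf// Hg// mulr0 addr0.
- exists [seq chrC R k | k <- box n p] => f; exists (f - truncC p f).
    apply/asboolP => k kp; rewrite coef_CinfD coef_CinfN coef_truncC.
    by rewrite wt_box ?subrr// ltnW.
  exists (fun i => coef f (nth 0 (box n p) i)).
  rewrite -[LHS](subrK (truncC p f)); congr (_ + _).
  rewrite -(big_mkord xpredT (fun i => coef f (nth 0 (box n p) i) *:
    [seq chrC R k | k <- box n p]`_i)) size_map /truncC.
  rewrite [LHS](big_nth 0) !big_nat; apply: eq_bigr => i /andP[_ ip].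
  by rewrite (@nth_map _ (0 : 'rV[int]_n) _ 0 (@chrC R n) i (box n p) ip).
move=> f /asboolP Hf.
pose r k := psymJ c A k * coef f k + B * conjc (coef f (- k)).
pose b k := if (wt k < p)%N then 0 else r k / pdet c A B k.
have det0 k : (p <= wt k)%N -> pdet c A B k != 0.
  move=> /Hp; apply: contraTneq => ->; rewrite Normc.normc0 mul0r.
  by rewrite -ltNge ltr01.
have rb : rapid b.
  apply: rapid_of_pdet DC (rapid_coef f) _ => k; rewrite /b.
  case: ltnP => kp; last by rewrite mulrC divfK// det0.
  by rewrite !Hf ?wtN// conjc0 !mulr0 addr0.
exists (synthC rb); apply: Cinf_inj => k.
rewrite coef_operP !coef_synthC /b wtN; case: ltnP => kp.
  by rewrite Hf// conjc0 !mulr0 subr0.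
have D0 := det0 k kp.
(* By [pdetN], conjugating the formula at - k gives the second component of Cramer's solution at k;
   what remains is a field identity. *)
have -> : conjc (r (- k) / pdet c A B (- k)) =
    (psym c A k * conjc (coef f (- k)) + conjc B * coef f k) / pdet c A B k.
  rewrite pdetN conjcM conjc_inv conjcK /r opprK conj_blockD.
  by rewrite /psymJ opprK conjcK.
rewrite /r -/(psym c A k); move: D0; rewrite /pdet.
move: (psym c A k) (psymJ c A k) (coef f k) (conjc (coef f (- k))) => s d x y D0.
by field.
Qed.

(** * Almost singular blocks and sparse sequences of frequencies *)

Definition pblock_null (R : realType) (s d B v w : R[i]) (e : R) : Prop :=
  Normc.normc (s * v - B * w) <= e /\ Normc.normc (d * w - conjc B * v) <= e.

Definition pblock_far (R : realType) (s d B F G : R[i]) (r : R) : Prop :=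
  forall v w, s * v - B * w = F -> d * w - conjc B * v = G ->
    r <= Normc.normc v \/ r <= Normc.normc w.

(* [v] and [w] serve to refute hypoellipticity, [F] and [G] solvability. *)
Definition bad_frequency (R : realType) (n m : nat)
    (c : {ffun 'I_n -> 'I_m.+1} -> R[i]) (A B : R[i]) (r C : R) (q p : nat)
    (k : 'rV[int]_n) : Prop :=
  (exists v w, [/\ Normc.normc v <= C * (wt k)%:R ^+ q,
      Normc.normc w <= C * (wt k)%:R ^+ q,
      r <= Normc.normc v \/ r <= Normc.normc w &
      pblock_null (psym c A k) (psymJ c A k) B v w ((wt k)%:R ^+ p)^-1]) /\
  (exists F G, [/\ Normc.normc F <= ((wt k)%:R ^+ p)^-1,
      Normc.normc G <= ((wt k)%:R ^+ p)^-1 &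
      pblock_far (psym c A k) (psymJ c A k) B F G r]).

Lemma wtX_gt0 (R : realType) (n p : nat) (k : 'rV[int]_n) :
  0 < (wt k)%:R ^+ p :> R.
Proof. by rewrite exprn_gt0// ltr0n. Qed.

(** The block is diagonal. Failure is used with exponent p + p, so that a product below W^-2, with W
    the p-th power of the weight, forces one diagonal entry below W^-1. The matching basis vector is
    almost annihilated, and W^-1 times it is a right-hand side whose solution has size at least
    1. *)
Lemma bad_frequencies_B0 (R : realType) (n m : nat)
    (c : {ffun 'I_n -> 'I_m.+1} -> R[i]) A :
  ~ diophantine c A 0 ->
  forall p, exists k, (p <= wt k)%N /\ bad_frequency c A 0 1 1 0 p k.
Proof.
move=> nD p.
have [k /not_implyP[kp /negP]] : exists k, ~ ((p + p <= wt k)%N ->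
    1 <= Normc.normc (pdet c A 0 k) * (wt k)%:R ^+ (p + p)).
  by apply/existsNP => H; apply: nD; exists (p + p)%N.
rewrite -ltNge /pdet mul0r subr0 Normc.normcM exprD mulrACA => small.
exists k; split; first by rewrite (leq_trans _ kp)// leq_addr.
have W0 := wtX_gt0 R p k; set W := (wt k)%:R ^+ p in small W0 *.
have Wi : Normc.normc (W^-1)%:C = W^-1.
  by rewrite normc_realC ger0_norm// invr_ge0 ltW.
set s := psym c A k in small *; set d := psymJ c A k in small *.
have far (x v : R[i]) : Normc.normc x * W < 1 -> x * v = (W^-1)%:C ->
    1 <= Normc.normc v.
  move=> xW E; have xv : Normc.normc x * Normc.normc v = W^-1.
    by rewrite -Normc.normcM E.
  have x0 : 0 < Normc.normc x.
    rewrite lt_neqAle normc_ge0 andbT; apply/eqP => x0.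
    by move: xv; rewrite -x0 mul0r => /esym/eqP; rewrite invr_eq0 gt_eqF.
  rewrite -(ler_pM2l x0) mulr1 xv -[leRHS]mul1r ler_pdivlMr//; exact: ltW.
have Wi0 : 0 <= W^-1 by rewrite invr_ge0 ltW.
have [sW|Ws] := ltP (Normc.normc s * W) 1.
- split.
    exists 1, 0; rewrite expr0 mulr1 Normc.normc1 Normc.normc0; split=> //.
      by left.
    split; rewrite !mulr0 ?subr0 ?conjc0 ?mul0r ?subr0 ?Normc.normc0//.
    by rewrite mulr1 -[leRHS]mul1r ler_pdivlMr// ltW.
  exists (W^-1)%:C, 0; rewrite Wi Normc.normc0; split=> // v w.
  by rewrite mul0r subr0 => /(far _ _ sW); left.
- have dW : Normc.normc d * W < 1.
    rewrite ltNge; apply/negP => Wd; move: small; rewrite ltNge => /negP; apply.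
    by rewrite -[leLHS]mulr1; apply: ler_pM.
  split.
    exists 0, 1; rewrite expr0 mulr1 Normc.normc1 Normc.normc0; split=> //.
      by right.
    split; rewrite !mulr0 ?mul0r ?subr0 ?Normc.normc0//.
    by rewrite mulr1 -[leRHS]mul1r ler_pdivlMr// ltW.
  exists 0, (W^-1)%:C; rewrite Wi Normc.normc0; split=> // v w _.
  by rewrite conjc0 mul0r subr0 => /(far _ _ dW); right.
Qed.

Lemma bad_frequencies_Bn0 (R : realType) (n m : nat)
    (c : {ffun 'I_n -> 'I_m.+1} -> R[i]) A B :
  B != 0 -> ~ diophantine c A B ->
  exists (C : R) (q : nat), forall p, exists k, (p <= wt k)%N /\
    bad_frequency c A B (Normc.normc B) C q p k.
Proof.
move=> B0 nD.
have [C [q HC]] := poly_bounded_conjN (poly_bounded_psym c A).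
have C0 : 0 <= C.
  rewrite -(pmulr_lge0 _ (wtX_gt0 R q (0 : 'rV[int]_n))).
  exact: le_trans (normc_ge0 _) (HC 0).
exists (C + Normc.normc B), q => p.
have [k /not_implyP[kp /negP]] : exists k, ~ ((p <= wt k)%N ->
    1 <= Normc.normc (pdet c A B k) * (wt k)%:R ^+ p).
  by apply/existsNP => H; apply: nD; exists p.
rewrite -ltNge => small; exists k; split=> //.
have W0 := wtX_gt0 R p k; set W := (wt k)%:R ^+ p in small W0 *.
have Wi : Normc.normc (W^-1)%:C = W^-1.
  by rewrite normc_realC ger0_norm// invr_ge0 ltW.
have Wi0 : 0 <= W^-1 by rewrite invr_ge0 ltW.
have Bg : 0 < Normc.normc B by rewrite normc_gt0.
have wq1 : 1 <= (wt k)%:R ^+ q :> R by rewrite exprn_ege1// ler1n.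
have wq0 := le_trans ler01 wq1.
have HCk : Normc.normc (psymJ c A k) <= C * (wt k)%:R ^+ q := HC k.
split.
  exists (psymJ c A k), (conjc B); split.
  - by apply: le_trans HCk _; rewrite ler_wpM2r// lerDl normc_ge0.
  - rewrite normc_conj; apply: (@le_trans _ _ (Normc.normc B * (wt k)%:R ^+ q)).
      by rewrite ler_peMr// ltW.
    by rewrite ler_wpM2r// lerDr.
  - by right; rewrite normc_conj.
  split; last by rewrite [X in _ - X]mulrC subrr Normc.normc0.
  by rewrite -/(pdet c A B k) -[leRHS]mul1r ler_pdivlMr// ltW.
exists (W^-1)%:C, 0; rewrite Wi Normc.normc0; split=> // v w E1 E2; right.
have : pdet c A B k * w = conjc B * (W^-1)%:C.
  rewrite -E1; transitivity (conjc B * (psym c A k * v - B * w) +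
    psym c A k * (psymJ c A k * w - conjc B * v)); first by rewrite /pdet; ring.
  by rewrite E2 mulr0 addr0.
move=> /(congr1 (@Normc.normc R)); rewrite !Normc.normcM Wi normc_conj => E.
have D0 : 0 < Normc.normc (pdet c A B k).
  rewrite lt_neqAle normc_ge0 andbT; apply/eqP => D0.
  have : 0 < Normc.normc B * W^-1 by rewrite mulr_gt0// invr_gt0.
  by rewrite -E -D0 mul0r ltxx.
rewrite -(ler_pM2l D0) E mulrC ler_wpM2l ?normc_ge0//.
by rewrite -[leRHS]mul1r ler_pdivlMr// ltW.
Qed.

Lemma bad_frequencies (R : realType) (n m : nat)
    (c : {ffun 'I_n -> 'I_m.+1} -> R[i]) A B :
  ~ diophantine c A B ->
  exists (r C : R) (q : nat), 0 < r /\ forall p, exists k, (p <= wt k)%N /\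
    bad_frequency c A B r C q p k.
Proof.
have [->|B0] := eqVneq B 0 => nD.
  by exists 1, 1, 0%N; split=> //; exact: bad_frequencies_B0.
have [C [q H]] := bad_frequencies_Bn0 B0 nD.
by exists (Normc.normc B), C, q; split=> //; rewrite normc_gt0.
Qed.

(** [lev i] is the exponent for which [kap i] is bad. Strictly increasing weights keep the pairs k,
    - k of different indices disjoint, and a level of at least 2 excludes k = 0, the frequency equal
    to its opposite. *)
Definition sparse (n : nat) (kap : nat -> 'rV[int]_n) (lev : nat -> nat) : Prop :=
  [/\ forall i, (i.+2 <= lev i)%N, forall i, (lev i <= wt (kap i))%N &
      forall i j, (i < j)%N -> (wt (kap i) < wt (kap j))%N].

Lemma sparse_choice (n : nat) (P : nat -> 'rV[int]_n -> Prop) :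
  (forall p, exists k, (p <= wt k)%N /\ P p k) ->
  exists kap lev, sparse kap lev /\ forall i, P (lev i) (kap i).
Proof.
move=> /choice[K HK].
(* Each level exceeds the weight of the previous frequency, which forces the weights to increase. *)
pose st i := iter i (fun p => (wt (K p)).+1) 2%N.
have stS i : st i.+1 = (wt (K (st i))).+1 by [].
have mono i j : (i < j)%N -> (wt (K (st i)) < wt (K (st j)))%N.
  elim: j => // j IH; rewrite ltnS leq_eqVlt => /orP[/eqP->|/IH ij].
    by have [] := HK (st j.+1); rewrite stS.
  by apply: ltn_trans ij _; have [] := HK (st j.+1); rewrite stS.
exists (fun i => K (st i)), st; split; last by move=> i; have [] := HK (st i).
split=> // [|i]; last by have [] := HK (st i).
elim=> // i IH; rewrite stS ltnS; apply: leq_trans IH _.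
by have [] := HK (st i).
Qed.

Lemma sparse_inj (n : nat) (kap : nat -> 'rV[int]_n) lev :
  sparse kap lev -> injective kap.
Proof.
move=> [_ _ mono] i j E; have [ij|ji|//] := ltngtP i j.
  by have := mono _ _ ij; rewrite E ltnn.
by have := mono _ _ ji; rewrite E ltnn.
Qed.

Lemma sparse_opp (n : nat) (kap : nat -> 'rV[int]_n) lev i j :
  sparse kap lev -> kap i <> - kap j.
Proof.
move=> sp E; have [l2 lw mono] := sp.
have ij : i = j.
  have [ij|ji|//] := ltngtP i j.
    by have := mono _ _ ij; rewrite E wtN ltnn.
  by have := mono _ _ ji; rewrite E wtN ltnn.
have := leq_trans (l2 i) (lw i); rewrite /wt big1// => l _.
have := congr1 (fun k : 'rV[int]_n => k ord0 l) E; rewrite mxE -ij.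
by move: (kap i ord0 l) => z; lia.
Qed.

Lemma sparse_spread (R : realType) (n : nat) (kap : nat -> 'rV[int]_n) lev
    (v w : nat -> R[i]) : sparse kap lev ->
  exists b : 'rV[int]_n -> R[i], [/\ forall i, b (kap i) = v i,
    forall i, b (- kap i) = w i &
    forall k, (forall i, k <> kap i /\ k <> - kap i) -> b k = 0].
Proof.
move=> sp.
have : forall k, exists z : R[i], [/\ forall i, k = kap i -> z = v i,
    forall i, k = - kap i -> z = w i &
    (forall i, k <> kap i /\ k <> - kap i) -> z = 0].
  move=> k; have [[i ki]|nk] := pselect (exists i, k = kap i).
    exists (v i); split=> [j|j|/(_ i)[]//].
      by rewrite ki => /(sparse_inj sp) ->.
    by rewrite ki => /(sparse_opp sp).
  have [[i ki]|nk'] := pselect (exists i, k = - kap i).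
    exists (w i); split=> [j|j|/(_ i)[]//].
      by rewrite ki => /esym/(sparse_opp sp).
    by rewrite ki => /oppr_inj/(sparse_inj sp) ->.
  exists 0; split=> // i ki; [by case: nk; exists i|by case: nk'; exists i].
move=> /choice[b Hb]; exists b; split=> [i|i|k].
- by have [+ _ _] := Hb (kap i); apply.
- by have [_ + _] := Hb (- kap i); apply.
- by have [_ _ +] := Hb k; apply.
Qed.

Lemma sparse_cases (n : nat) (kap : nat -> 'rV[int]_n) (k : 'rV[int]_n) :
  [\/ exists i, k = kap i, exists i, k = - kap i |
      forall i, k <> kap i /\ k <> - kap i].
Proof.
have [H|nk] := pselect (exists i, k = kap i); first exact: Or31.
have [H|nk'] := pselect (exists i, k = - kap i); first exact: Or32.
by apply: Or33 => i; split=> ki; [apply: nk; exists i|apply: nk'; exists i].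
Qed.

Lemma sparse_rapid (R : realType) (n : nat) (kap : nat -> 'rV[int]_n) lev
    (b : 'rV[int]_n -> R[i]) : sparse kap lev ->
  (forall i, Normc.normc (b (kap i)) <= ((wt (kap i))%:R ^+ lev i)^-1) ->
  (forall i, Normc.normc (b (- kap i)) <= ((wt (kap i))%:R ^+ lev i)^-1) ->
  (forall k, (forall i, k <> kap i /\ k <> - kap i) -> b k = 0) ->
  rapid b.
Proof.
(* If [lev i >= q] the product is at most 1; otherwise i < q, and the weight of [kap i] is below
   that of [kap q]. *)
move=> [l2 lw mono] H1 H2 H3 q; exists (1 + (wt (kap q))%:R ^+ q) => k.
have bnd i x : x <= ((wt (kap i))%:R ^+ lev i)^-1 :> R ->
    x * (wt (kap i))%:R ^+ q <= 1 + (wt (kap q))%:R ^+ q.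
  move=> hx; have W0 := wtX_gt0 R (lev i) (kap i).
  have W1 : 1 <= (wt (kap i))%:R :> R by rewrite ler1n.
  apply: le_trans (ler_wpM2r (ltW (wtX_gt0 R q (kap i))) hx) _.
  have [ql|lq] := leqP q (lev i).
    rewrite -[leLHS]addr0 lerD ?exprn_ge0// mulrC ler_pdivrMr// mul1r.
    by rewrite ler_weXn2l.
  rewrite -[leLHS]add0r lerD//.
  apply: (@le_trans _ _ ((wt (kap i))%:R ^+ q)).
    by rewrite ler_piMl ?exprn_ge0// invf_le1// exprn_ege1.
  rewrite lerXn2r ?nnegrE// ler_nat ltnW// mono//.
  by have := l2 i; lia.
case: (sparse_cases kap k) => [[i ->]|[i ->]|/H3 ->].
- exact: bnd.
- by rewrite wtN; exact: bnd.
by rewrite Normc.normc0 mul0r addr_ge0// exprn_ge0.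
Qed.

Lemma sparse_poly_bounded (R : realType) (n : nat) (kap : nat -> 'rV[int]_n)
    (b : 'rV[int]_n -> R[i]) (C : R) q :
  (forall i, Normc.normc (b (kap i)) <= C * (wt (kap i))%:R ^+ q) ->
  (forall i, Normc.normc (b (- kap i)) <= C * (wt (kap i))%:R ^+ q) ->
  (forall k, (forall i, k <> kap i /\ k <> - kap i) -> b k = 0) ->
  poly_bounded b.
Proof.
move=> H1 H2 H3; exists C, q => k.
have C0 : 0 <= C.
  rewrite -(pmulr_lge0 _ (wtX_gt0 R q (kap 0%N))).
  exact: le_trans (normc_ge0 _) (H1 0%N).
case: (sparse_cases kap k) => [[i ->]|[i ->]|/H3 ->].
- exact: H1.
- by rewrite wtN.
by rewrite Normc.normc0 mulr_ge0// exprn_ge0.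
Qed.

Lemma sparse_not_rapid (R : realType) (n : nat) (kap : nat -> 'rV[int]_n) lev
    (b : 'rV[int]_n -> R[i]) (r : R) : sparse kap lev -> 0 < r ->
  (forall i0, exists2 i, (i0 <= i)%N &
    r <= Normc.normc (b (kap i)) \/ r <= Normc.normc (b (- kap i))) ->
  ~ rapid b.
Proof.
move=> [l2 lw _] r0 H /(_ 1%N)[C HC].
have [i Ci Hi] := H (Num.bound (`|C| / r)).
have := archi_boundP (x := `|C| / r) _.
rewrite divr_ge0// ?ltW// => /(_ isT) HB.
have : C < r * (wt (kap i))%:R.
  apply: le_lt_trans (ler_norm C) _; rewrite mulrC -ltr_pdivrMr//.
  apply: lt_le_trans HB _; rewrite ler_nat (leq_trans Ci)//.
  by have := l2 i; have := lw i; lia.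
rewrite ltNge => /negP; apply; case: Hi => Hi.
  by apply: le_trans (HC (kap i)); rewrite expr1 ler_wpM2r.
by apply: le_trans (HC (- kap i)); rewrite wtN expr1 ler_wpM2r.
Qed.

(** * Necessity of the Diophantine condition *)

Lemma hypoelliptic_diophantine (R : realType) (n m : nat)
    (c : {ffun 'I_n -> 'I_m.+1} -> R[i]) A B :
  globally_hypoelliptic (operPd c A B) -> diophantine c A B.
Proof.
move=> GH; apply: contrapT => /bad_frequencies[r [C [q [r0 H]]]].
have [kap [lev [sp Hbad]]] := sparse_choice H.
have /choice[v /choice[w Hvw]] := fun i => (Hbad i).1.
(* The second unknown of a block is the conjugate of the coefficient at - k, hence the conjugation
   of [w i]. *)
have [b [bv bw b0]] := sparse_spread v (fun i => conjc (w i)) sp.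
have pb : poly_bounded b.
  apply: (sparse_poly_bounded (C := C) (q := q)) b0 => i.
    by rewrite bv; have [] := Hvw i.
  by rewrite bw normc_conj; have [] := Hvw i.
have [u du ub] := distribution_of_coef pb.
pose b' k := psym c A k * b k - B * conjc (b (- k)).
have rb' : rapid b'.
  apply: (sparse_rapid sp) => [i|i|k Hk]; rewrite /b'.
  - by rewrite bv bw conjcK; have [_ _ _ []] := Hvw i.
  - rewrite opprK bv bw -normc_conj conjcB !conjcM !conjcK.
    by rewrite -/(psymJ c A (kap i)); have [_ _ _ []] := Hvw i.
  - rewrite !b0// ?conjc0 ?mulr0 ?subr0// => i; have [h1 h2] := Hk i.
    by split=> E; [apply: h2; rewrite -E opprK|apply: h1; rewrite -[LHS]opprK E opprK].
have [lu cu] := (du.1, distribution_fourier_cont du).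
have [lP cP] := operPd_cont c A B lu cu.
have df := dist_of_distribution (synthC rb').
have [|g Eg] := GH u du.
  exists (synthC rb'); apply: dcoef_inj => //; first exact: df.1.
    exact: distribution_fourier_cont.
  by move=> k; rewrite dcoef_operPd// dcoef_dist_of coef_synthC !ub.
have /funext E : b =1 coef g by move=> k; rewrite -ub Eg dcoef_dist_of.
have := rapid_coef g; rewrite -E; apply: (sparse_not_rapid sp r0) => i.
by exists i => //; rewrite bv bw normc_conj; have [] := Hvw i.
Qed.

Lemma left_kernel (R : realType) (q N : nat) (M : 'M[R]_(q, N)) : (N < q)%N ->
  exists2 t : 'rV[R]_q, t != 0 & t *m M = 0.
Proof.
move=> Nq; have : kermx M != 0.
  rewrite kermx_eq0 /row_free neq_ltn.
  by rewrite (leq_ltn_trans (rank_leq_col M) Nq).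
by move=> /rowV0Pn[t /sub_kermxP tM t0]; exists t.
Qed.

Lemma solvable_diophantine (R : realType) (n m : nat)
    (c : {ffun 'I_n -> 'I_m.+1} -> R[i]) A B :
  solvable (operP c A B) -> diophantine c A B.
Proof.
move=> [V [[V0 VZD] [s Hs] HV]].
apply: contrapT => /bad_frequencies[r [C [q0 [r0 H]]]].
have [kap [lev [sp Hbad]]] := sparse_choice H.
have /choice[F /choice[G HFG]] := fun i => (Hbad i).2.
pose N := size s; pose q := (N + N).+1.
(* The j-th function lives on the indices congruent to j modulo q, so that the functions have
   disjoint spectra, each meeting infinitely many bad frequencies. *)
have Hf (j : 'I_q) : exists f : Cinf R n, forall i,
    coef f (kap i) = (if (i %% q == j)%N then F i else 0) /\
    coef f (- kap i) = conjc (if (i %% q == j)%N then G i else 0).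
  have [b [bF bG b0]] := sparse_spread
    (fun i => if (i %% q == j)%N then F i else 0)
    (fun i => conjc (if (i %% q == j)%N then G i else 0)) sp.
  have rb : rapid b.
    apply: (sparse_rapid sp) b0 => i.
      rewrite bF; case: ifP => _; last by rewrite Normc.normc0.
      by have [] := HFG i.
    rewrite bG normc_conj; case: ifP => _; last by rewrite Normc.normc0.
    by have [] := HFG i.
  by exists (synthC rb) => i; rewrite !coef_synthC bF bG.
have /choice[f Ef] := Hf.
have Hd j : exists hb : Cinf R n * ('I_N -> R[i]), hb.1 \in V /\
    f j = hb.1 + \sum_(i < N) hb.2 i *: s`_i.
  by have [h hV [b E]] := Hs (f j); exists (h, b).
have /choice[hb Ehb] := Hd.
(* Real and imaginary parts of the N coordinates modulo [V] form 2 N real columns, so the 2 N + 1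
   rows are dependent over the reals. *)
pose M : 'M[R]_(q, N + N) :=
  row_mx (\matrix_(j, i) complex.Re ((hb j).2 i))
         (\matrix_(j, i) complex.Im ((hb j).2 i)).
have [t t0 tM] := @left_kernel R q _ M (ltnSn _).
have tb (i : 'I_N) : \sum_j (t ord0 j)%:C * (hb j).2 i = 0.
  rewrite sumC; apply/eqP; rewrite eq_complex /=; apply/andP; split; apply/eqP.
    have := congr1 (fun X : 'rV_(N + N) => X ord0 (lshift N i)) tM.
    rewrite !mxE => E; rewrite -[RHS]E; apply: eq_bigr => j _.
    by rewrite row_mxEl mxE; case: ((hb j).2 i) => x y /=; rewrite mul0r subr0.
  have := congr1 (fun X : 'rV_(N + N) => X ord0 (rshift N i)) tM.
  rewrite !mxE => E; rewrite -[RHS]E; apply: eq_bigr => j _.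
  by rewrite row_mxEr mxE; case: ((hb j).2 i) => x y /=; rewrite mul0r addr0.
(* The relation [tb] removes the part along [s], so this combination lies in [V]. Its coefficients
   being real, conjugation fixes them, and both components of a block are multiplied by the same
   scalar. *)
pose g : Cinf R n := \sum_j (t ord0 j)%:C *: f j.
have gV : g \in V.
  have -> : g = \sum_j (t ord0 j)%:C *: (hb j).1.
    rewrite /g; under eq_bigr => j _ do rewrite (Ehb j).2 scalerDr scaler_sumr.
    rewrite big_split /= exchange_big /= [X in _ + X]big1 ?addr0// => i _.
    under eq_bigr do rewrite scalerA.
    by rewrite -scaler_suml tb scale0r.
  elim/big_rec: _ => // j y _ yV; apply: VZD => //; exact: (Ehb j).1.
have [u Pu] := HV g gV.
have [j tj] : exists j, t ord0 j != 0.
  apply/existsP; apply: contraNT t0; rewrite negb_exists => /forallP t0.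
  apply/eqP/rowP => j; rewrite [RHS]mxE; apply/eqP.
  by have := t0 j; rewrite negbK.
set tc := (t ord0 j)%:C.
have tc0 : tc != 0 by rewrite eq_complex /= (negPf tj).
have gk (k : 'rV[int]_n) : coef g k = \sum_j (t ord0 j)%:C * coef (f j) k.
  by rewrite coef_Cinf_sum; apply: eq_bigr => l _; rewrite coef_CinfZ.
have gF i : (i %% q == j)%N ->
    coef g (kap i) = tc * F i /\ conjc (coef g (- kap i)) = tc * G i.
  move=> /eqP ij; rewrite !gk; split.
    rewrite (bigD1 j)//= (Ef j i).1 ij eqxx big1 ?addr0// => l lj.
    by rewrite (Ef l i).1 ij (inj_eq val_inj) eq_sym (negPf lj) mulr0.
  rewrite (bigD1 j)//= (Ef j i).2 ij eqxx big1 ?addr0 => [|l lj].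
    by rewrite conjcM conjcK conjc_real.
  by rewrite (Ef l i).2 ij (inj_eq val_inj) eq_sym (negPf lj) conjc0 mulr0.
have T0 : 0 < Normc.normc tc by rewrite normc_gt0.
have := rapid_coef u; apply: (sparse_not_rapid sp (mulr_gt0 T0 r0)) => i0.
(* An index beyond i0 in the class of j; there only the term [t ord0 j] of the combination
   contributes. *)
pose i := (j + q * i0)%N.
exists i; first by rewrite /i; nia.
have ij : (i %% q == j)%N by rewrite /i mulnC addnC modnMDl modn_small.
have [E1 E2] := gF i ij; have [_ _ far] := HFG i.
have sys k : coef g k = psym c A k * coef u k - B * conjc (coef u (- k)).
  by rewrite -Pu coef_operP.
(* Dividing the coefficients of u by [tc] gives a solution of the block with right-hand side [F i],
   [G i], to which the lower bound r applies. *)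
have F1 : psym c A (kap i) * (tc^-1 * coef u (kap i)) -
    B * (tc^-1 * conjc (coef u (- kap i))) = F i.
  by apply: (mulfI tc0); rewrite -E1 sys mulrBr; congr (_ - _);
    rewrite mulrCA mulVKf.
have F2 : psymJ c A (kap i) * (tc^-1 * conjc (coef u (- kap i))) -
    conjc B * (tc^-1 * coef u (kap i)) = G i.
  apply: (mulfI tc0); rewrite -E2 sys opprK conj_block mulrBr.
  rewrite -/(psymJ c A (kap i)).
  by congr (_ - _); rewrite mulrCA mulVKf.
have scale z : r <= Normc.normc (tc^-1 * z) ->
    Normc.normc tc * r <= Normc.normc z.
  by rewrite Normc.normcM Normc.normcV ler_pdivlMl.
by case: (far _ _ F1 F2) => /scale H'; [left|right; rewrite normc_conj in H'].
Qed.

Theorem corollary3 (R : realType) (n m : nat) (hn : (1 <= n)%N)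
    (c : {ffun 'I_n -> 'I_m.+1} -> R[i]%C) (A B : R[i]%C) :
  solvable (operP c A B) <-> globally_hypoelliptic (operPd c A B).
Proof.
split=> [/solvable_diophantine|/hypoelliptic_diophantine].
  exact: diophantine_hypoelliptic.
exact: diophantine_solvable.
Qed.
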